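(* Let $s\in[0,1]$. (i) Suppose that $\mathbf Z$ is diagonalizable, and let $X,Y$ be first-order polynomials in $a$ and $a^\dagger$ such that, for some $\lambda,\mu\in\mathbb C$, $$L^{(s)}(\rho^{s/2}X\rho^{(1-s)/2})=\lambda\,\rho^{s/2}X\rho^{(1-s)/2},\qquad L^{(s)}(\rho^{s/2}Y\rho^{(1-s)/2})=\mu\,\rho^{s/2}Y\rho^{(1-s)/2}.$$ Then for all $n,m\in\mathbb N$, $$L^{(s)}(\rho^{s/2}X^nY^m\rho^{(1-s)/2})=(n\lambda+m\mu)\,\rho^{s/2}X^nY^m\rho^{(1-s)/2}+\rho^{s/2}R_{n,m}\rho^{(1-s)/2},$$ where $R_{n,m}\in\operatorname{span}\{X^iY^j:i+j\le n+m-2\}$ when $n+m\ge2$, and $R_{n,m}=0$ otherwise. Moreover, every number $n\lambda+m\mu$ with $n,m\in\mathbb N$ is an eigenvalue of $L^{(s)}$. (ii) Suppose that $\mathbf Z$ is defective (not diagonalizable), and let $X,Y$ be first-order polynomials in $a$ and $a^\dagger$ such that, for some $\lambda\in\mathbb C$, $$L^{(s)}(\rho^{s/2}X\rho^{(1-s)/2})=\lambda\,\rho^{s/2}X\rho^{(1-s)/2},\qquad L^{(s)}(\rho^{s/2}Y\rho^{(1-s)/2})=\lambda\,\rho^{s/2}Y\rho^{(1-s)/2}-\rho^{s/2}X\rho^{(1-s)/2}.$$ Then for all $n,m\in\mathbb N$, $$L^{(s)}(\rho^{s/2}X^nY^m\rho^{(1-s)/2})=(n+m)\lambda\,\rho^{s/2}X^nY^m\rho^{(1-s)/2}-m\,\rho^{s/2}X^{n+1}Y^{m-1}\rho^{(1-s)/2}+\rho^{s/2}R_{n,m}\rho^{(1-s)/2}$$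 (the middle term being $0$ when $m=0$), where $R_{n,m}\in\operatorname{span}\{X^iY^j:i+j\le n+m-2\}$ when $n+m\ge2$, and $R_{n,m}=0$ otherwise. Furthermore, every $n\lambda$ with $n\in\mathbb N$ is an eigenvalue of $L^{(s)}$.
   Context: $\mathbb N=\{0,1,2,\dots\}$. $\mathsf h=\Gamma(\mathbb C)$ is the one-mode bosonic Fock space with orthonormal basis $(e_n)_{n\ge0}$; $ae_n=\sqrt n\,e_{n-1}$ ($ae_0=0$), $a^\dagger e_n=\sqrt{n+1}\,e_{n+1}$, $N=a^\dagger a$; $W(z)=\exp(za^\dagger-\overline z a)$, $z\in\mathbb C$. $\mathcal B(\mathsf h)$, $\mathcal B_2(\mathsf h)$ are the bounded and Hilbert--Schmidt operators, with $\langle X,Y\rangle_2=\mathrm{Tr}(X^*Y)$. Gaussian QMS: let $\Omega\in\mathbb R$, $\kappa,\zeta,u_1,u_2,v_1,v_2\in\mathbb C$, $\gamma=\frac12\sum_{\ell=1}^2(|v_\ell|^2-|u_\ell|^2)$, and define real-linear operators on $\mathbb C$ by $Zz=(\mathrm i\Omega-\gamma)z+\mathrm i\kappa\overline z$ and $Cz=\sum_{\ell=1}^2\big((|u_\ell|^2+|v_\ell|^2)z+2v_\ell u_\ell\overline z\big)$. The Gaussian quantum Markov semigroup $(\mathcal T_t)_{t\ge0}$ is the weak$^*$-continuous semigroup of normal, completely positive, identity-preserving maps on $\mathcal B(\mathsf h)$ determined by $$\mathcal T_t(W(z))=\exp\Big\{-\tfrac12\int_0^t\Re\big(\overline{e^{rZ}z}\,C(e^{rZ}z)\big)dr+\mathrm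 i\int_0^t\Re\big(\overline\zeta\,e^{rZ}z\big)dr\Big\}W(e^{tZ}z).$$ Drift matrix: $\mathbf Z=\begin{pmatrix}-\gamma-\Im\kappa&\Re\kappa-\Omega\\ \Re\kappa+\Omega&-\gamma+\Im\kappa\end{pmatrix}$. Standing assumptions: $\mathbf Z$ is stable (eigenvalues with strictly negative real parts); the unique normal invariant state $\rho$ is faithful; and (standardization) $\zeta=0$, $\kappa=\mathrm i\tanh(\beta/2)\sum_\ell u_\ell v_\ell$ with $\beta=-\log\big(\sum_\ell|u_\ell|^2/\sum_\ell|v_\ell|^2\big)>0$, so that $\rho=(1-e^{-\beta})e^{-\beta N}$. Induced semigroup: for $s\in[0,1]$, $T_t^{(s)}(\rho^{s/2}X\rho^{(1-s)/2})=\rho^{s/2}\mathcal T_t(X)\rho^{(1-s)/2}$, $X\in\mathcal B(\mathsf h)$, extends uniquely to a strongly continuous contraction semigroup on $\mathcal B_2(\mathsf h)$, with generator $L^{(s)}$. For a polynomial $P$ in $a,a^\dagger$, $\rho^{s/2}P\rho^{(1-s)/2}$ is initially defined on the span of the $e_n$ and denotes its Hilbert--Schmidt extension; it belongs to $\operatorname{Dom}L^{(s)}$. A first-order polynomial is one of total degree exactly one. Convention $X^0=Y^0=\mathbf 1$. *)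

(* Defs.v *)
From HB Require Import structures.
From mathcomp Require Import all_boot all_order all_algebra complex.
From mathcomp Require Import ring.
From mathcomp Require Import all_classical all_reals all_analysis.

Set Implicit Arguments.
Unset Strict Implicit.
Unset Printing Implicit Defensive.

Import Order.TTheory GRing.Theory Num.Theory numFieldNormedType.Exports.

Local Open Scope classical_set_scope.
Local Open Scope ring_scope.
Local Open Scope complex_scope.

(* R[i] is a numFieldType; these instances equip the bare type (rather than
   R[i]^o) with its usual topology and with the structure of a normed module
   over itself. *)
Section ComplexTopology.
Variable R : realType.
HB.instance Definition _ := PseudoPointedMetric.copy R[i] R[i]^o.
HB.instance Definition _ := GRing.ComAlgebra.copy R[i] R[i]^o.
HB.instance Definition _ := Vector.copy R[i] R[i]^o.
HB.instance Definition _ := NormedModule.copy R[i] R[i]^o.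
End ComplexTopology.

(* The one-mode Fock space is realised as the Hilbert space of
   square-summable complex sequences, (x_n) standing for \sum_n x_n e_n. *)
Section SquareSummable.
Variable R : realType.
Implicit Types (x y : nat -> R[i]) (z w : R[i]).

Definition sqmod z : R := complex.Re z ^+ 2 + complex.Im z ^+ 2.

Definition square_summable x : Prop := cvgn (series (fun n => sqmod (x n))).

(* Only meaningful for square-summable x. *)
Definition l2norm x : R := Num.sqrt (limn (series (fun n => sqmod (x n)))).

Definition ell2 : {pred (nat -> R[i])} := fun x => `[< square_summable x >].

Let sqmod_ge0 z : 0 <= sqmod z.
Proof. by rewrite addr_ge0 // sqr_ge0. Qed.

Let sqmodZ z w : sqmod (z * w) = sqmod z * sqmod w.
Proof. case: z w => [a b] [c d]; rewrite /sqmod /=; ring. Qed.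

Let sqmodD_le z w : sqmod (z + w) <= 2 * sqmod z + 2 * sqmod w.
Proof.
case: z w => [a b] [c d]; rewrite /sqmod /=.
rewrite -subr_ge0 [X in 0 <= X](_ : _ = (a - c) ^+ 2 + (b - d) ^+ 2); last ring.
by rewrite addr_ge0 // sqr_ge0.
Qed.

Lemma ell2_submod_closed : submod_closed ell2.
Proof.
split; first last.
  move=> c x y /asboolP hx /asboolP hy; apply/asboolP.
  apply: (@series_le_cvg _ _
    (fun n => (2 * sqmod c) *: sqmod (x n) + 2%:R *: sqmod (y n))) => [n|n|n|].
  - exact: sqmod_ge0.
  - by rewrite addr_ge0 // ?scaler_ge0 ?mulr_ge0 // sqmod_ge0.
  - by rewrite (le_trans (sqmodD_le _ _)) // sqmodZ mulrA.
  by apply: (@is_cvg_seriesD R); apply: (@is_cvg_seriesZ R).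
apply/asboolP; rewrite /square_summable.
rewrite (_ : series _ = fun=> 0); first exact: is_cvg_cst.
by apply/funext => n; rewrite /series /= big1 // => k _; rewrite /sqmod /= expr0n addr0.
Qed.

HB.instance Definition _ :=
  GRing.isSubmodClosed.Build R[i] (nat -> R[i]) ell2 ell2_submod_closed.

End SquareSummable.

Record fock (R : realType) :=
  Fock { fock_seq :> nat -> R[i]; _ : fock_seq \in @ell2 R }.

Section FockInstances.
Variable R : realType.
HB.instance Definition _ := [isSub for @fock_seq R].
HB.instance Definition _ := [Choice of fock R by <:].
HB.instance Definition _ := [SubChoice_isSubLmodule of fock R by <:].
End FockInstances.

Section Fock.
Variable R : realType.
Local Notation C := R[i].
Local Notation sequence := (nat -> C).
Local Notation vec := (fock R).
Local Notation op := (fock R -> fock R).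

Definition delta (n : nat) : sequence := fun k => (k == n)%:R.

Lemma delta_ell2 n : delta n \in @ell2 R.
Proof.
apply/asboolP; apply/cvg_ex; exists 1; apply: cvg_near_cst.
exists n.+1 => // k /= nk.
rewrite /series /= (bigD1_seq n) ?mem_index_iota ?iota_uniq //=.
rewrite big1 => [|j /negPf jn]; rewrite /delta /sqmod ?jn ?eqxx /=.
  by rewrite addr0 expr1n expr0n addr0.
by rewrite expr0n addr0.
Qed.

Definition ebasis (n : nat) : vec := Fock (delta_ell2 n).

Definition dot (x y : vec) : C := limn (series (fun n => (x n)^* * y n)).

Definition fnorm (x : vec) : R := l2norm x.

(* Operators are functions fock -> fock; every map on B(h)
    below is constrained only on bounded (linear) ones. *)

Definition bounded_op (X : op) : Prop :=
  linear X /\ exists M : R, forall x, fnorm (X x) <= M * fnorm x.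

Definition positive_op (X : op) : Prop := forall x, 0 <= dot x (X x).

(* Positivity of the matrix (X i j) as an operator on the direct sum of n
   copies of the Fock space. *)
Definition positive_mx n (X : 'I_n -> 'I_n -> op) : Prop :=
  forall x : 'I_n -> vec, 0 <= \sum_i \sum_j dot (x i) (X i j (x j)).

Definition completely_positive (Phi : op -> op) : Prop :=
  forall n (X : 'I_n -> 'I_n -> op), (forall i j, bounded_op (X i j)) ->
    positive_mx X -> positive_mx (fun i j => Phi (X i j)).

(* The weak-* topology of B(h) is the one induced by the functionals
   X |-> \sum_k <x_k, X y_k> with \sum_k |x_k|^2, \sum_k |y_k|^2 < oo, which
   are the functionals X |-> Tr(S X) with S of trace class. *)
Definition sq_summable_family (x : nat -> vec) : Prop :=
  cvgn (series (fun k => fnorm (x k) ^+ 2)).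

Definition pairing (x y : nat -> vec) (X : op) : C :=
  limn (series (fun k => dot (x k) (X (y k)))).

Definition weak_star_cvg (F : set_system op) (X : op) : Prop :=
  forall x y, sq_summable_family x -> sq_summable_family y ->
    pairing x y @ F --> pairing x y X.

Definition normal_map (Phi : op -> op) : Prop :=
  forall (F : set_system op) (X : op), ProperFilter F -> F [set Y | bounded_op Y] ->
    bounded_op X -> weak_star_cvg F X -> weak_star_cvg (Phi @ F) (Phi X).

Definition weak_star_continuous (f : R -> op) : Prop :=
  forall x y, sq_summable_family x -> sq_summable_family y ->
    {within `[0, +oo[, continuous (fun t : R => pairing x y (f t))}.

Record quantum_markov_semigroup (T : R -> op -> op) : Prop := {
  qms_bounded : forall (t : R) X, 0 <= t -> bounded_op X -> bounded_op (T t X);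
  qms_linear : forall (t : R) c X Y, 0 <= t -> bounded_op X -> bounded_op Y ->
    T t (c *: X + Y) = c *: T t X + T t Y;
  qms_normal : forall t : R, 0 <= t -> normal_map (T t);
  qms_cp : forall t : R, 0 <= t -> completely_positive (T t);
  qms_unital : forall t : R, 0 <= t -> T t idfun = idfun;
  qms_0 : forall X, bounded_op X -> T 0 X = X;
  qms_D : forall (t r : R) X, 0 <= t -> 0 <= r -> bounded_op X ->
    T (t + r) X = T t (T r X);
  qms_continuous : forall X, bounded_op X -> weak_star_continuous (T ^~ X) }.

(* a and a^+ act on all
    sequences; finite sequences, i.e. span{e_n}, are preserved, and polynomials
    in a, a^+ are multiplied by composition. *)

Definition ann (x : sequence) : sequence :=
  fun n => (Num.sqrt n.+1%:R)%:C * x n.+1.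

(* At n = 0 the square root vanishes. *)
Definition cre (x : sequence) : sequence :=
  fun n => (Num.sqrt n%:R)%:C * x n.-1.

(* The vectors e_n are analytic for the skew-symmetric operator z a^+ - z^* a,
   so that its exponential is given on them by the norm-convergent exponential
   series; this determines the bounded operator W(z). *)
Definition is_weyl (z : C) (W : op) : Prop :=
  bounded_op W /\ forall n,
    l2norm (series (fun k => (k`!%:R)^-1 *:
              iter k (z *: cre - z^* *: ann) (ebasis n)) m - (W (ebasis n) : sequence))
      @[m --> \oo] --> (0 : R).

Definition weyl (z : C) : op := xget 0 [set W | is_weyl z W].

Section Gaussian.
Variables (Omega : R) (kappa zeta : C) (u v : 'I_2 -> C).

Definition gamma : R := 2^-1 * \sum_(l < 2) (sqmod (v l) - sqmod (u l)).

Definition Zmap (z : C) : C :=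
  ('i * Omega%:C - gamma%:C) * z + 'i * kappa * z^*.

Definition Cmap (z : C) : C :=
  \sum_(l < 2) ((sqmod (u l) + sqmod (v l))%:C * z + 2 * v l * u l * z^*).

Definition expZ (t : R) (z : C) : C :=
  limn (series (fun k => (exp_coeff t k)%:C * iter k Zmap z)).

Definition cexp (z : C) : C :=
  (expR (complex.Re z))%:C * (cos (complex.Im z) +i* sin (complex.Im z)).

Definition gaussian_factor (t : R) (z : C) : C :=
  cexp (- (2^-1 * \int[lebesgue_measure]_(r in `[0, t])
             complex.Re ((expZ r z)^* * Cmap (expZ r z)))%:C
        + 'i * (\int[lebesgue_measure]_(r in `[0, t])
             complex.Re (zeta^* * expZ r z))%:C).

Definition gaussian_qms (T : R -> op -> op) : Prop :=
  quantum_markov_semigroup T /\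
  forall (t : R) z, 0 <= t -> T t (weyl z) = gaussian_factor t z *: weyl (expZ t z).

Definition drift_mx : 'M[R]_2 := \matrix_(i, j)
  if i == 0
  then if j == 0 then - gamma - complex.Im kappa else complex.Re kappa - Omega
  else if j == 0 then complex.Re kappa + Omega else - gamma + complex.Im kappa.

Definition cdrift_mx : 'M[C]_2 := map_mx (real_complex R) drift_mx.

Definition stable : Prop :=
  forall l : C, eigenvalue cdrift_mx l -> complex.Re l < 0.

(* As ln is 0 outside ]0, +oo[, beta > 0 forces both sums to be nonzero. *)
Definition beta : R :=
  - ln ((\sum_(l < 2) sqmod (u l)) / \sum_(l < 2) sqmod (v l)).

Definition tanh (x : R) : R := (expR x - expR (- x)) / (expR x + expR (- x)).

Definition standardized : Prop :=
  zeta = 0 /\ kappa = 'i * (tanh (beta / 2))%:C * \sum_(l < 2) u l * v l.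

End Gaussian.

Definition trace (X : op) : C :=
  limn (series (fun n => dot (ebasis n) (X (ebasis n)))).

(* Normal states are given by their density operators. *)
Definition density (rho : op) : Prop :=
  [/\ bounded_op rho, positive_op rho
    & series (fun n => dot (ebasis n) (rho (ebasis n))) @ \oo --> (1 : C)].

Definition invariant_state (T : R -> op -> op) (rho : op) : Prop :=
  density rho /\ forall (t : R) X, 0 <= t -> bounded_op X ->
    trace (rho \o T t X) = trace (rho \o X).

Definition faithful_state (rho : op) : Prop :=
  forall X, bounded_op X -> positive_op X -> trace (rho \o X) = 0 -> X = 0.

Definition unique_faithful_invariant (T : R -> op -> op) (rho : op) : Prop :=
  [/\ invariant_state T rho, forall rho', invariant_state T rho' -> rho' = rho
    & faithful_state rho].

(* Eigenvalue on e_n of the power rho^p of rho = (1 - e^-b) e^(-b N). *)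
Definition thermal_pow (b p : R) (n : nat) : R :=
  ((1 - expR (- b)) * expR (- b * n%:R)) `^ p.

Definition diag_seq (d : nat -> R) (x : sequence) : sequence :=
  fun n => (d n)%:C * x n.

(* For b > 0 and p >= 0 the multiplier is bounded, and the default value 0 of
   insubd is never used. *)
Definition thermal (b p : R) : op := fun x => insubd 0 (diag_seq (thermal_pow b p) x).

Definition hilbert_schmidt (X : op) : Prop :=
  bounded_op X /\ cvgn (series (fun n => fnorm (X (ebasis n)) ^+ 2)).

Definition hsnorm (X : op) : R :=
  Num.sqrt (limn (series (fun n => fnorm (X (ebasis n)) ^+ 2))).

Record contraction_semigroup (U : R -> op -> op) : Prop := {
  csg_hs : forall (t : R) X, 0 <= t -> hilbert_schmidt X -> hilbert_schmidt (U t X);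
  csg_linear : forall (t : R) c X Y, 0 <= t ->
    hilbert_schmidt X -> hilbert_schmidt Y ->
    U t (c *: X + Y) = c *: U t X + U t Y;
  csg_contraction : forall (t : R) X, 0 <= t -> hilbert_schmidt X ->
    hsnorm (U t X) <= hsnorm X;
  csg_0 : forall X, hilbert_schmidt X -> U 0 X = X;
  csg_D : forall (t r : R) X, 0 <= t -> 0 <= r -> hilbert_schmidt X ->
    U (t + r) X = U t (U r X);
  csg_continuous : forall X, hilbert_schmidt X ->
    hsnorm (U t X - X) @[t --> 0^'+] --> (0 : R) }.

Definition induced_semigroup (b s : R) (T U : R -> op -> op) : Prop :=
  contraction_semigroup U /\
  forall (t : R) X, 0 <= t -> bounded_op X ->
    U t (thermal b (s / 2) \o X \o thermal b ((1 - s) / 2)) =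
    thermal b (s / 2) \o T t X \o thermal b ((1 - s) / 2).

(* X lies in the domain of the generator of U, which maps X to Y. *)
Definition generator (U : R -> op -> op) (X Y : op) : Prop :=
  [/\ hilbert_schmidt X, hilbert_schmidt Y
    & hsnorm ((t^-1)%:C *: (U t X - X) - Y) @[t --> 0^'+] --> (0 : R)].

Definition generator_eigenvalue (U : R -> op -> op) (l : C) : Prop :=
  exists2 X, X != 0 & generator U X (l *: X).

Definition first_order (P : sequence -> sequence) : Prop :=
  exists c0 c1 c2 : C, (c1, c2) != (0, 0) /\
    P = c0 *: idfun + c1 *: ann + c2 *: cre.

Definition monomial (X Y : sequence -> sequence) (n m : nat) :
  sequence -> sequence := iter n X \o iter m Y.

(* Rem is in span{X^i Y^j : i + j <= n + m - 2} if n + m >= 2, and Rem = 0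
   otherwise. *)
Definition lower_order (X Y : sequence -> sequence) (n m : nat)
    (Rem : sequence -> sequence) : Prop :=
  if (2 <= n + m)%N then
    exists c : nat -> nat -> C,
      Rem = \sum_(i < n + m) \sum_(j < n + m | (i + j <= n + m - 2)%N)
              c i j *: monomial X Y i j
  else Rem = 0.

(* The Hilbert-Schmidt extension of rho^(s/2) P rho^((1-s)/2), given on the
   vectors e_n. *)
Definition embed (b s : R) (P : sequence -> sequence) : op :=
  xget 0 [set B | hilbert_schmidt B /\ forall n,
    (B (ebasis n) : sequence) =
    diag_seq (thermal_pow b (s / 2))
      (P (diag_seq (thermal_pow b ((1 - s) / 2)) (ebasis n)))].

End Fock.

(* Main.v *)
(* The dual action on Weyl operators, T_t W(rz) = exp(- r^2 q_t(z)) W(r e^{tZ} z),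
   determines U_t on the Hilbert-Schmidt operators rho^{s/2} W(rz) rho^{(1-s)/2}.
   These have an asymptotic expansion in r at 0 whose coefficients are the images of
   the powers of z a^+ - z^* a; since U_t is a contraction, comparing coefficients
   gives U_t on those powers, hence on all polynomials. Differentiating at t = 0, the
   generator acts on polynomials by an explicit operator L which is of second order:
   L(XQ) = L(X)Q + X L(Q) + (a combination of [a,Q] and [a^+,Q]) for X of first order.
   Hence L(X^n Y^m) is the claimed leading part plus terms of total degree n + m - 2.
   By stability n lambda + m mu differs from i lambda + j mu for all other i <= n,
   j <= m, so the triangular system can be solved and X^n Y^m is the leading term of
   an eigenvector; iterated commutators with a first-order operator that
   commutes with neither X nor Y show that it is nonzero. *)

From HB Require Import structures.
Require Import Defs.
From mathcomp Require Import all_boot all_order all_algebra complex.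
From mathcomp Require Import ring lra zify.
From mathcomp Require Import all_classical all_reals all_analysis.

Set Implicit Arguments.
Unset Strict Implicit.

Import Order.TTheory GRing.Theory Num.Theory numFieldNormedType.Exports.

Local Open Scope classical_set_scope.
Local Open Scope ring_scope.
Local Open Scope complex_scope.

(** Polynomials are unbounded, so [T] says nothing about them directly; only [U] reaches them. Two
    points shape the estimates. For [s = 0] or [s = 1] the weights damp only one of the two indices
    of a matrix entry; decay in both comes from the fact that the k-th power of a field operator has
    entries only within distance k of the diagonal. And the growth of those entries, of order
    sqrt(k!) in k, must be beaten by 1 / k! uniformly in the indices, which fixes the constants.
    Powers of field operators suffice because they span all polynomials: by polarization, the
    coefficients of (P + w Q)^k in w are the ordered monomials up to lower degree. Stability can be
    applied because the generator acts on the span of a and a^+ with the characteristic polynomial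
    of the drift matrix, so that [lambda] and [mu] are eigenvalues of the drift. The monomial
    formulas of both cases are one computation with a parameter [e], equal to 0 or 1 in L(Y) = mu Y
    - e X. *)

Local Notation "x ^*" := (Num.conj x) : complex_scope.

(** Equality of two sums in an abelian group, for use where products do not commute: the head of the
    left side is brought forward on the right by [addrCA] and cancelled. *)
Ltac abel := rewrite ?(add0r, addr0) ?opprD ?opprK -[LHS]addr0 -[RHS]addr0 -!addrA;
  repeat match goal with
  | |- _ => reflexivity
  | |- ?x + _ = ?y + _ => unify x y; refine (f_equal (fun z => x + z) _)
  | |- ?x + _ = _ => rewrite [in RHS](addrCA _ x)
  end.

(** * Commutators and second-order operators *)

Section Algebra.
Variables (K : numFieldType) (A : algType K).
Implicit Types (l p q X Y : A) (x y : K).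

(** Locking keeps simplification and unification from opening commutators; [adE] opens them on
    demand. *)
Definition ad l p := locked (l * p - p * l).

Lemma adE l p : ad l p = l * p - p * l.
Proof. by rewrite /ad -lock. Qed.

Lemma ad_linear l : linear (ad l).
Proof.
move=> k p q; rewrite !adE mulrDl mulrDr scalerBr -scalerAl -scalerAr.
by rewrite opprD addrACA.
Qed.

HB.instance Definition _ l := GRing.isLinear.Build K A A _ (ad l) (ad_linear l).

Lemma adDl l l' p : ad (l + l') p = ad l p + ad l' p.
Proof. by rewrite !adE mulrDl mulrDr opprD addrACA. Qed.

Lemma adZl k l p : ad (k *: l) p = k *: ad l p.
Proof. by rewrite !adE scalerBr -scalerAl -scalerAr. Qed.

Lemma adZr k l p : ad l (k *: p) = k *: ad l p.
Proof. by rewrite linearZ. Qed.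

Lemma adDr l p q : ad l (p + q) = ad l p + ad l q.
Proof. by rewrite linearD. Qed.

Lemma adBr l p q : ad l (p - q) = ad l p - ad l q.
Proof. by rewrite linearB. Qed.

Lemma adC l p : ad l p = - ad p l.
Proof. by rewrite !adE opprB. Qed.

Lemma adxx l : ad l l = 0.
Proof. by rewrite !adE subrr. Qed.

Lemma ad_scalar l x : ad l x%:A = 0.
Proof. by rewrite !adE -scalerAl -scalerAr mulr1 mul1r subrr. Qed.

Lemma ad1 l : ad l 1 = 0.
Proof. by rewrite adE mulr1 mul1r subrr. Qed.

Lemma adM l p q : ad l (p * q) = ad l p * q + p * ad l q.
Proof. by rewrite !adE mulrBl mulrBr addrA !mulrA subrK. Qed.

Lemma adMscalar l X x q : ad l X = x%:A -> ad l (X * q) = x *: q + X * ad l q.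
Proof. by move=> h; rewrite adM h -scalerAl mul1r. Qed.

(** At [n = 0] the factor [n%:R] vanishes, so the truncated exponent [n.-1] does no harm. The
    monomial formulas below rely on the same convention. *)
Lemma ad_exp l X x n : ad l X = x%:A -> ad l (X ^+ n) = (n%:R * x) *: X ^+ n.-1.
Proof.
move=> h; elim: n => [|n IH]; first by rewrite expr0 -(scale1r 1) ad_scalar mul0r scale0r.
rewrite exprS (adMscalar _ h) IH -scalerAr -exprS.
case: n {IH} => [|n]; rewrite /= ?mul0r ?scale0r ?addr0 ?mul1r //.
by rewrite -scalerDl -[in RHS]natr1 mulrDl mul1r addrC.
Qed.

Lemma ad_monomial l X Y x y n m : ad l X = x%:A -> ad l Y = y%:A ->
  ad l (X ^+ n * Y ^+ m) =
  (n%:R * x) *: (X ^+ n.-1 * Y ^+ m) + (m%:R * y) *: (X ^+ n * Y ^+ m.-1).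
Proof.
by move=> hX hY; rewrite adM (ad_exp _ hX) (ad_exp _ hY) -scalerAl -scalerAr.
Qed.

Lemma iter_ad_linear l k : linear (iter k (ad l)).
Proof. by elim: k => [//|k IH] c p q /=; rewrite IH linearP. Qed.

Lemma iter_ad0 l k : iter k (ad l) 0 = 0.
Proof. by elim: k => [//|k IH] /=; rewrite IH linear0. Qed.

(** A commutator with [l] lowers the total degree by one, because both letters have scalar
    commutators with [l]. *)
Lemma iter_ad_monomial_lt l X Y x y k i j : ad l X = x%:A -> ad l Y = y%:A ->
  (i + j < k)%N -> iter k (ad l) (X ^+ i * Y ^+ j) = 0.
Proof.
move=> hX hY; elim: k i j => [//|k IH] i j; rewrite ltnS => ijk.
rewrite iterSr (ad_monomial _ _ hX hY) iter_ad_linear -[X in _ + iter k _ X]addr0 iter_ad_linear.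
rewrite iter_ad0 addr0; case: i ijk => [|i] ijk.
  rewrite mul0r scale0r add0r; case: j ijk => [|j] ijk; first by rewrite mul0r scale0r.
  by rewrite IH ?scaler0.
rewrite IH // scaler0 add0r; case: j ijk => [|j] ijk; first by rewrite mul0r scale0r.
by rewrite IH ?scaler0 //; rewrite addnS in ijk.
Qed.

(** Each of the (i + j)! orders in which the commutators can hit the letters contributes
    [x ^+ i * y ^+ j]. The top coefficient of a polynomial can thus be read off whatever the
    commutator of [X] and [Y] is. *)
Lemma iter_ad_monomial l X Y x y i j : ad l X = x%:A -> ad l Y = y%:A ->
  iter (i + j) (ad l) (X ^+ i * Y ^+ j) = ((i + j)`!%:R * x ^+ i * y ^+ j)%:A.
Proof.
move=> hX hY; have [k] := ubnP (i + j); elim: k i j => [//|k IH] i j.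
rewrite ltnS; case: i => [|i] ik.
  rewrite add0n expr0 mul1r; case: j ik => [|j] ik; first by rewrite /= fact0 !expr0 !mulr1 scale1r.
  rewrite iterSr (ad_exp _ hY) -[X in iter j _ X]addr0 iter_ad_linear iter_ad0 addr0.
  have := IH 0 j; rewrite !add0n expr0 mul1r => -> //.
  rewrite scalerA; congr (_ *: _); rewrite ?expr0 ?mulr1 factS natrM exprS /=; ring.
rewrite addSn iterSr (ad_monomial _ _ hX hY) iter_ad_linear.
rewrite -[X in _ + iter _ _ X]addr0 iter_ad_linear iter_ad0 addr0 IH //.
case: j ik => [|j] ik.
  by rewrite mul0r scale0r addr0 scalerA factS natrM addn0 exprS; congr (_ *: _); ring.
rewrite /= addnS -addSn IH; last by rewrite -addnS.
rewrite !scalerA -scalerDl; congr (_ *: _).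
have -> : ((i.+1 + j).+1)`!%:R = (i.+1%:R + j.+1%:R) * (i.+1 + j)`!%:R :> K.
  by rewrite factS natrM -addnS natrD.
rewrite !exprS; ring.
Qed.

End Algebra.

Section SecondOrder.
Variables (K : numFieldType) (A : algType K) (a c : A).
Variables (l1a l1c l2a l2c s11 s12 s22 : K).
Implicit Types (l p q X Y : A) (x y : K).

(* The general shape of the Lindbladian of a Gaussian semigroup on polynomials. *)
Definition quad_gen p :=
  (l1a *: a + l1c *: c) * ad a p + (l2a *: a + l2c *: c) * ad c p
  + (s11 *: ad a (ad a p) + s12 *: ad a (ad c p) + s22 *: ad c (ad c p)).

Lemma quad_gen_linear : linear quad_gen.
Proof.
move=> k p q; rewrite /quad_gen !ad_linear !mulrDr -!scalerAr !scalerDr.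
rewrite !(scalerA _ k) ![_ * k]mulrC -!(scalerA k).
abel.
Qed.

HB.instance Definition _ := GRing.isLinear.Build K A A _ quad_gen quad_gen_linear.

(** A Leibniz rule with a defect, the defect being a combination of first commutators whose
    coefficients depend only on those of [X]. As a predicate it is stable under sums and multiples,
    so [quad_gen] can be treated piece by piece. *)
Definition second_order (O : A -> A) (g1 g2 : K -> K -> K) :=
  forall X x1 x2 q, ad a X = x1%:A -> ad c X = x2%:A ->
    O (X * q) = O X * q + X * O q + (g1 x1 x2 *: ad a q + g2 x1 x2 *: ad c q).

Lemma second_orderD O O' g1 g2 g1' g2' :
  second_order O g1 g2 -> second_order O' g1' g2' ->
  second_order (fun p => O p + O' p) (fun x y => g1 x y + g1' x y)
    (fun x y => g2 x y + g2' x y).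
Proof.
move=> hO hO' X x1 x2 q h1 h2; rewrite (hO _ _ _ _ h1 h2) (hO' _ _ _ _ h1 h2).
by rewrite addrACA [X in X + _]addrACA [X in _ + X]addrACA -!scalerDl mulrDl mulrDr.
Qed.

Lemma second_orderZ k O g1 g2 : second_order O g1 g2 ->
  second_order (fun p => k *: O p) (fun x y => k * g1 x y) (fun x y => k * g2 x y).
Proof.
move=> hO X x1 x2 q h1 h2; rewrite (hO _ _ _ _ h1 h2) !scalerDr !scalerA.
by rewrite -scalerAl -scalerAr.
Qed.

(** Moving [b] across [X] costs the scalar [y]; this is the whole defect of [b * ad l] from the
    Leibniz rule. *)
Lemma mul_ad_scalar b l X x y q : ad l X = x%:A -> ad b X = y%:A ->
  b * ad l (X * q) = b * ad l X * q + X * (b * ad l q) + y *: ad l q.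
Proof.
move=> hl hb; rewrite (adMscalar _ hl) mulrDr hl -!scalerAr mulr1 -!scalerAl.
rewrite -!addrA; congr (_ + _); rewrite !mulrA; apply/eqP; rewrite addrC -subr_eq -mulrBl.
by rewrite -adE hb -scalerAl mul1r.
Qed.

Lemma ad_lin_scalar ka kc X x1 x2 : ad a X = x1%:A -> ad c X = x2%:A ->
  ad (ka *: a + kc *: c) X = (ka * x1 + kc * x2)%:A.
Proof. by move=> h1 h2; rewrite adDl !adZl h1 h2 !scalerA scalerDl. Qed.

Lemma ad_ad_scalar l l' X x x' q : ad l X = x%:A -> ad l' X = x'%:A ->
  ad l (ad l' (X * q)) =
  ad l (ad l' X) * q + X * ad l (ad l' q) + (x *: ad l' q + x' *: ad l q).
Proof.
move=> hl hl'; rewrite (adMscalar _ hl') ad_linear (adMscalar _ hl) hl'.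
rewrite ad_scalar mul0r; abel.
Qed.

(* The coefficients of the carre du champ of [quad_gen]. *)
Definition carre1 x1 x2 := l1a * x1 + l1c * x2 + (s11 * (x1 + x1) + s12 * x2).
Definition carre2 x1 x2 := l2a * x1 + l2c * x2 + (s12 * x1 + s22 * (x2 + x2)).

Lemma quad_genM X x1 x2 q : ad a X = x1%:A -> ad c X = x2%:A ->
  quad_gen (X * q) = quad_gen X * q + X * quad_gen q
    + (carre1 x1 x2 *: ad a q + carre2 x1 x2 *: ad c q).
Proof.
have Da : second_order (fun p => (l1a *: a + l1c *: c) * ad a p)
    (fun x y => l1a * x + l1c * y) (fun x y => 0).
  move=> {}X {}x1 {}x2 {}q h1 h2; rewrite scale0r addr0.
  by rewrite (mul_ad_scalar _ h1 (ad_lin_scalar _ _ h1 h2)).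
have Dc : second_order (fun p => (l2a *: a + l2c *: c) * ad c p)
    (fun x y => 0) (fun x y => l2a * x + l2c * y).
  move=> {}X {}x1 {}x2 {}q h1 h2; rewrite scale0r add0r.
  by rewrite (mul_ad_scalar _ h2 (ad_lin_scalar _ _ h1 h2)).
have Daa : second_order (fun p => ad a (ad a p)) (fun x y => x + x) (fun x y => 0).
  by move=> {}X {}x1 {}x2 {}q h1 h2; rewrite scale0r addr0 (ad_ad_scalar _ h1 h1) scalerDl.
have Dac : second_order (fun p => ad a (ad c p)) (fun x y => y) (fun x y => x).
  by move=> {}X {}x1 {}x2 {}q h1 h2; rewrite (ad_ad_scalar _ h1 h2) [in X in _ = _ + X]addrC.
have Dcc : second_order (fun p => ad c (ad c p)) (fun x y => 0) (fun x y => y + y).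
  by move=> {}X {}x1 {}x2 {}q h1 h2; rewrite scale0r add0r (ad_ad_scalar _ h2 h2) scalerDl.
move=> h1 h2.
rewrite /quad_gen (second_orderD (second_orderD Da Dc) (second_orderD (second_orderD
  (second_orderZ s11 Daa) (second_orderZ s12 Dac)) (second_orderZ s22 Dcc)) _ h1 h2).
congr (_ + (_ *: _ + _ *: _)); rewrite /carre1 /carre2; ring.
Qed.

Lemma quad_gen1 : quad_gen 1 = 0.
Proof.
by rewrite /quad_gen -(scale1r 1) !ad_scalar !(linear0, mulr0, scaler0, addr0).
Qed.

Lemma quad_genX X x1 x2 : ad a X = x1%:A -> ad c X = x2%:A ->
  quad_gen X = x1 *: (l1a *: a + l1c *: c) + x2 *: (l2a *: a + l2c *: c).
Proof.
move=> h1 h2; rewrite /quad_gen h1 h2 !ad_scalar !scaler0 !addr0.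
by rewrite -!scalerAr !mulr1.
Qed.

(** The derivative of the n-th power at [X] in the direction [X'], that is the sum of X^i X'
    X^(n-1-i); the order matters, since [X'] need not commute with [X]. *)
Fixpoint dpow X X' n : A :=
  if n is k.+1 then X' * X ^+ k + X * dpow X X' k else 0.

(** Each of the ['C(n, 2)] pairs of factors contributes one carre du champ of [X] with itself. The
    first-order part stays in the form [dpow], in which it also arises as a time derivative. *)
Lemma quad_gen_exp X x1 x2 n : ad a X = x1%:A -> ad c X = x2%:A ->
  quad_gen (X ^+ n) = dpow X (quad_gen X) n
    + ('C(n, 2)%:R * (carre1 x1 x2 * x1 + carre2 x1 x2 * x2)) *: X ^+ (n - 2).
Proof.
move=> h1 h2; elim: n => [|n IH].
  by rewrite quad_gen1 add0r mul0r scale0r.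
rewrite exprS (quad_genM _ h1 h2) IH (ad_exp _ h1) (ad_exp _ h2) /=.
rewrite mulrDr -!addrA; do 2! congr (_ + _); rewrite !scalerA -scalerDl -scalerAr.
case: n {IH} => [|[|n]].
- by rewrite !bin_small // !(mul0r, mulr0, addr0, scale0r).
- rewrite bin_small // mul0r scale0r add0r !expr0 binn.
  by congr (_ *: _); ring.
rewrite !subSS !subn0 /= -exprS -scalerDl; congr (_ *: _).
rewrite (binS n.+2 1) bin1 natrD; ring.
Qed.

Section Monomials.
Variables (X Y : A) (x1 x2 y1 y2 k : K).
Hypotheses (aX : ad a X = x1%:A) (cX : ad c X = x2%:A).
Hypotheses (aY : ad a Y = y1%:A) (cY : ad c Y = y2%:A) (YX : ad Y X = k%:A).
Variables (lam mu e : K).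
Hypotheses (LX : quad_gen X = lam *: X) (LY : quad_gen Y = mu *: Y - e *: X).

Variable gam : K.
Hypothesis gamE : gam = carre1 y1 y2 * y1 + carre2 y1 y2 * y2 - e * k.

(** The part [- e * k] of [gam] comes from normal ordering: L(Y) puts - e X in each position, and
    moving [X] to the left past i letters [Y] costs i k, in total ['C(m, 2)] times k. *)
Lemma quad_gen_expY m : quad_gen (Y ^+ m) =
  (m%:R * mu) *: Y ^+ m - (m%:R * e) *: (X * Y ^+ m.-1)
  + ('C(m, 2)%:R * gam) *: Y ^+ (m - 2).
Proof.
elim: m => [|m IH]; first by rewrite quad_gen1 !mul0r !scale0r subr0 addr0.
have YXp p : Y * (X * p) = X * (Y * p) + k *: p.
  by apply/eqP; rewrite !mulrA addrC -subr_eq -mulrBl -adE YX -scalerAl mul1r.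
have E1 : (m%:R * e) *: (X * (Y * Y ^+ m.-1)) = (m%:R * e) *: (X * Y ^+ m).
  by case: m {IH} => [|m]; rewrite ?(mul0r, scale0r) // -exprS.
have E2 x : ('C(m, 2)%:R * x) *: (Y * Y ^+ (m - 2)) = ('C(m, 2)%:R * x) *: Y ^+ m.-1.
  by case: m {IH E1} => [|[|m]]; rewrite ?(mul0r, scale0r) // -exprS subn2.
have E3 x : ('C(m.+1, 2)%:R * x) *: Y ^+ (m.+1 - 2) = (('C(m, 2)%:R + m%:R) * x) *: Y ^+ m.-1.
  by rewrite binS bin1 natrD subn2.
rewrite E3 exprS (quad_genM _ aY cY) IH (ad_exp _ aY) (ad_exp _ cY) LY.
rewrite mulrBl !mulrDr mulrN -!scalerAr -!scalerAl YXp !scalerDr E1 E2 !scalerA -natr1.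
move: (Y * Y ^+ m) (X * Y ^+ m) (Y ^+ m.-1) => V1 V2 V3.
rewrite gamE; move: (carre1 y1 y2) (carre2 y1 y2) ('C(m, 2)%:R) (m%:R) => d1 d2 b n.
transitivity ((mu + n * mu) *: V1 + (- e - n * e) *: V2
  + (- (n * e * k) + b * (d1 * y1 + d2 * y2 - e * k) + (d1 * (n * y1) + d2 * (n * y2))) *: V3).
  by rewrite !scalerDl !scaleNr; abel.
rewrite -[in RHS]scaleNr; congr (_ *: _ + _ *: _ + _ *: _); ring.
Qed.

(** Letters [X] are peeled off on the left, where they already stand in normal order, so the only
    reordering is that of [quad_gen_expY]. The three correction terms count pairs XX, XY and YY. *)
Lemma quad_gen_monomial n m : quad_gen (X ^+ n * Y ^+ m) =
  (n%:R * lam + m%:R * mu) *: (X ^+ n * Y ^+ m)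
  - (m%:R * e) *: (X ^+ n.+1 * Y ^+ m.-1)
  + (('C(n, 2)%:R * (carre1 x1 x2 * x1 + carre2 x1 x2 * x2)) *: (X ^+ (n - 2) * Y ^+ m)
   + ((n * m)%:R * (carre1 x1 x2 * y1 + carre2 x1 x2 * y2)) *: (X ^+ n.-1 * Y ^+ m.-1)
   + ('C(m, 2)%:R * gam) *: (X ^+ n * Y ^+ (m - 2))).
Proof.
(* [al] and [be] stay names until coefficients are compared, so that the vectors can be collected by
   additive reasoning alone. *)
have [al alE] : exists al, al = carre1 x1 x2 * x1 + carre2 x1 x2 * x2 by eexists.
have [be beE] : exists be, be = carre1 x1 x2 * y1 + carre2 x1 x2 * y2 by eexists.
rewrite -alE -beE; elim: n => [|n IH].
  by rewrite !mul0r !scale0r !expr0 expr1 !mul1r !add0r quad_gen_expY.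
have E2 x : ('C(n, 2)%:R * x) *: (X * (X ^+ (n - 2) * Y ^+ m)) =
            ('C(n, 2)%:R * x) *: (X ^+ n.-1 * Y ^+ m).
  by case: n {IH} => [|[|n]]; rewrite ?(mul0r, scale0r) // mulrA -exprS subn2.
have E3 x : ('C(n.+1, 2)%:R * x) *: (X ^+ (n.+1 - 2) * Y ^+ m) =
            (('C(n, 2)%:R + n%:R) * x) *: (X ^+ n.-1 * Y ^+ m).
  by rewrite binS bin1 natrD subn2.
have E1 x : ((n * m)%:R * x) *: (X * (X ^+ n.-1 * Y ^+ m.-1)) =
            (n%:R * m%:R * x) *: (X ^+ n * Y ^+ m.-1).
  by case: n {IH E2 E3} => [|n]; rewrite ?(mul0r, scale0r) // mulrA -exprS natrM.
rewrite E3 exprS -mulrA (quad_genM _ aX cX) IH (ad_monomial _ _ aX aY) (ad_monomial _ _ cX cY) LX.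
rewrite !mulrDr mulrN -!scalerAr -!scalerAl !scalerDr E1 E2 !scalerA -natr1 natrM -natr1.
rewrite !(mulrA X (X ^+ _)) -!exprS.
move: (X ^+ n.+1 * Y ^+ m) (X ^+ n.+2 * Y ^+ m.-1) (X ^+ n.-1 * Y ^+ m)
  (X ^+ n * Y ^+ m.-1) (X ^+ n.+1 * Y ^+ (m - 2)) => V1 V2 V3 V4 V5.
move: (carre1 x1 x2) (carre2 x1 x2) alE beE ('C(m, 2)%:R) ('C(n, 2)%:R) (m%:R) (n%:R)
  => d1 d2 alE beE c' b m' n'.
transitivity ((lam + (n' * lam + m' * mu)) *: V1 - (m' * e) *: V2
  + ((b * al + (d1 * (n' * x1) + d2 * (n' * x2))) *: V3
   + (n' * m' * be + (d1 * (m' * y1) + d2 * (m' * y2))) *: V4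
   + (c' * gam) *: V5)).
  by rewrite !scalerDl; abel.
rewrite alE beE; congr (_ *: _ - _ *: _ + (_ *: _ + _ *: _ + _ *: _)); ring.
Qed.

End Monomials.
End SecondOrder.

(** * Polynomials in two generators with scalar commutator *)

Section Span.
Variables (K : numFieldType) (A : algType K).

(** Subspaces are plain predicates, since they will be properties such as decay of entries or
    membership in the domain of a generator. *)
Definition linear_closed (V : A -> Prop) :=
  V 0 /\ forall k p q, V p -> V q -> V (k *: p + q).

Lemma linear_closedD V p q : linear_closed V -> V p -> V q -> V (p + q).
Proof. by move=> [_ h] Vp Vq; rewrite -(scale1r p); exact: h. Qed.

Lemma linear_closedZ V k p : linear_closed V -> V p -> V (k *: p).
Proof. by move=> [h0 h] Vp; rewrite -(addr0 (k *: p)); exact: h. Qed.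

Lemma linear_closedB V p q : linear_closed V -> V p -> V q -> V (p - q).
Proof. by move=> hV Vp Vq; rewrite -scaleN1r addrC; case: hV => _; exact. Qed.

Lemma linear_closed_sum V (I : Type) (r : seq I) (F : I -> A) :
  linear_closed V -> (forall i, V (F i)) -> V (\sum_(i <- r) F i).
Proof.
move=> hV hF; elim/big_rec: _ => [|i p _ Vp]; first by case: hV.
exact: linear_closedD.
Qed.

(* Comparing [w] with [2 w] eliminates the leading coefficient. *)
Lemma coef_linear_closed V k (F : nat -> A) : linear_closed V ->
  (forall w : nat, V (\sum_(m < k) (w%:R ^+ m : K) *: F m)) ->
  forall m, (m < k)%N -> V (F m).
Proof.
move=> hV; elim: k F => [//|k IH] F hF.
have Vlt m : (m < k)%N -> V (F m).
  move=> mk; have neq0 : (2 ^+ m - 2 ^+ k : K) != 0.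
    rewrite subr_eq0 -!natrX eqr_nat neq_ltn.
    by rewrite ltn_exp2l ?mk.
  suff : V ((2 ^+ m - 2 ^+ k : K) *: F m).
    by move/(linear_closedZ (2 ^+ m - 2 ^+ k)^-1 hV); rewrite scalerA mulVf ?scale1r.
  apply: (IH (fun m => (2 ^+ m - 2 ^+ k : K) *: F m)) => // w.
  suff -> : \sum_(i < k) (w%:R ^+ i : K) *: ((2 ^+ i - 2 ^+ k : K) *: F i)
      = \sum_(i < k.+1) ((2 * w)%:R ^+ i : K) *: F i
        - (2 ^+ k : K) *: \sum_(i < k.+1) (w%:R ^+ i : K) *: F i.
    by apply: linear_closedB => //; exact: linear_closedZ.
  rewrite scaler_sumr -sumrB big_ord_recr /= natrM exprMn scalerA subrr addr0.
  by apply: eq_bigr => i _; rewrite !scalerA -scalerBl exprMn; congr (_ *: _); ring.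
move=> m; rewrite ltnS leq_eqVlt => /predU1P[->|]; last exact: Vlt.
have := hF 1%N; rewrite big_ord_recr /= expr1n scale1r => Vs.
rewrite (_ : F k = \sum_(i < k) (1 ^+ i : K) *: F i + F k - \sum_(i < k) (1 ^+ i : K) *: F i).
  apply: linear_closedB => //.
  rewrite -(big_mkord xpredT (fun i => (1 ^+ i : K) *: F i)) big_seq.
  elim/big_rec: _ => [|i p]; first by case: hV.
  rewrite mem_index_iota => /= ik Vp; apply: linear_closedD => //.
  by apply: linear_closedZ => //; exact: Vlt.
by rewrite addrC addKr.
Qed.

Variables (P Q : A) (kap : K).
Hypothesis QP : ad Q P = kap%:A.

(** [d] is a strict bound on the total degree: [low_span k.-1] is degree at most k - 2, and
    [low_span 0] contains only 0. *)
Inductive low_span (d : nat) : A -> Prop :=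
| low_span0 : low_span d 0
| low_spanS k i j p : (i + j < d)%N -> low_span d p ->
    low_span d (k *: (P ^+ i * Q ^+ j) + p).

Lemma low_span_closed d : linear_closed (low_span d).
Proof.
split; first exact: low_span0.
move=> k p q hp hq; elim: hp => [|x i j {}p ij _ IH]; first by rewrite scaler0 add0r.
by rewrite scalerDr scalerA -addrA; exact: low_spanS.
Qed.

Lemma low_span_mono d k i j : (i + j < d)%N -> low_span d (k *: (P ^+ i * Q ^+ j)).
Proof. by move=> ij; rewrite -[_ *: _]addr0; apply: low_spanS => //; exact: low_span0. Qed.

Lemma mulQ_mono i j : Q * (P ^+ i * Q ^+ j) =
  P ^+ i * Q ^+ j.+1 + (i%:R * kap) *: (P ^+ i.-1 * Q ^+ j).
Proof.
rewrite mulrA -[Q * _](subrK (P ^+ i * Q)) -adE (ad_exp _ QP) mulrDl -scalerAl.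
by rewrite addrC -mulrA -exprS.
Qed.

Lemma low_span_mulP d p : low_span d p -> low_span d.+1 (P * p).
Proof.
elim=> [|k i j {}p ij _ IH]; first by rewrite mulr0; exact: low_span0.
by rewrite mulrDr -scalerAr mulrA -exprS; exact: low_spanS.
Qed.

Lemma low_span_mulQ d p : low_span d p -> low_span d.+1 (Q * p).
Proof.
elim=> [|k i j {}p ij _ IH]; first by rewrite mulr0; exact: low_span0.
rewrite mulrDr -scalerAr mulQ_mono scalerDr scalerA -addrA.
apply: low_spanS; first by rewrite addnS.
apply: low_spanS => //; by rewrite ltnS ltnW // (leq_ltn_trans _ ij) // leq_add2r leq_pred.
Qed.

Lemma low_span_le d d' p : (d <= d')%N -> low_span d p -> low_span d' p.
Proof.
move=> dd'; elim=> [|k i j {}p ij _ IH]; first exact: low_span0.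
by apply: low_spanS => //; exact: leq_trans dd'.
Qed.

Lemma low_span_sub V d : linear_closed V ->
  (forall i j, (i + j < d)%N -> V (P ^+ i * Q ^+ j)) -> forall p, low_span d p -> V p.
Proof.
move=> hV h p; elim=> [|k i j {}p ij _ IH]; first by case: hV.
by case: hV => _; apply=> //; exact: h.
Qed.

(* The coefficient of [w ^ m] in [(P + w Q) ^ k]. *)
Fixpoint sym_mono (k m : nat) : A :=
  if k is k'.+1 then
    P * sym_mono k' m + (if m is m'.+1 then Q * sym_mono k' m' else 0)
  else (m == 0)%:R.

Lemma sym_mono_gt k m : (k < m)%N -> sym_mono k m = 0.
Proof.
elim: k m => [|k IH] [|m] //= km.
by rewrite !IH ?mulr0 ?addr0 // ltnW.
Qed.

Lemma sym_monoE k (w : K) :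
  (P + w *: Q) ^+ k = \sum_(m < k.+1) w ^+ m *: sym_mono k m.
Proof.
elim: k => [|k IH]; first by rewrite big_ord1 !expr0 scale1r.
rewrite exprS IH mulrDl [RHS]big_ord_recl /= expr0 scale1r addr0.
under [X in _ = _ + X]eq_bigr do rewrite scalerDr.
rewrite big_split /= addrA; congr (_ + _).
  rewrite mulr_sumr big_ord_recl /= expr0 scale1r; congr (_ + _).
  rewrite [RHS]big_ord_recr /= sym_mono_gt ?mulr0 ?scaler0 ?addr0 //.
  by apply: eq_bigr => i _; rewrite -scalerAr.
by rewrite mulr_sumr; apply: eq_bigr => i _; rewrite -scalerAl -scalerAr scalerA -exprS.
Qed.

(** The coefficient of w^m is the sum of the ['C(k, m)] words with m letters [Q]. Normal ordering of
    a word produces scalar commutators only, each of which removes two letters. *)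
Lemma sym_mono_lead k m : (m <= k)%N ->
  low_span k.-1 (sym_mono k m - ('C(k, m)%:R : K) *: (P ^+ (k - m) * Q ^+ m)).
Proof.
elim: k m => [|k IH] m.
  rewrite leqn0 => /eqP ->; rewrite /= bin0 !expr0 mulr1 scale1r subrr; exact: low_span0.
move=> mk /=.
have PH m' : (m' <= k)%N ->
    low_span k (P * sym_mono k m' - ('C(k, m')%:R : K) *: (P ^+ (k.+1 - m') * Q ^+ m')).
  move=> m'k; case: k {mk} IH m'k => [|k] IH m'k.
    move: m'k; rewrite leqn0 => /eqP ->.
    by rewrite /= ?(subn0, expr0, expr1, mulr1, mul1r, bin0, scale1r) subrr; exact: low_span0.
  by have /low_span_mulP := IH _ m'k; rewrite mulrBr -scalerAr mulrA -exprS -subSn.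
case: m mk => [|m] mk; first by rewrite addr0 !bin0; have := PH 0 isT; rewrite bin0.
have QH : low_span k (Q * sym_mono k m - ('C(k, m)%:R : K) *: (P ^+ (k - m) * Q ^+ m.+1)).
  rewrite ltnS in mk; case: k {PH} IH mk => [|k] IH mk.
    move: mk; rewrite leqn0 => /eqP ->.
    by rewrite /= ?(subn0, expr0, expr1, mulr1, mul1r, bin0, scale1r) subrr; exact: low_span0.
  have /low_span_mulQ := IH _ mk; rewrite mulrBr -scalerAr mulQ_mono scalerDr scalerA opprD addrA.
  have [mk'|km] := ltnP m k.+1; last first.
    (* No letter [P] is left for [Q] to pass, and the commutator term has coefficient 0. *)
    have -> : (k.+1 - m = 0)%N by apply/eqP; rewrite subn_eq0.
    by rewrite !(mul0r, mulr0) scale0r subr0.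
  move=> h; have := linear_closedD (low_span_closed _) h
    (low_span_mono ('C(k.+1, m)%:R * ((k.+1 - m)%:R * kap)) (i := (k.+1 - m).-1) (j := m) _).
  rewrite subrK; apply.
  by rewrite /= -subnS subSS subnK.
rewrite subSS; case: (ltnP m k) => [mk'|km].
  have := linear_closedD (low_span_closed _) (PH _ mk') QH.
  rewrite subSS addrACA -opprD -scalerDl -natrD.
  by rewrite -binS.
have {mk} mk : m = k by apply/eqP; rewrite eqn_leq km -ltnS mk.
by move: QH; rewrite mk (sym_mono_gt (ltnSn k)) mulr0 add0r !binn.
Qed.

(** Polarization: [coef_linear_closed] puts [sym_mono k m] into [V], induction on the degree removes
    its lower-order terms, and the binomial coefficient is invertible in characteristic zero. *)
Lemma low_span_powers V : linear_closed V ->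
  (forall (w k : nat), V ((P + (w%:R : K) *: Q) ^+ k)) -> forall d p, low_span d p -> V p.
Proof.
move=> hV hP; suff h k : forall m, (m <= k)%N -> V (P ^+ (k - m) * Q ^+ m).
  move=> d; apply: low_span_sub => // i j _.
  by have := h _ _ (leq_addl i j); rewrite addnK.
have [n] := ubnP k; elim: n k => [//|n IH] k; rewrite ltnS => kn m mk.
have Vs : V (sym_mono k m).
  apply: (@coef_linear_closed V k.+1 (sym_mono k)) => // w.
  by rewrite -sym_monoE; exact: hP.
have Vl : forall p, low_span k.-1 p -> V p.
  apply: low_span_sub => // i j ij.
  have := IH (i + j) _ _ (leq_addl i j); rewrite addnK; apply.
  by rewrite (leq_trans ij) // (leq_trans (leq_pred k)).
have /Vl := sym_mono_lead mk; move/(linear_closedB hV Vs); rewrite subKr.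
move/(linear_closedZ ('C(k, m)%:R)^-1 hV); rewrite scalerA mulVf ?scale1r //.
by rewrite pnatr_eq0 -lt0n bin_gt0.
Qed.

Inductive poly_in : A -> Prop :=
| poly_inP : poly_in P
| poly_inQ : poly_in Q
| poly_in_scalar k : poly_in k%:A
| poly_inD p q : poly_in p -> poly_in q -> poly_in (p + q)
| poly_inM p q : poly_in p -> poly_in q -> poly_in (p * q).

Lemma poly_inZ k p : poly_in p -> poly_in (k *: p).
Proof. by move=> hp; rewrite -[p]mul1r scalerAl; apply: poly_inM => //; exact: poly_in_scalar. Qed.

Lemma poly_in_closed : linear_closed poly_in.
Proof.
split; first by rewrite -(scale0r 1); exact: poly_in_scalar.
by move=> k p q hp hq; apply: poly_inD => //; exact: poly_inZ.
Qed.

Lemma poly_in1 : poly_in 1.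
Proof. by rewrite -(scale1r 1); exact: poly_in_scalar. Qed.

Lemma poly_inX p n : poly_in p -> poly_in (p ^+ n).
Proof.
move=> hp; elim: n => [|n IH]; first by rewrite expr0; exact: poly_in1.
by rewrite exprS; exact: poly_inM.
Qed.

(** Left multiplication by a polynomial preserves the union of the [low_span d]; applied to 1, this
    gives a normal form of every polynomial. *)
Lemma poly_in_span V : linear_closed V ->
  (forall (w k : nat), V ((P + (w%:R : K) *: Q) ^+ k)) -> forall p, poly_in p -> V p.
Proof.
move=> hV hP p hp; suff h : forall d q, low_span d q -> exists d', low_span d' (p * q).
  have /(h 1) : low_span 1 1.
    by have := @low_span_mono 1 1 0 0 isT; rewrite scale1r !expr0 mulr1.
  by rewrite mulr1 => -[d']; exact: low_span_powers.
elim: hp => [d q hq|d q hq|k d q hq|{}p p' _ IH _ IH' d q hq|{}p p' _ IH _ IH' d q hq].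
- by exists d.+1; exact: low_span_mulP.
- by exists d.+1; exact: low_span_mulQ.
- by exists d; rewrite -scalerAl mul1r; apply: linear_closedZ => //; exact: low_span_closed.
- have [[d1 h1] [d2 h2]] := (IH _ _ hq, IH' _ _ hq); exists (maxn d1 d2).
  rewrite mulrDl; apply: linear_closedD; first exact: low_span_closed.
    exact: low_span_le (leq_maxl _ _) h1.
  exact: low_span_le (leq_maxr _ _) h2.
have [d1 /IH[d2 h]] := IH' _ _ hq.
by exists d2; rewrite -mulrA.
Qed.

End Span.

(** * Eigenvectors of an operator that is triangular on monomials *)

Section Triangular.
Variables (K : numFieldType) (A : algType K) (L : A -> A) (X Y : A).
Variables (lam mu al be ga : K).
Hypothesis L_linear : linear L.
Hypothesis L_monomial : forall n m, L (X ^+ n * Y ^+ m) =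
  (n%:R * lam + m%:R * mu) *: (X ^+ n * Y ^+ m)
  + (('C(n, 2)%:R * al) *: (X ^+ (n - 2) * Y ^+ m)
   + ((n * m)%:R * be) *: (X ^+ n.-1 * Y ^+ m.-1)
   + ('C(m, 2)%:R * ga) *: (X ^+ n * Y ^+ (m - 2))).
Hypothesis weight_neq0 : forall i j, (0 < i + j)%N -> i%:R * lam + j%:R * mu != 0.

Let weight n m : K := n%:R * lam + m%:R * mu.

Let L0 : L 0 = 0.
Proof.
have := L_linear 1 0 0; rewrite !scale1r addr0 => /eqP.
by rewrite -subr_eq subrr eq_sym => /eqP.
Qed.

Let LZ k p : L (k *: p) = k *: L p.
Proof. by rewrite -[k *: p]addr0 L_linear L0 addr0. Qed.

Let LD p q : L (p + q) = L p + L q.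
Proof. by rewrite -[p]scale1r L_linear !scale1r. Qed.

Let LB p q : L (p - q) = L p - L q.
Proof. by rewrite LD -scaleN1r LZ scaleN1r. Qed.

(** The difference of the two weights is itself a weight, of positive degree. *)
Let weight_eq n m i j : (i <= n)%N -> (j <= m)%N -> (i + j < n + m)%N ->
  weight n m != weight i j.
Proof.
move=> iN jm ijnm; rewrite -subr_eq0 /weight.
have -> : n%:R * lam + m%:R * mu - (i%:R * lam + j%:R * mu)
        = (n - i)%:R * lam + (m - j)%:R * mu by rewrite !natrB //; ring.
by apply: weight_neq0; lia.
Qed.

(* [al], [be], [ga] are multiplied by coefficients that vanish as soon as an
   exponent would be truncated, so only indices of total degree n + m - 2
   contribute. *)
Let lower_ex (nu : K) n m :
  (forall i j, (i <= n)%N -> (j <= m)%N -> (i + j < n + m)%N ->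
     exists2 q, low_span X Y (i + j).+1 q & L q - nu *: q = X ^+ i * Y ^+ j) ->
  exists2 q, low_span X Y (n + m) q &
    L q - nu *: q = ('C(n, 2)%:R * al) *: (X ^+ (n - 2) * Y ^+ m)
   + ((n * m)%:R * be) *: (X ^+ n.-1 * Y ^+ m.-1)
   + ('C(m, 2)%:R * ga) *: (X ^+ n * Y ^+ (m - 2)).
Proof.
move=> h.
have one (c : K) i j : (c != 0 -> (i <= n)%N /\ (j <= m)%N /\ (i + j < n + m)%N) ->
    exists2 q, low_span X Y (n + m) q & L q - nu *: q = c *: (X ^+ i * Y ^+ j).
  have [->|c0] := eqVneq c 0.
    by exists 0; [exact: low_span0 | rewrite L0 scaler0 subr0 scale0r].
  case=> // iN [jm ij]; have [q hq Lq] := h _ _ iN jm ij.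
  exists (c *: q); last by rewrite LZ -Lq scalerBr !scalerA mulrC.
  by apply: linear_closedZ; [exact: low_span_closed | exact: low_span_le hq].
have [q1 h1 L1] : exists2 q, low_span X Y (n + m) q &
    L q - nu *: q = ('C(n, 2)%:R * al) *: (X ^+ (n - 2) * Y ^+ m).
  apply: one; case: n {h} => [|[|n]]; rewrite ?mul0r ?eqxx // => _.
  by rewrite subn2 /= !addSn; split; [rewrite ltnW // ltnW|split => //; rewrite ltnW].
have [q2 h2 L2] : exists2 q, low_span X Y (n + m) q &
    L q - nu *: q = ((n * m)%:R * be) *: (X ^+ n.-1 * Y ^+ m.-1).
  apply: one; case: n {h q1 h1 L1} => [|n]; rewrite ?mul0r ?eqxx //.
  case: m => [|m]; rewrite ?muln0 ?mul0r ?eqxx // => _.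
  by rewrite /= addSn addnS ltnW // !leqnSn.
have [q3 h3 L3] : exists2 q, low_span X Y (n + m) q &
    L q - nu *: q = ('C(m, 2)%:R * ga) *: (X ^+ n * Y ^+ (m - 2)).
  apply: one; case: m {h q1 h1 L1 q2 h2 L2} => [|[|m]]; rewrite ?mul0r ?eqxx // => _.
  by rewrite subn2 /= !addnS; split => //; split; [rewrite ltnW // ltnW|rewrite ltnW].
exists (q1 + q2 + q3).
  by do 2! (apply: linear_closedD => //; try exact: low_span_closed).
by rewrite -L1 -L2 -L3 !LD !scalerDr; abel.
Qed.

(** The numbers [weight i j - nu] are the diagonal entries of L - nu; being nonzero, they allow back
    substitution along the degree. *)
Lemma resolvent_monomial (nu : K) n m :
  (forall i j, (i <= n)%N -> (j <= m)%N -> weight i j != nu) ->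
  exists2 q, low_span X Y (n + m).+1 q & L q - nu *: q = X ^+ n * Y ^+ m.
Proof.
have [N] := ubnP (n + m); elim: N n m => [//|N IH] n m; rewrite ltnS => nmN hnu.
have [|q hq Lq] := @lower_ex nu n m.
  move=> i j iN jm ij; apply: IH; first exact: leq_trans nmN.
  by move=> i' j' i'i j'j; apply: hnu; [exact: leq_trans iN|exact: leq_trans jm].
have w0 : weight n m - nu != 0 by rewrite subr_eq0 hnu.
exists ((weight n m - nu)^-1 *: (X ^+ n * Y ^+ m - q)).
  apply: linear_closedZ; first exact: low_span_closed.
  apply: linear_closedB; first exact: low_span_closed.
    by have := @low_span_mono _ _ X Y (n + m).+1 1 n m (ltnSn _); rewrite scale1r.
  exact: low_span_le hq.
have LE : L (X ^+ n * Y ^+ m - q) - nu *: (X ^+ n * Y ^+ m - q) =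
    (weight n m - nu) *: (X ^+ n * Y ^+ m).
  rewrite LB L_monomial -Lq -/(weight n m).
  move: (L q) (X ^+ n * Y ^+ m) => Q V.
  transitivity ((weight n m - nu) *: V + (1 - 1) *: Q + (nu - nu) *: q).
    by rewrite scalerDr scalerN !scalerBl scale1r; abel.
  by rewrite !subrr !scale0r !addr0.
by rewrite LZ scalerA mulrC -scalerA -scalerBr LE scalerA mulVf // scale1r.
Qed.

(** At the eigenvalue itself only strictly lower monomials have to be inverted, and for these
    [weight_eq] excludes a vanishing diagonal entry. *)
Lemma eigenvector_monomial n m : exists2 q, low_span X Y (n + m) q &
  L (X ^+ n * Y ^+ m + q) = weight n m *: (X ^+ n * Y ^+ m + q).
Proof.
have [|q hq Lq] := @lower_ex (weight n m) n m.
  move=> i j iN jm ij; apply: resolvent_monomial => i' j' i'i j'j.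
  rewrite eq_sym; apply: weight_eq; rewrite ?(leq_trans i'i) ?(leq_trans j'j) //.
  by rewrite (leq_ltn_trans _ ij) // leq_add.
exists (- q).
  by rewrite -scaleN1r; apply: linear_closedZ => //; exact: low_span_closed.
rewrite LB L_monomial -Lq -/(weight n m).
move: (L q) (X ^+ n * Y ^+ m) => Q V.
transitivity (weight n m *: V + (1 - 1) *: Q - weight n m *: q).
  by rewrite !scalerBl scale1r; abel.
by rewrite subrr scale0r addr0 scalerDr scalerN.
Qed.

(** n + m commutators with [l] kill [q] and turn the leading monomial into the nonzero scalar (n +
    m)! x^n y^m. This covers proportional [X] and [Y] too, where the monomials are linearly
    dependent. *)
Lemma monomial_low_span_neq0 l x y n m q : ad l X = x%:A -> ad l Y = y%:A ->
  x != 0 -> y != 0 -> low_span X Y (n + m) q -> X ^+ n * Y ^+ m + q != 0.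
Proof.
move=> hX hY x0 y0 hq; apply/eqP => /(congr1 (iter (n + m) (ad l))).
rewrite iter_ad0 -[X ^+ n * Y ^+ m]scale1r iter_ad_linear scale1r.
have -> : iter (n + m) (ad l) q = 0.
  elim: hq => [|k i j p ij _ IH]; first exact: iter_ad0.
  by rewrite iter_ad_linear IH addr0 (iter_ad_monomial_lt hX hY ij) scaler0.
rewrite addr0 (iter_ad_monomial _ _ hX hY) => /eqP; rewrite scaler_eq0 oner_eq0 orbF.
by rewrite !mulf_eq0 !expf_eq0 (negPf x0) (negPf y0) !andbF !orbF pnatr_eq0 -leqn0 leqNgt fact_gt0.
Qed.

End Triangular.

(** * Operators on the Fock space *)

Section ComplexModulus.
Variable R : realType.
Local Notation C := R[i].
Implicit Types (z w : C) (x y : nat -> C).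

(** The norm of [R[i]] takes its values in [R[i]]; limits and estimates use this real version. *)
Definition cabs z : R := Num.sqrt (sqmod z).

Lemma sqmod_ge0 z : 0 <= sqmod z.
Proof. by rewrite addr_ge0 // sqr_ge0. Qed.

Lemma cabsE z : `|z| = (cabs z)%:C.
Proof. by rewrite normc_def. Qed.

Lemma cabs_ge0 z : 0 <= cabs z. Proof. exact: sqrtr_ge0. Qed.

Lemma cabs_sq z : cabs z ^+ 2 = sqmod z.
Proof. by rewrite sqr_sqrtr // sqmod_ge0. Qed.

Lemma cabsM z w : cabs (z * w) = cabs z * cabs w.
Proof. by apply: complexI; rewrite -cabsE normrM !cabsE rmorphM. Qed.

Lemma cabsD z w : cabs (z + w) <= cabs z + cabs w.
Proof. by have := ler_normD z w; rewrite !cabsE -rmorphD lecR. Qed.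

Lemma cabsN z : cabs (- z) = cabs z.
Proof. by apply: complexI; rewrite -!cabsE normrN. Qed.

Lemma cabsB z w : cabs (z - w) <= cabs z + cabs w.
Proof. by rewrite -(cabsN w) cabsD. Qed.

Lemma cabs_distC z w : cabs (z - w) = cabs (w - z).
Proof. by rewrite -cabsN opprB. Qed.

Lemma cabs_dist_le z w v : cabs (z - v) <= cabs (z - w) + cabs (w - v).
Proof. by apply: le_trans (cabsD _ _); rewrite addrA subrK. Qed.

Lemma cabs0 : cabs 0 = 0.
Proof. by apply: complexI; rewrite -cabsE normr0. Qed.

Lemma cabs0_eq0 z : cabs z = 0 -> z = 0.
Proof. by move=> h; apply/normr0_eq0; rewrite cabsE h. Qed.

Lemma cabs_le0 z : cabs z <= 0 -> z = 0.
Proof. by move=> h; apply: cabs0_eq0; apply/eqP; rewrite eq_le h cabs_ge0. Qed.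

Lemma cabs_real (r : R) : cabs r%:C = `|r|.
Proof. by rewrite /cabs /sqmod /= expr0n addr0 sqrtr_sqr. Qed.

Lemma cabs_conj z : cabs z^* = cabs z.
Proof. by case: z => a b; rewrite /cabs /sqmod /= sqrrN. Qed.

Lemma conj_real (r : R) : (r%:C)^* = r%:C :> C. Proof. exact: conjc_real. Qed.

Lemma conjM z w : (z * w)^* = z^* * w^*. Proof. exact: rmorphM. Qed.

Lemma conjD z w : (z + w)^* = z^* + w^*. Proof. exact: rmorphD. Qed.

Lemma conj_nat (n : nat) : (n%:R : C)^* = n%:R. Proof. exact: conjc_nat. Qed.

Lemma cabsX z n : cabs (z ^+ n) = cabs z ^+ n.
Proof. by apply: complexI; rewrite -cabsE normrX cabsE rmorphXn. Qed.

Lemma cabs_nat n : cabs n%:R = n%:R.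
Proof.
by apply: complexI; rewrite -cabsE normr_nat rmorph_nat.
Qed.

Lemma cabsV z : cabs z^-1 = (cabs z)^-1.
Proof. by apply: complexI; rewrite -cabsE normfV cabsE fmorphV. Qed.

Lemma cabs_sum (I : Type) (r : seq I) (P : pred I) (F : I -> C) :
  cabs (\sum_(i <- r | P i) F i) <= \sum_(i <- r | P i) cabs (F i).
Proof.
elim/big_rec2: _ => [|i a b _ h]; first by rewrite cabs0.
by apply: le_trans (cabsD _ _) _; rewrite lerD2l.
Qed.

Lemma Re_le_cabs z : `|complex.Re z| <= cabs z.
Proof. by rewrite -[X in X <= _]sqrtr_sqr ler_wsqrtr // lerDl sqr_ge0. Qed.

Lemma Im_le_cabs z : `|complex.Im z| <= cabs z.
Proof. by rewrite -[X in X <= _]sqrtr_sqr ler_wsqrtr // lerDr sqr_ge0. Qed.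

Lemma cabs_le_ReIm z : cabs z <= `|complex.Re z| + `|complex.Im z|.
Proof.
rewrite -[X in _ <= X]ger0_norm ?addr_ge0 // -sqrtr_sqr ler_wsqrtr //.
rewrite sqrrD !real_normK ?num_real // /sqmod.
by rewrite -addrA [X in _ <= _ + X]addrC addrA lerDl mulrn_wge0 // mulr_ge0.
Qed.

Lemma sqmodM z w : sqmod (z * w) = sqmod z * sqmod w.
Proof. by rewrite -!cabs_sq cabsM exprMn. Qed.

Lemma sqmodD_le z w : sqmod (z + w) <= 2 * sqmod z + 2 * sqmod w.
Proof.
case: z w => [a b] [c d]; rewrite /sqmod /=.
rewrite -subr_ge0 [X in 0 <= X](_ : _ = (a - c) ^+ 2 + (b - d) ^+ 2); last ring.
by rewrite addr_ge0 // sqr_ge0.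
Qed.

Lemma sqmod0 : sqmod (0 : C) = 0.
Proof. by rewrite -cabs_sq cabs0 expr0n. Qed.

Lemma cvg_sum_real (I T : Type) (G : set_system T) {FG : Filter G} (r : seq I)
    (f : I -> T -> R) (l : I -> R) : (forall i, f i t @[t --> G] --> l i) ->
  \sum_(i <- r) f i t @[t --> G] --> \sum_(i <- r) l i.
Proof.
move=> fl; elim: r => [|i r IH].
  by rewrite big_nil; under eq_fun do rewrite big_nil; exact: cvg_cst.
by rewrite big_cons; under eq_fun do rewrite big_cons; exact: cvgD.
Qed.

Lemma cvg_dist0 (u : nat -> R) l : u @ \oo --> l -> `|u n - l| @[n --> \oo] --> (0 : R).
Proof.
move=> ul; have h : u n - l @[n --> \oo] --> l - l by apply: cvgB => //; exact: cvg_cst.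
by rewrite subrr in h; rewrite -(normr0 R); exact: cvg_norm.
Qed.

Lemma series_bounded_cvg (u : nat -> R) M : (forall n, 0 <= u n) ->
  (forall N, \sum_(0 <= n < N) u n <= M) -> cvgn (series u).
Proof.
move=> u0 uM; apply: nondecreasing_is_cvgn; last first.
  by exists M => _ [n _ <-]; exact: uM.
by apply/nondecreasing_seqP => n; rewrite seriesSr lerDl.
Qed.

Lemma series_le_lim (u : nat -> R) N : (forall n, 0 <= u n) -> cvgn (series u) ->
  \sum_(0 <= n < N) u n <= limn (series u).
Proof.
move=> u0 cu; apply: (nondecreasing_cvgn_le _ cu).
by apply/nondecreasing_seqP => n; rewrite seriesSr lerDl.
Qed.

Lemma lim_series_bounded (u : nat -> R) M : (forall n, 0 <= u n) ->
  (forall N, \sum_(0 <= n < N) u n <= M) -> limn (series u) <= M.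
Proof.
move=> u0 uM; apply: limr_le; first exact: series_bounded_cvg uM.
by near=> n; exact: uM.
Unshelve. all: by end_near.
Qed.

(** Summation through two real series, so that convergence is always that of a real sequence, stated
    as [cabs] of a difference tending to 0. *)
Definition csum x : C :=
  Complex (limn (series (fun n => complex.Re (x n)))) (limn (series (fun n => complex.Im (x n)))).

Lemma Re_sum (I : Type) (r : seq I) (F : I -> C) :
  complex.Re (\sum_(i <- r) F i) = \sum_(i <- r) complex.Re (F i).
Proof. by elim/big_rec2: _ => [//|i a b _ <-]; case: (F i) b => [? ?] [? ?]. Qed.

Lemma Im_sum (I : Type) (r : seq I) (F : I -> C) :
  complex.Im (\sum_(i <- r) F i) = \sum_(i <- r) complex.Im (F i).
Proof. by elim/big_rec2: _ => [//|i a b _ <-]; case: (F i) b => [? ?] [? ?]. Qed.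

Lemma csum_cvg x : cvgn (series (fun n => cabs (x n))) ->
  cabs (series x n - csum x) @[n --> \oo] --> (0 : R).
Proof.
move=> cx.
have cRe : cvgn (series (fun n => complex.Re (x n))).
  apply: normed_cvg; apply: (series_le_cvg _ _ _ cx) => n //=; first exact: cabs_ge0.
  exact: Re_le_cabs.
have cIm : cvgn (series (fun n => complex.Im (x n))).
  apply: normed_cvg; apply: (series_le_cvg _ _ _ cx) => n //=; first exact: cabs_ge0.
  exact: Im_le_cabs.
have h0 : `|series (fun n => complex.Re (x n)) n - limn (series (fun n => complex.Re (x n)))|
   + `|series (fun n => complex.Im (x n)) n - limn (series (fun n => complex.Im (x n)))|
   @[n --> \oo] --> (0 : R).
  rewrite -[X in _ --> X]addr0; apply: cvgD.
    exact: cvg_dist0.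
  exact: cvg_dist0.
apply: (squeeze_cvgr _ (cvg_cst 0) h0); near=> n; rewrite cabs_ge0 /=.
apply: le_trans (cabs_le_ReIm _) _.
rewrite /series /=; set s := \sum_(_ <= _ < _) x _.
by rewrite /csum -Re_sum -Im_sum -/s; case: s.
Unshelve. all: by end_near.
Qed.

Lemma cabs_lim_le (u : nat -> C) (l w : C) (M : R) :
  cabs (u n - l) @[n --> \oo] --> (0 : R) ->
  (\forall n \near \oo, cabs (u n - w) <= M) -> cabs (l - w) <= M.
Proof.
move=> ul hM; apply/ler_addgt0Pr => e e0.
have /cvgrPdist_le /(_ e e0) := ul => {}ul.
near \oo => n.
apply: le_trans (cabs_dist_le _ (u n) _) _; rewrite addrC lerD //; first by near: n.
rewrite cabs_distC -[X in X <= _]ger0_norm ?cabs_ge0 // -[X in X <= _]normrN -[- _]sub0r.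
by near: n.
Unshelve. all: by end_near.
Qed.

Lemma ler_dist_cabs z w : `|cabs z - cabs w| <= cabs (z - w).
Proof.
by have := ler_dist_dist z w; rewrite !cabsE lecR -rmorphB cabs_real.
Qed.

Lemma cvg_cabs (u : nat -> C) (l : C) : cabs (u n - l) @[n --> \oo] --> (0 : R) ->
  cabs (u n) @[n --> \oo] --> cabs l.
Proof.
move/cvgrPdist_le => h; apply/cvgrPdist_le => e /h{}h; near=> n.
apply: le_trans (ler_dist_cabs _ _) _; rewrite cabs_distC.
rewrite -[X in X <= _]ger0_norm ?cabs_ge0 // -[X in X <= _]normrN -[- _]sub0r.
by near: n.
Unshelve. all: by end_near.
Qed.

Lemma cabs_lim_unique (u : nat -> C) (l l' : C) :
  cabs (u n - l) @[n --> \oo] --> (0 : R) ->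
  cabs (u n - l') @[n --> \oo] --> (0 : R) -> l = l'.
Proof.
move=> ul ul'; apply/eqP; rewrite -subr_eq0; apply/eqP/cabs_le0.
apply/ler_addgt0Pr => e e0; rewrite add0r; apply: (cabs_lim_le ul).
move/cvgrPdist_le: ul' => /(_ e e0) h; near=> n.
rewrite -[X in X <= _]ger0_norm ?cabs_ge0 // -[X in X <= _]normrN -[- _]sub0r.
by near: n.
Unshelve. all: by end_near.
Qed.

(** A positive element of [R[i]] is real, so the distances defining the topology of [R[i]] reduce to
    [cabs]. *)
Lemma cvg_complex (u : nat -> C) (l : C) :
  cabs (u n - l) @[n --> \oo] --> (0 : R) -> u @ \oo --> l.
Proof.
move=> ul; apply/cvgrPdist_le => e; rewrite ltcE /= => /andP[/eqP eI eR].
have -> : e = (complex.Re e)%:C by case: e eI {eR} => a b /= ->.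
move/cvgrPdist_le: ul => /(_ _ eR) h; near=> n.
rewrite cabsE lecR cabs_distC -[X in X <= _]ger0_norm ?cabs_ge0 //.
by rewrite -[X in X <= _]normrN -[- _]sub0r; near: n.
Unshelve. all: by end_near.
Qed.

Lemma sum_geometric_le (H : R) K N : 0 <= H ->
  \sum_(K <= k < N) H / 2 ^+ k <= 2 * H / 2 ^+ K.
Proof.
move=> H0; have [NK|KN] := leqP N K.
  by rewrite big_geq // divr_ge0 ?mulr_ge0 ?exprn_ge0.
suff -> : \sum_(K <= k < N) H / 2 ^+ k = 2 * H / 2 ^+ K - 2 * H / 2 ^+ N.
  by rewrite lerBlDr lerDl divr_ge0 ?mulr_ge0 ?exprn_ge0.
rewrite -[RHS]opprB -(telescope_sumr (fun k => 2 * H / 2 ^+ k)) ?(ltnW KN) // -sumrN.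
apply: eq_bigr => k _; have p0 : (2 : R) ^+ k != 0 by rewrite expf_neq0 // pnatr_eq0.
by rewrite exprS; field.
Qed.

(** The bound is demanded only from [K] on: a Taylor remainder of order [K] has constants that fail
    for the earlier terms. *)
Lemma csum_tail x (H : R) K : 0 <= H -> (forall k, (K <= k)%N -> cabs (x k) <= H / 2 ^+ k) ->
  cabs (series x n - csum x) @[n --> \oo] --> (0 : R) /\
  cabs (csum x - series x K) <= 2 * H / 2 ^+ K.
Proof.
move=> H0 hx.
have cx : cvgn (series (fun n => cabs (x n))).
  apply: (@series_bounded_cvg _ (\sum_(0 <= n < K) cabs (x n) + 2 * H / 2 ^+ K)).
    by move=> n; exact: cabs_ge0.
  move=> N; have [NK|KN] := leqP N K.
    rewrite [X in _ <= X + _](big_cat_nat (leq0n N) NK) //= -addrA lerDl addr_ge0 //.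
      by apply: sumr_ge0 => i _; exact: cabs_ge0.
    by rewrite divr_ge0 ?mulr_ge0 ?exprn_ge0.
  rewrite (big_cat_nat (leq0n K) (ltnW KN)) //= lerD2l.
  apply: le_trans (sum_geometric_le _ N H0).
  rewrite big_nat [X in _ <= X]big_nat; apply: ler_sum => k /andP[/hx]; exact.
split; first exact: csum_cvg.
apply: (cabs_lim_le (csum_cvg cx)); exists K => // n /= Kn.
rewrite sub_series_geq //; apply: le_trans (cabs_sum _ _ _) _.
apply: le_trans (sum_geometric_le _ n H0).
rewrite big_nat [X in _ <= X]big_nat; apply: ler_sum => k /andP[/hx]; exact.
Qed.

End ComplexModulus.

#[local] Arguments fock_seq : simpl never.
#[local] Arguments ebasis : simpl never.

Section FockOperators.
Variable R : realType.
Local Notation C := R[i].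
Local Notation op := (fock R -> fock R).
Implicit Types (x y : fock R) (X Y : op).

Lemma fock_summable x : square_summable x.
Proof. by case: x => x hx; exact: (asboolW hx). Qed.

Lemma fock_ext x y : (forall n, x n = y n) -> x = y.
Proof. by move=> h; apply: val_inj; apply/funext. Qed.

Lemma fock_linE (c : C) x y n : (c *: x + y) n = c * x n + y n.
Proof. by []. Qed.

Lemma fockZE (c : C) x n : (c *: x) n = c * x n. Proof. by []. Qed.
Lemma fockDE x y n : (x + y) n = x n + y n. Proof. by []. Qed.
Lemma fockNE x n : (- x) n = - x n. Proof. by []. Qed.
Lemma fock0E n : (0 : fock R) n = 0. Proof. by []. Qed.

Lemma fnorm_ge0 x : 0 <= fnorm x. Proof. exact: sqrtr_ge0. Qed.

Lemma fnorm_sq x : fnorm x ^+ 2 = limn (series (fun n => sqmod (x n))).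
Proof.
rewrite sqr_sqrtr //.
have := @series_le_lim _ _ 0 (fun n => sqmod_ge0 (x n)) (@fock_summable x).
by rewrite big_nil.
Qed.

Lemma sum_sqmod_le x N : \sum_(0 <= n < N) sqmod (x n) <= fnorm x ^+ 2.
Proof. by rewrite fnorm_sq; exact: (@series_le_lim _ _ N (fun n => sqmod_ge0 (x n)) (@fock_summable x)). Qed.

Lemma fnorm_sq_le x M : (forall N, \sum_(0 <= n < N) sqmod (x n) <= M) -> fnorm x ^+ 2 <= M.
Proof. by move=> h; rewrite fnorm_sq; apply: lim_series_bounded => // n; exact: sqmod_ge0. Qed.

Lemma ell2_bounded (x : nat -> C) M :
  (forall N, \sum_(0 <= n < N) sqmod (x n) <= M) -> x \in @ell2 R.
Proof.
move=> h; apply/asboolP; apply: series_bounded_cvg h => n; exact: sqmod_ge0.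
Qed.

Lemma insubd_ell2 (x : nat -> C) M n :
  (forall N, \sum_(0 <= n < N) sqmod (x n) <= M) -> (insubd (0 : fock R) x) n = x n.
Proof. by move=> /ell2_bounded h; rewrite /insubd insubT. Qed.

Lemma cabs_le_fnorm x n : cabs (x n) <= fnorm x.
Proof.
rewrite -[cabs _]ger0_norm ?cabs_ge0 // -[fnorm x]ger0_norm ?fnorm_ge0 //.
rewrite -!sqrtr_sqr ler_wsqrtr // cabs_sq; apply: le_trans (sum_sqmod_le x n.+1).
by rewrite big_nat_recr //= lerDr; apply: sumr_ge0 => i _; exact: sqmod_ge0.
Qed.

Lemma ebasisE n k : (ebasis R n) k = (k == n)%:R. Proof. by []. Qed.

Definition trunc x N : fock R := \sum_(0 <= n < N) x n *: ebasis R n.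

Lemma fock_sumE (I : Type) (r : seq I) (F : I -> fock R) m :
  (\sum_(i <- r) F i) m = \sum_(i <- r) F i m.
Proof. by elim/big_rec2: _ => [//|i a b _ <-]. Qed.

Lemma truncE x N m : (trunc x N) m = if (m < N)%N then x m else 0.
Proof.
rewrite /trunc fock_sumE; elim: N => [|N IH]; first by rewrite big_nil.
rewrite big_nat_recr //= IH fockZE ebasisE [in RHS]ltnS [in RHS]leq_eqVlt.
by case: eqVneq => [->|mN] /=; rewrite ?ltnn ?(add0r, mulr1, mulr0, addr0).
Qed.

Lemma fnorm_trunc_cvg x (e : R) : 0 < e ->
  \forall N \near \oo, fnorm (x - trunc x N) <= e.
Proof.
move=> e0; have /cvgrPdist_le /(_ (e ^+ 2)) := @fock_summable x.
rewrite exprn_gt0 // => /(_ isT) h; near=> N.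
rewrite -(@ler_pXn2r _ 2) ?nnegrE ?fnorm_ge0 ?(ltW e0) //.
apply: fnorm_sq_le => K.
have hN : `|limn (series (fun n => sqmod (x n))) - series (fun n => sqmod (x n)) N| <= e ^+ 2.
  by near: N.
rewrite -fnorm_sq in hN; apply: le_trans (le_trans (ler_norm _) hN).
rewrite lerBrDl.
have [KN|NK] := leqP K N.
  rewrite [X in _ + X <= _]big1_seq ?addr0; first exact: sum_sqmod_le.
  move=> i /andP[_]; rewrite mem_index_iota => /= iK.
  by rewrite fockDE fockNE truncE (leq_trans iK KN) subrr sqmod0.
apply: le_trans (sum_sqmod_le x K).
rewrite /series /= (big_cat_nat (leq0n N) (ltnW NK)) /=.
rewrite [X in _ <= X](big_cat_nat (leq0n N) (ltnW NK)) /= lerD2l.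
rewrite big1_seq ?add0r; last first.
  move=> i /andP[_]; rewrite mem_index_iota => /= iN.
  by rewrite fockDE fockNE truncE iN subrr sqmod0.
rewrite big_nat [X in _ <= X]big_nat; apply: ler_sum => i /andP[Ni _].
by rewrite fockDE fockNE truncE ltnNge Ni /= subr0.
Unshelve. all: by end_near.
Qed.

Lemma linear_sumE X x N m : linear X ->
  (X (trunc x N)) m = \sum_(0 <= n < N) x n * (X (ebasis R n)) m.
Proof.
move=> hX.
have X0 : X 0 = 0.
  have := hX 1 0 0; rewrite !scale1r addr0 => /eqP.
  by rewrite -subr_eq subrr eq_sym => /eqP.
rewrite /trunc; elim: N => [|N IH]; first by rewrite !big_nil X0.
by rewrite !big_nat_recr //= addrC hX fock_linE IH addrC.
Qed.

Lemma bounded_op_cvg X x m : bounded_op X ->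
  cabs (\sum_(0 <= n < N) x n * (X (ebasis R n)) m - X x m) @[N --> \oo] --> (0 : R).
Proof.
case=> hX [M hM]; apply/cvgrPdist_le => e e0; near=> N.
rewrite sub0r normrN ger0_norm ?cabs_ge0 // -linear_sumE //.
have -> : X (trunc x N) m - X x m = (X (- (x - trunc x N))) m.
  rewrite (_ : - _ = -1 *: x + trunc x N); last by rewrite opprB scaleN1r addrC.
  by rewrite hX fock_linE mulN1r addrC.
apply: le_trans (cabs_le_fnorm _ _) _; apply: le_trans (hM _) _.
have -> : fnorm (- (x - trunc x N)) = fnorm (x - trunc x N).
  rewrite /fnorm /l2norm; congr (Num.sqrt (limn (series _))).
  by apply/funext => k; rewrite fockNE -!cabs_sq cabsN.
have : fnorm (x - trunc x N) <= e / (`|M| + 1).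
  by near: N; apply: fnorm_trunc_cvg; rewrite divr_gt0 // ltr_wpDl.
rewrite ler_pdivlMr ?ltr_wpDl // => h; apply: le_trans h; rewrite mulrC.
by apply: ler_wpM2l; rewrite ?fnorm_ge0 // (le_trans (ler_norm _)) // lerDl.
Unshelve. all: by end_near.
Qed.

(** Most operator identities below are reduced to matrix entries through this lemma. *)
Lemma bounded_op_ext X Y : bounded_op X -> bounded_op Y ->
  (forall n m, X (ebasis R n) m = Y (ebasis R n) m) -> X = Y.
Proof.
move=> hX hY XY; apply/funext => x; apply: fock_ext => m.
apply: (cabs_lim_unique (bounded_op_cvg x m hX)).
have := bounded_op_cvg x m hY.
by under eq_fun do under eq_bigr do rewrite -XY.
Qed.

(** Only finite sections occur, so the condition can be checked before the operator exists. [M]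
    bounds the square of the norm. *)
Definition matrix_bounded (b : nat -> nat -> C) (M : R) :=
  forall K N (x : nat -> C),
    \sum_(0 <= m < K) sqmod (\sum_(0 <= n < N) b m n * x n)
    <= M * \sum_(0 <= n < N) sqmod (x n).

Lemma matrix_bounded_row b M m N : 0 <= M -> matrix_bounded b M ->
  \sum_(0 <= n < N) sqmod (b m n) <= M.
Proof.
(* Tested on the conjugate of the row, the m-th component alone contributes S^2, where S is the sum
   to be bounded. *)
move=> M0 /(_ m.+1 N (fun n => (b m n)^*)); set S := \sum_(0 <= n < N) sqmod (b m n).
have -> : \sum_(0 <= n < N) sqmod (b m n)^* = S.
  by apply: eq_bigr => i _; rewrite -!cabs_sq cabs_conj.
have ES : \sum_(0 <= n < N) b m n * (b m n)^* = S%:C.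
  rewrite rmorph_sum; apply: eq_bigr => i _; rewrite -normCK cabsE -rmorphXn /=.
  by rewrite cabs_sq.
rewrite big_nat_recr //= ES -[X in _ + X]cabs_sq cabs_real.
have S0 : 0 <= S by apply: sumr_ge0 => i _; exact: sqmod_ge0.
move=> h; have {h} : S ^+ 2 <= M * S.
  apply: le_trans h; rewrite real_normK ?num_real // lerDr.
  by apply: sumr_ge0 => i _; exact: sqmod_ge0.
by rewrite expr2; have [->//|S1] := eqVneq S 0; rewrite ler_pM2r // lt_neqAle eq_sym S1.
Qed.

Lemma cabs_mul_le (z w : C) : cabs (z * w) <= sqmod z + sqmod w.
Proof.
rewrite -!cabs_sq cabsM.
have := sqr_ge0 (cabs z - cabs w); have := sqr_ge0 (cabs z); have := sqr_ge0 (cabs w).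
rewrite !expr2; nra.
Qed.

(** Rows are square summable by [matrix_bounded_row], so each component is an absolutely convergent
    series; the bound on finite sections passes to the limit in [N] for fixed [K], then to all
    components. *)
Lemma matrix_op b M : 0 <= M -> matrix_bounded b M ->
  exists2 X, bounded_op X & forall n m, X (ebasis R n) m = b m n.
Proof.
move=> M0 hb.
have cv x m : cabs (series (fun n => b m n * x n) n - csum (fun n => b m n * x n))
    @[n --> \oo] --> (0 : R).
  apply: csum_cvg; apply: (@series_bounded_cvg _ _ (M + fnorm x ^+ 2)) => [n|N].
    exact: cabs_ge0.
  apply: (@le_trans _ _ (\sum_(0 <= n < N) (sqmod (b m n) + sqmod (x n)))).
    by apply: ler_sum => i _; exact: cabs_mul_le.
  by rewrite big_split /= lerD ?sum_sqmod_le // matrix_bounded_row.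
have bd x K : \sum_(0 <= m < K) sqmod (csum (fun n => b m n * x n)) <= M * fnorm x ^+ 2.
  have h : \sum_(0 <= m < K) sqmod (series (fun n => b m n * x n) N)
      @[N --> \oo] --> \sum_(0 <= m < K) sqmod (csum (fun n => b m n * x n)).
    apply: cvg_sum_real => m.
    have hc := cvg_cabs (cv x m).
    have : cabs (series (fun n => b m n * x n) N) ^+ 2 @[N --> \oo] -->
        cabs (csum (fun n => b m n * x n)) ^+ 2.
      by under eq_fun do rewrite expr2; rewrite expr2; exact: cvgM.
    by rewrite cabs_sq; under eq_fun do rewrite cabs_sq.
  rewrite -(cvg_lim (@norm_hausdorff _ _) h); apply: limr_le; first by apply/cvg_ex; eexists; exact: h.
  near=> N; apply: le_trans (hb _ _ _) _.
  by rewrite ler_wpM2l ?sum_sqmod_le.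
have [F FE] : exists F : op, forall x m, F x m = csum (fun n => b m n * x n).
  exists (fun x => insubd (0 : fock R) (fun m => csum (fun n => b m n * x n))) => x m.
  exact: insubd_ell2 (bd x).
exists F.
  split.
    move=> c x y; apply: fock_ext => m; rewrite fock_linE !FE.
    apply: (cabs_lim_unique (cv _ m)); apply/cvgrPdist_le => e e0; near=> N.
    rewrite sub0r normrN ger0_norm ?cabs_ge0 //.
    have -> : series (fun n => b m n * (c *: x + y) n) N = c * series (fun n => b m n * x n) N
       + series (fun n => b m n * y n) N.
      rewrite /series /= mulr_sumr -big_split; apply: eq_bigr => i _.
      by rewrite fock_linE mulrDr mulrCA.
    rewrite opprD addrACA -mulrBr; apply: le_trans (cabsD _ _) _; rewrite cabsM.
    rewrite [e]splitr lerD //.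
      have : cabs (series (fun n => b m n * x n) N - csum (fun n => b m n * x n))
          <= e / 2 / (cabs c + 1).
        rewrite -[X in X <= _]ger0_norm ?cabs_ge0 // -[X in X <= _]normrN -[- _]sub0r; near: N.
        by apply/(cvgrPdist_le _ _).1; [exact: cv|rewrite !divr_gt0 // ltr_wpDl // cabs_ge0].
      rewrite ler_pdivlMr ?ltr_wpDl ?cabs_ge0 // mulrC; apply: le_trans.
      by rewrite ler_wpM2r ?cabs_ge0 // lerDl.
    rewrite -[X in X <= _]ger0_norm ?cabs_ge0 // -[X in X <= _]normrN -[- _]sub0r; near: N.
    by apply/(cvgrPdist_le _ _).1; [exact: cv|rewrite !divr_gt0].
  exists (Num.sqrt M) => x.
  rewrite -(@ler_pXn2r _ 2) ?nnegrE ?mulr_ge0 ?fnorm_ge0 ?sqrtr_ge0 //.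
  rewrite exprMn (sqr_sqrtr M0).
  apply: fnorm_sq_le => N.
  by under eq_bigr do rewrite FE; exact: bd.
move=> n m; rewrite FE.
apply: (cabs_lim_unique (cv _ m)); apply: cvg_near_cst; exists n.+1 => // N /= nN.
rewrite /series /= (bigD1_seq n) ?mem_index_iota ?iota_uniq //=.
rewrite ebasisE eqxx mulr1 big1 ?addr0 ?subrr ?cabs0 // => i /negPf ni.
by rewrite ebasisE ni mulr0.
Unshelve. all: by end_near.
Qed.

End FockOperators.

(** * Hilbert-Schmidt norm and matrices with geometric decay *)

Section HilbertSchmidt.
Variable R : realType.
Local Notation C := R[i].
Local Notation op := (fock R -> fock R).
Implicit Types (x y : fock R) (X Y : op).

Lemma hsnorm_ge0 X : 0 <= hsnorm X. Proof. exact: sqrtr_ge0. Qed.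

Lemma hs_bounded_op X : hilbert_schmidt X -> bounded_op X.
Proof. by case. Qed.

Lemma hsnorm_sq X : hilbert_schmidt X ->
  hsnorm X ^+ 2 = limn (series (fun n => fnorm (X (ebasis R n)) ^+ 2)).
Proof.
case=> _ cX; rewrite sqr_sqrtr //.
have := @series_le_lim R _ 0 (fun n => sqr_ge0 (fnorm (X (ebasis R n)))) cX.
by rewrite big_nil.
Qed.

Lemma sum_fnorm_le X N : hilbert_schmidt X ->
  \sum_(0 <= n < N) fnorm (X (ebasis R n)) ^+ 2 <= hsnorm X ^+ 2.
Proof.
move=> hX; rewrite hsnorm_sq //; case: hX => _ cX.
exact: (@series_le_lim R _ N (fun n => sqr_ge0 (fnorm (X (ebasis R n)))) cX).
Qed.

Lemma hsnorm_sq_le X M : hilbert_schmidt X ->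
  (forall N, \sum_(0 <= n < N) fnorm (X (ebasis R n)) ^+ 2 <= M) -> hsnorm X ^+ 2 <= M.
Proof.
by move=> hX h; rewrite hsnorm_sq //; apply: lim_series_bounded => // n; exact: sqr_ge0.
Qed.

Lemma hilbert_schmidt_bounded X M : bounded_op X ->
  (forall N, \sum_(0 <= n < N) fnorm (X (ebasis R n)) ^+ 2 <= M) -> hilbert_schmidt X.
Proof. by move=> hX h; split => //; apply: series_bounded_cvg h => n; exact: sqr_ge0. Qed.

Lemma cabs_le_hsnorm X n m : hilbert_schmidt X -> cabs ((X (ebasis R n)) m) <= hsnorm X.
Proof.
move=> hX; apply: le_trans (cabs_le_fnorm _ _) _.
rewrite -(@ler_pXn2r _ 2) ?nnegrE ?fnorm_ge0 ?hsnorm_ge0 //.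
apply: le_trans (sum_fnorm_le n.+1 hX); rewrite big_nat_recr //= lerDr.
by apply: sumr_ge0 => i _; exact: sqr_ge0.
Qed.

Lemma fnormD_sq_le (c : C) x y :
  fnorm (c *: x + y) ^+ 2 <= 2 * (cabs c ^+ 2 * fnorm x ^+ 2) + 2 * fnorm y ^+ 2.
Proof.
apply: fnorm_sq_le => N.
apply: (@le_trans _ _ (\sum_(0 <= n < N) (2 * (cabs c ^+ 2 * sqmod (x n)) + 2 * sqmod (y n)))).
  by apply: ler_sum => i _; rewrite fock_linE cabs_sq -sqmodM sqmodD_le.
rewrite big_split /= -!mulr_sumr lerD // ler_wpM2l ?ler_wpM2l ?sqr_ge0 ?sum_sqmod_le //.
Qed.

Lemma bounded_opD (c : C) X Y : bounded_op X -> bounded_op Y -> bounded_op (c *: X + Y).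
Proof.
move=> [lX [M hM]] [lY [M' hM']]; split.
  move=> k x y; rewrite !fctE lX lY !scalerDr !scalerA (mulrC c k) -!scalerA; abel.
exists (Num.sqrt (2 * (cabs c ^+ 2 * M ^+ 2) + 2 * M' ^+ 2)) => x.
have K0 : 0 <= 2 * (cabs c ^+ 2 * M ^+ 2) + 2 * M' ^+ 2.
  by apply: addr_ge0; rewrite pmulr_rge0 ?sqr_ge0 ?ltr0n // mulr_ge0 ?sqr_ge0.
rewrite -(@ler_pXn2r _ 2) ?nnegrE ?mulr_ge0 ?fnorm_ge0 ?sqrtr_ge0 //.
rewrite exprMn (sqr_sqrtr K0); apply: le_trans (fnormD_sq_le _ _ _) _.
have sq_le (a b r : R) : 0 <= r -> r <= a * b -> r ^+ 2 <= a ^+ 2 * b ^+ 2.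
  move=> r0 rab; rewrite -exprMn ler_sqr ?nnegrE //; exact: le_trans rab.
have hx := sq_le _ _ _ (fnorm_ge0 _) (hM x); have hy := sq_le _ _ _ (fnorm_ge0 _) (hM' x).
have := ler_wpM2l (sqr_ge0 (cabs c)) hx.
move: hy; move: (fnorm _ ^+ 2) (fnorm _ ^+ 2) (fnorm x ^+ 2) (cabs c ^+ 2) => *; lra.
Qed.

Lemma hilbert_schmidtD (c : C) X Y : hilbert_schmidt X -> hilbert_schmidt Y ->
  hilbert_schmidt (c *: X + Y) /\
  hsnorm (c *: X + Y) ^+ 2 <= 2 * (cabs c ^+ 2 * hsnorm X ^+ 2) + 2 * hsnorm Y ^+ 2.
Proof.
move=> hX hY.
have h N : \sum_(0 <= n < N) fnorm ((c *: X + Y) (ebasis R n)) ^+ 2 <=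
    2 * (cabs c ^+ 2 * hsnorm X ^+ 2) + 2 * hsnorm Y ^+ 2.
  apply: (@le_trans _ _ (\sum_(0 <= n < N) (2 * (cabs c ^+ 2 * fnorm (X (ebasis R n)) ^+ 2)
      + 2 * fnorm (Y (ebasis R n)) ^+ 2))).
    by apply: ler_sum => i _; exact: fnormD_sq_le.
  rewrite big_split /= -!mulr_sumr lerD // ler_wpM2l ?ler_wpM2l ?sqr_ge0 ?sum_fnorm_le //.
have hXY : hilbert_schmidt (c *: X + Y).
  by apply: hilbert_schmidt_bounded h; apply: bounded_opD; [case: hX|case: hY].
by split => //; exact: hsnorm_sq_le.
Qed.

Lemma bounded_op0 : bounded_op (0 : op).
Proof.
have op0E x : (0 : op) x = 0 by [].
split; first by move=> c x y; rewrite !op0E scaler0 addr0.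
exists 0 => x; rewrite op0E mul0r -[fnorm _]ger0_norm ?fnorm_ge0 // normr_le0 -sqrf_eq0.
rewrite eq_le sqr_ge0 andbT; apply: fnorm_sq_le => N.
by rewrite big1 // => i _; rewrite fock0E sqmod0.
Qed.

Lemma hilbert_schmidt0 : hilbert_schmidt (0 : op).
Proof.
apply: (@hilbert_schmidt_bounded _ 0); first exact: bounded_op0.
move=> N; rewrite big1 // => n _; apply/eqP; rewrite eq_le sqr_ge0 andbT.
by apply: fnorm_sq_le => K; rewrite big1 // => i _; rewrite fock0E sqmod0.
Qed.

Lemma hilbert_schmidtZ (c : C) X : hilbert_schmidt X -> hilbert_schmidt (c *: X).
Proof.
by move=> hX; have [] := hilbert_schmidtD c hX hilbert_schmidt0; rewrite addr0. Qed.

Lemma hilbert_schmidtB X Y : hilbert_schmidt X -> hilbert_schmidt Y -> hilbert_schmidt (X - Y).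
Proof.
by move=> hX hY; rewrite -scaleN1r addrC; exact: (hilbert_schmidtD _ _ _).1.
Qed.

Lemma sum_geometric_lt1 (q : R) N : 0 <= q -> q < 1 ->
  \sum_(0 <= n < N) q ^+ n <= (1 - q)^-1.
Proof.
move=> q0 q1; have q1' : 0 < 1 - q by rewrite subr_gt0.
rewrite -[X in _ <= X]mul1r ler_pdivlMr // mulrC.
suff -> : (1 - q) * \sum_(0 <= n < N) q ^+ n = 1 - q ^+ N by rewrite lerBlDr lerDl exprn_ge0.
elim: N => [|N IH]; first by rewrite big_nil mulr0 subrr.
rewrite big_nat_recr //= mulrDr IH exprS; ring.
Qed.

(* Everything that follows is estimated entrywise against [M * th ^+ (m + n)]. *)
Lemma decay_hsnorm X (th M : R) : 0 <= th -> th < 1 -> 0 <= M -> bounded_op X ->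
  (forall m n, cabs ((X (ebasis R n)) m) <= M * th ^+ (m + n)) ->
  hilbert_schmidt X /\ hsnorm X <= M / (1 - th ^+ 2).
Proof.
move=> th0 th1 M0 hX hM.
have th21 : th ^+ 2 < 1 by rewrite exprn_ilt1.
set q := th ^+ 2 in th21 *; have q0 : 0 <= q by exact: sqr_ge0.
have q1 : 0 < 1 - q by rewrite subr_gt0.
have hn n : fnorm (X (ebasis R n)) ^+ 2 <= M ^+ 2 * (1 - q)^-1 * q ^+ n.
  apply: fnorm_sq_le => N.
  apply: (@le_trans _ _ (\sum_(0 <= m < N) (M ^+ 2 * q ^+ n * q ^+ m))).
    apply: ler_sum => m _; rewrite -cabs_sq -mulrA -exprD -exprM mulnC addnC exprM -exprMn.
    by rewrite ler_sqr ?nnegrE ?cabs_ge0 ?mulr_ge0 ?exprn_ge0.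
  rewrite -mulr_sumr [X in _ <= X]mulrAC; apply: ler_wpM2l; last exact: sum_geometric_lt1.
  by apply: mulr_ge0; [exact: sqr_ge0|exact: exprn_ge0].
have hN N : \sum_(0 <= n < N) fnorm (X (ebasis R n)) ^+ 2 <= (M / (1 - q)) ^+ 2.
  apply: (@le_trans _ _ (\sum_(0 <= n < N) M ^+ 2 * (1 - q)^-1 * q ^+ n)).
    by apply: ler_sum.
  have -> : (M / (1 - q)) ^+ 2 = M ^+ 2 * (1 - q)^-1 * (1 - q)^-1.
    by rewrite exprMn [X in _ * X = _]expr2 mulrA.
  rewrite -mulr_sumr; apply: ler_wpM2l; last exact: sum_geometric_lt1.
  by apply: mulr_ge0; [exact: sqr_ge0|rewrite invr_ge0 ltW].
have hs := hilbert_schmidt_bounded hX hN; split => //.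
rewrite -(@ler_pXn2r _ 2) ?nnegrE ?hsnorm_ge0 ?divr_ge0 ?(ltW q1) //.
exact: hsnorm_sq_le.
Qed.

Lemma decay_matrix (b : nat -> nat -> C) (th M : R) : 0 <= th -> th < 1 -> 0 <= M ->
  (forall m n, cabs (b m n) <= M * th ^+ (m + n)) ->
  exists2 X : op, bounded_op X & forall n m, X (ebasis R n) m = b m n.
Proof.
move=> th0 th1 M0 hM.
have th21 : th ^+ 2 < 1 by rewrite exprn_ilt1.
set q := th ^+ 2 in th21 *; have q0 : 0 <= q by exact: sqr_ge0.
have q1 : 0 < 1 - q by rewrite subr_gt0.
(* Cauchy-Schwarz for finite sums, by induction; the mixed term of the square is bounded by the
   inequality between arithmetic and geometric means. *)
have CS N (f g : nat -> R) : (\sum_(0 <= n < N) f n * g n) ^+ 2 <=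
    (\sum_(0 <= n < N) f n ^+ 2) * \sum_(0 <= n < N) g n ^+ 2.
  elim: N => [|N IH]; first by rewrite !big_nil mul0r expr0n.
  rewrite !big_nat_recr //=.
  set a := \sum_(0 <= n < N) _ in IH *; set b2 := \sum_(0 <= n < N) f n ^+ 2 in IH *.
  set c2 := \sum_(0 <= n < N) g n ^+ 2 in IH *.
  have b20 : 0 <= b2 by apply: sumr_ge0 => i _; exact: sqr_ge0.
  have c20 : 0 <= c2 by apply: sumr_ge0 => i _; exact: sqr_ge0.
  have h : 2 * a * (f N * g N) <= b2 * g N ^+ 2 + c2 * f N ^+ 2.
    apply: le_trans (ler_norm _) _.
    have r0 : 0 <= b2 * g N ^+ 2 + c2 * f N ^+ 2.
      by apply: addr_ge0; apply: mulr_ge0 => //; exact: sqr_ge0.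
    rewrite -(@ler_pXn2r _ 2) ?nnegrE //.
    rewrite real_normK ?num_real //.
    have h1 : a ^+ 2 * (f N * g N) ^+ 2 <= b2 * c2 * (f N * g N) ^+ 2 by rewrite ler_wpM2r ?sqr_ge0.
    have h2 := sqr_ge0 (b2 * g N ^+ 2 - c2 * f N ^+ 2).
    by rewrite !(exprMn, sqrrD, sqrrB) in h1 h2 *; lra.
  rewrite sqrrD exprMn mulrDl !mulrDr; nra.
(* The constant is the square of the Hilbert-Schmidt norm of the majorant M th^(m + n). *)
apply: (@matrix_op _ b (M ^+ 2 * (1 - q)^-1 * (1 - q)^-1)).
  by apply: mulr_ge0; [apply: mulr_ge0|]; rewrite ?sqr_ge0 ?invr_ge0 ?(ltW q1).
move=> K N x; set S := \sum_(0 <= n < N) sqmod (x n).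
have S0 : 0 <= S by apply: sumr_ge0 => i _; exact: sqmod_ge0.
have hm m : sqmod (\sum_(0 <= n < N) b m n * x n) <= M ^+ 2 * (1 - q)^-1 * S * q ^+ m.
  rewrite -cabs_sq.
  apply: (@le_trans _ _ ((\sum_(0 <= n < N) (M * th ^+ (m + n)) * cabs (x n)) ^+ 2)).
    rewrite ler_sqr ?nnegrE ?cabs_ge0 //; last first.
      by apply: sumr_ge0 => i _; rewrite !mulr_ge0 ?exprn_ge0 ?cabs_ge0.
    apply: le_trans (cabs_sum _ _ _) _; apply: ler_sum => i _.
    by rewrite cabsM ler_wpM2r ?cabs_ge0.
  apply: le_trans (CS _ _ _) _.
  under [X in _ * X]eq_bigr do rewrite cabs_sq.
  rewrite -/S mulrAC ler_wpM2r //.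
  under eq_bigr do rewrite exprMn exprD exprMn -!exprM ![(_ * 2)%N]mulnC !exprM -/q mulrA.
  rewrite -mulr_sumr [X in _ <= X]mulrAC; apply: ler_wpM2l; last exact: sum_geometric_lt1.
  by apply: mulr_ge0; [exact: sqr_ge0|exact: exprn_ge0].
apply: (@le_trans _ _ (\sum_(0 <= m < K) M ^+ 2 * (1 - q)^-1 * S * q ^+ m)).
  by apply: ler_sum.
rewrite -mulr_sumr [X in _ <= X]mulrAC; apply: ler_wpM2l; last exact: sum_geometric_lt1.
by apply: mulr_ge0 => //; apply: mulr_ge0; rewrite ?sqr_ge0 ?invr_ge0 ?(ltW q1).
Qed.

End HilbertSchmidt.

(** Packaging linearity makes composition the product of an algebra, so that the commutator calculus
    applies to polynomials in a and a^+. The coercion gives back the functions used by [embed] and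
    [monomial]. *)
Record seq_end (R : realType) :=
  SeqEnd { seq_end_fun :> (nat -> R[i]) -> (nat -> R[i]); _ : linear seq_end_fun }.
Arguments SeqEnd {R} _ _.

(** * Weyl operators *)

Section SequenceEndomorphisms.
Variable R : realType.
Local Notation C := R[i].
Local Notation V := (nat -> C).
Local Notation E := (seq_end R).
Implicit Types (p q : E).

Lemma seq_end_linear p : linear p. Proof. by case: p. Qed.

Lemma seq_end_ext p q : (forall x, p x = q x) -> p = q.
Proof.
case: p q => [p hp] [q hq] /= h; have pq : p = q by apply/funext.
by subst q; congr SeqEnd; exact: Prop_irrelevance.
Qed.

Lemma seq_end_fun0 p : p 0 = 0.
Proof.
have := seq_end_linear p 1 0 0; rewrite !scale1r addr0 => /eqP.
by rewrite -subr_eq subrr eq_sym => /eqP.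
Qed.

Lemma seq_end_funZ p c x : p (c *: x) = c *: p x.
Proof. by rewrite -[c *: x]addr0 seq_end_linear seq_end_fun0 addr0. Qed.

HB.instance Definition _ := gen_eqMixin E.
HB.instance Definition _ := gen_choiceMixin E.

Lemma seq_end_zero_linear : linear ((fun=> 0) : V -> V).
Proof. by move=> c x y; rewrite scaler0 addr0. Qed.

Lemma seq_end_add_linear p q : linear (fun x => p x + q x).
Proof. by move=> c x y; rewrite !seq_end_linear scalerDr addrACA. Qed.

Lemma seq_end_opp_linear p : linear (fun x => - p x).
Proof. by move=> c x y; rewrite seq_end_linear opprD scalerN. Qed.

Lemma seq_end_scale_linear k p : linear (fun x => k *: p x).
Proof. by move=> c x y; rewrite seq_end_linear scalerDr !scalerA mulrC. Qed.

Lemma seq_end_one_linear : linear (id : V -> V). Proof. by []. Qed.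

Lemma seq_end_mul_linear p q : linear (fun x => p (q x)).
Proof. by move=> c x y; rewrite !seq_end_linear. Qed.

Definition seq_end_zero := SeqEnd _ seq_end_zero_linear.
Definition seq_end_add p q := SeqEnd _ (seq_end_add_linear p q).
Definition seq_end_opp p := SeqEnd _ (seq_end_opp_linear p).
Definition seq_end_scale k p := SeqEnd _ (seq_end_scale_linear k p).
Definition seq_end_one := SeqEnd _ seq_end_one_linear.
Definition seq_end_mul p q := SeqEnd _ (seq_end_mul_linear p q).

Let addA : associative seq_end_add.
Proof. by move=> p q r; apply: seq_end_ext => x /=; rewrite addrA. Qed.
Let addC : commutative seq_end_add.
Proof. by move=> p q; apply: seq_end_ext => x /=; rewrite addrC. Qed.
Let add0 : left_id seq_end_zero seq_end_add.
Proof. by move=> p; apply: seq_end_ext => x /=; rewrite add0r. Qed.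
Let addN : left_inverse seq_end_zero seq_end_opp seq_end_add.
Proof. by move=> p; apply: seq_end_ext => x /=; rewrite addNr. Qed.
HB.instance Definition _ := GRing.isZmodule.Build E addA addC add0 addN.

Let mulA : associative seq_end_mul.
Proof. by move=> p q r; apply: seq_end_ext. Qed.
Let mul1 : left_id seq_end_one seq_end_mul.
Proof. by move=> p; apply: seq_end_ext. Qed.
Let mulr1' : right_id seq_end_one seq_end_mul.
Proof. by move=> p; apply: seq_end_ext. Qed.
Let mulDl' : left_distributive seq_end_mul seq_end_add.
Proof. by move=> p q r; apply: seq_end_ext. Qed.
Let mulDr' : right_distributive seq_end_mul seq_end_add.
Proof.
move=> p q r; apply: seq_end_ext => x /=.
by rewrite -[q x]scale1r seq_end_linear !scale1r.
Qed.
Let one_neq0 : seq_end_one != seq_end_zero.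
Proof.
apply/eqP => /(congr1 (fun p : E => p (fun=> 1) 0%N)) /= /eqP; rewrite oner_eq0 //.
Qed.
HB.instance Definition _ :=
  GRing.Zmodule_isNzRing.Build E mulA mul1 mulr1' mulDl' mulDr' one_neq0.

Let scaleA a b p : seq_end_scale a (seq_end_scale b p) = seq_end_scale (a * b) p.
Proof. by apply: seq_end_ext => x /=; rewrite scalerA. Qed.
Let scale1 : left_id 1 seq_end_scale.
Proof. by move=> p; apply: seq_end_ext => x /=; rewrite scale1r. Qed.
Let scaleDr : right_distributive seq_end_scale +%R.
Proof. by move=> k p q; apply: seq_end_ext => x /=; rewrite scalerDr. Qed.
Let scaleDl p : {morph seq_end_scale^~ p : a b / a + b}.
Proof. by move=> a b; apply: seq_end_ext => x /=; rewrite scalerDl. Qed.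
HB.instance Definition _ :=
  GRing.Zmodule_isLmodule.Build C E scaleA scale1 scaleDr scaleDl.

Let scaleAl (a : C) p q : a *: (p * q) = (a *: p) * q.
Proof. by apply: seq_end_ext. Qed.
HB.instance Definition _ := GRing.Lmodule_isLalgebra.Build C E scaleAl.

Let scaleAr (a : C) p q : a *: (p * q) = p * (a *: q).
Proof.
by apply: seq_end_ext => x /=; rewrite seq_end_funZ.
Qed.
HB.instance Definition _ := GRing.Lalgebra_isAlgebra.Build C E scaleAr.

Lemma seq_endDE p q x : (p + q) x = p x + q x. Proof. by []. Qed.
Lemma seq_endNE p x : (- p) x = - p x. Proof. by []. Qed.
Lemma seq_endME p q x : (p * q) x = p (q x). Proof. by []. Qed.
Lemma seq_end1E x : (1 : E) x = x. Proof. by []. Qed.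
Lemma seq_endXE p n x : (p ^+ n) x = iter n p x.
Proof. by elim: n => [//|n IH]; rewrite exprS seq_endME IH. Qed.

Lemma seq_end_funD p x y : p (x + y) = p x + p y.
Proof. by rewrite -[x]scale1r seq_end_linear !scale1r. Qed.

Lemma seq_end_fun_sum p (I : Type) (r : seq I) (F : I -> V) :
  p (\sum_(i <- r) F i) = \sum_(i <- r) p (F i).
Proof. by elim/big_rec2: _ => [|i a b _ <-]; rewrite ?seq_end_fun0 ?seq_end_funD. Qed.

Lemma ann_linear : linear (@ann R).
Proof. by move=> c x y; apply/funext => n; rewrite /ann !fctE mulrDr mulrCA. Qed.

Lemma cre_linear : linear (@cre R).
Proof. by move=> c x y; apply/funext => n; rewrite /cre !fctE mulrDr mulrCA. Qed.

Definition Ann : E := SeqEnd _ ann_linear.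
Definition Cre : E := SeqEnd _ cre_linear.

Lemma ad_Ann_Cre : ad Ann Cre = 1.
Proof.
have sq n : (Num.sqrt n%:R)%:C * (Num.sqrt n%:R)%:C = n%:R :> C.
  by rewrite -rmorphM -expr2 sqr_sqrtr // rmorph_nat.
rewrite adE; apply: seq_end_ext => x; rewrite seq_endDE seq_endNE !seq_endME.
apply/funext => n; rewrite /= !fctE /ann /cre /=.
case: n => [|n] /=; rewrite mulrA sq; last rewrite mulrA sq -mulrBl.
  by rewrite sqrtr0 mul0r subr0 mul1r.
by rewrite -natrB // subSnn mul1r.
Qed.

Lemma ad_Cre_Ann : ad Cre Ann = (-1)%:A.
Proof. by rewrite adC ad_Ann_Cre scaleN1r. Qed.

Definition field_op (z : C) : E := z *: Cre - z^* *: Ann.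

End SequenceEndomorphisms.

(** * Entries of powers of field operators *)

Section MatrixEntries.
Variable R : realType.
Local Notation C := R[i].
Local Notation V := (nat -> C).
Local Notation E := (seq_end R).
Implicit Types (p q : E) (z : C).

Definition entry p m n : C := p (delta R n) m.

Lemma entryD p q m n : entry (p + q) m n = entry p m n + entry q m n. Proof. by []. Qed.
Lemma entryZ c p m n : entry (c *: p) m n = c * entry p m n. Proof. by []. Qed.
Lemma entry0 m n : entry 0 m n = 0. Proof. by []. Qed.

Lemma field_op_exprS z k x m : (field_op z ^+ k.+1) x m =
  z * ((Num.sqrt m%:R)%:C * (field_op z ^+ k) x m.-1)
  - z^* * ((Num.sqrt m.+1%:R)%:C * (field_op z ^+ k) x m.+1).
Proof. by rewrite exprS. Qed.

Lemma field_op_exp_high z k x N m : (forall i, (N <= i)%N -> x i = 0) ->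
  (N + k <= m)%N -> (field_op z ^+ k) x m = 0.
Proof.
move=> hx; elim: k m => [|k IH] m Nm; first by rewrite expr0 seq_end1E hx //; lia.
rewrite field_op_exprS [X in _ - _ * (_ * X)]IH ?mulr0 ?subr0; last by lia.
by rewrite IH ?mulr0 //; lia.
Qed.

Lemma entry_high z k m n : (n + k < m)%N -> entry (field_op z ^+ k) m n = 0.
Proof.
move=> h; apply: (@field_op_exp_high _ _ _ n.+1); last by lia.
by move=> i ni; rewrite /delta gtn_eqF.
Qed.

Lemma entry_low z k m n : (m + k < n)%N -> entry (field_op z ^+ k) m n = 0.
Proof.
rewrite /entry; elim: k m => [|k IH] m mk.
  by rewrite expr0 seq_end1E /delta ltn_eqF // -[m]addn0.
rewrite field_op_exprS [X in _ - _ * (_ * X)]IH ?mulr0 ?subr0; last by lia.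
by rewrite IH ?mulr0 //; lia.
Qed.

Lemma sqrt_nat_le (m n : nat) : (m <= n)%N -> Num.sqrt m%:R <= Num.sqrt n%:R :> R.
Proof. by move=> mn; rewrite ler_wsqrtr // ler_nat. Qed.

(** The square root is the norm of (a^+)^k e_n. The power is a sum of 2^k words, and none of them
    enlarges e_n more than this, since no index above n + k is reached. *)
Lemma entry_le z k m n : cabs (entry (field_op z ^+ k) m n) <=
  (2 * cabs z) ^+ k * Num.sqrt (k`!%:R * 'C(n + k, k)%:R).
Proof.
elim: k m => [|k IH] m.
  rewrite /entry expr0 seq_end1E /delta cabs_nat expr0 mul1r fact0 addn0 bin0 mulr1 sqrtr1.
  by case: eqP.
set B := (2 * cabs z) ^+ k * Num.sqrt (k`!%:R * 'C(n + k, k)%:R) in IH.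
have B0 : 0 <= B by apply: le_trans (IH 0%N); exact: cabs_ge0.
have -> : (2 * cabs z) ^+ k.+1 * Num.sqrt (k.+1`!%:R * 'C(n + k.+1, k.+1)%:R)
    = 2 * cabs z * Num.sqrt (n + k).+1%:R * B.
  rewrite /B exprS -!mulrA; congr (_ * (_ * _)); rewrite mulrCA; congr (_ * _).
  rewrite -sqrtrM // -!natrM; congr (Num.sqrt _%:R).
  by rewrite factS addnS (mulnC k.+1) -mulnA -mul_bin_diag mulnCA.
have step j j' : (j' <= j.+1)%N -> cabs ((Num.sqrt j'%:R)%:C * entry (field_op z ^+ k) j n) <=
    Num.sqrt (n + k).+1%:R * B.
  move=> jj'; rewrite cabsM cabs_real ger0_norm ?sqrtr_ge0 //.
  have [h|h] := ltnP (n + k) j; first by rewrite entry_high // cabs0 mulr0 mulr_ge0 ?sqrtr_ge0.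
  by rewrite ler_pM ?sqrtr_ge0 ?cabs_ge0 // sqrt_nat_le // (leq_trans jj').
rewrite /entry field_op_exprS; apply: le_trans (cabsB _ _) _.
rewrite !(cabsM z) !(cabsM z^*) cabs_conj -mulrDr -!mulrA mulrCA mulr_natl.
rewrite ler_wpM2l ?cabs_ge0 // mulr2n lerD //; first by apply: step; case: m.
by apply: step.
Qed.

(** A single term of the binomial expansion of (x + (1 - x))^(n + k) = 1. *)
Lemma bin_geometric_le (x : R) n k : 0 <= x -> x <= 1 ->
  'C(n + k, k)%:R * x ^+ n * (1 - x) ^+ k <= 1.
Proof.
move=> x0 x1; have e1 : (x + (1 - x)) ^+ (n + k) = 1 :> R by rewrite addrC subrK expr1n.
apply: (@le_trans _ _ ((x + (1 - x)) ^+ (n + k))); last by rewrite e1.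
rewrite [X in _ <= X]exprDn.
have kn : (k < (n + k).+1)%N by rewrite ltnS leq_addl.
rewrite (bigD1 (Ordinal kn)) //= addnK.
have -> : 'C(n + k, k)%:R * x ^+ n * (1 - x) ^+ k = x ^+ n * (1 - x) ^+ k *+ 'C(n + k, k).
  by rewrite -[RHS]mulr_natl mulrA.
rewrite lerDl.
apply: sumr_ge0 => i _; rewrite mulrn_wge0 // mulr_ge0 ?exprn_ge0 //.
by rewrite subr_ge0.
Qed.

Lemma bin_le_exp2 n k : 'C(n + k, k)%:R <= 2 ^+ n * 2 ^+ k :> R.
Proof.
have half1 : 2^-1 <= 1 :> R by rewrite invf_le1 // ler1n.
have := @bin_geometric_le 2^-1 n k _ half1; rewrite invr_ge0 => /(_ (ler0n _ 2)).
have -> : 1 - 2^-1 = 2^-1 :> R by lra.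
by rewrite -mulrA !exprVn -invfM ler_pdivrMr ?mul1r ?mulr_gt0 ?exprn_gt0.
Qed.

(** A term (4 D^2)^k / k! of an exponential series is at most exp(4 D^2); the claim is the square
    root of this. *)
Lemma geometric_fact (D : R) : 0 <= D ->
  exists2 H : R, 0 <= H & forall k, D ^+ k * Num.sqrt k`!%:R / k`!%:R <= H / 2 ^+ k.
Proof.
move=> D0; exists (Num.sqrt (expR (4 * D ^+ 2))) => [|k]; first exact: sqrtr_ge0.
have f0 : 0 < k`!%:R :> R by rewrite ltr0n fact_gt0.
have t0 : 0 <= 4 * D ^+ 2 :> R by rewrite mulr_ge0 ?exprn_ge0.
have h : (4 * D ^+ 2) ^+ k / k`!%:R <= expR (4 * D ^+ 2).
  have := @series_le_lim R (exp_coeff (4 * D ^+ 2)) k.+1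
    (fun n => exp_coeff_ge0 n t0) (is_cvg_series_exp_coeff _).
  apply: le_trans; rewrite big_nat_recr //= lerDr.
  by apply: sumr_ge0 => i _; exact: exp_coeff_ge0.
rewrite ler_pdivlMr ?exprn_gt0 // -[X in X <= _]ger0_norm; last first.
  by rewrite mulr_ge0 ?exprn_ge0 // divr_ge0 ?mulr_ge0 ?exprn_ge0 ?sqrtr_ge0 // ltW.
rewrite -sqrtr_sqr ler_wsqrtr //; apply: le_trans h.
rewrite le_eqVlt; apply/orP; left; apply/eqP.
rewrite ![in LHS]exprMn (sqr_sqrtr (ltW f0)) exprVn [in RHS]exprMn.
have sw (x : R) : (x ^+ k) ^+ 2 = (x ^+ 2) ^+ k by rewrite -!exprM mulnC.
have -> : 4 = 2 ^+ 2 :> R by rewrite -natrX.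
rewrite !sw; move: ((D ^+ 2) ^+ k) ((2 ^+ 2) ^+ k) => x y.
by field; rewrite lt0r_neq0.
Qed.

(** [B] may be as large as desired at the price of a constant; its powers are later spent on decay
    in other indices. *)
Lemma entry_fact_le z (B : R) : 0 < B -> exists2 H : R, 0 <= H &
  forall k m n, cabs (entry (field_op z ^+ k) m n) / k`!%:R <= H * 2 ^+ n / B ^+ k.
Proof.
move=> B0; have [|H H0 hH] := @geometric_fact (2 * cabs z * 2 * B).
  by rewrite !mulr_ge0 ?cabs_ge0 // ltW.
exists H => // k m n.
have f0 : 0 < k`!%:R :> R by rewrite ltr0n fact_gt0.
have hb : Num.sqrt 'C(n + k, k)%:R <= 2 ^+ n * 2 ^+ k :> R.
  have h2 : 0 <= 2 ^+ n * 2 ^+ k :> R by rewrite mulr_ge0 ?exprn_ge0.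
  rewrite -[X in _ <= X]ger0_norm // -sqrtr_sqr ler_wsqrtr //.
  apply: le_trans (bin_le_exp2 _ _) _.
  by rewrite expr2 ler_peMl // -exprD -natrX ler1n expn_gt0.
rewrite ler_pdivlMr ?exprn_gt0 // mulrAC ler_pdivrMr //.
apply: le_trans (_ : (2 * cabs z) ^+ k * (Num.sqrt k`!%:R * (2 ^+ n * 2 ^+ k)) * B ^+ k <= _).
  rewrite ler_wpM2r ?exprn_ge0 ?(ltW B0) //; apply: le_trans (entry_le _ _ _ _) _.
  rewrite ler_wpM2l ?exprn_ge0 ?mulr_ge0 ?cabs_ge0 // sqrtrM ?ler0n //.
  by rewrite ler_wpM2l ?sqrtr_ge0.
have := hH k; rewrite ler_pdivrMr // => h.
have {h} : (2 * cabs z * 2 * B) ^+ k * Num.sqrt k`!%:R <= H * k`!%:R.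
  apply: le_trans h _; rewrite ler_wpM2r ?(ltW f0) // ler_pdivrMr ?exprn_gt0 //.
  by rewrite ler_peMr // -natrX ler1n expn_gt0.
move/(ler_wpM2l (exprn_ge0 n (ler0n R 2))).
move: (2 * cabs z) => y.
have -> : (y * 2 * B) ^+ k = y ^+ k * 2 ^+ k * B ^+ k by rewrite (exprMn k (y * 2)) (exprMn k y).
move: (Num.sqrt (k`!%:R : R)) (k`!%:R : R) (y ^+ k) (B ^+ k) (2 ^+ n : R) (2 ^+ k : R) => a1 a2 a3 a4 a5 a6 h; lra.
Qed.

End MatrixEntries.

#[local] Arguments seq_end_fun : simpl never.

(** * The exponential series of a field operator *)

Section WeylOperator.
Variable R : realType.
Local Notation C := R[i].
Local Notation V := (nat -> C).
Implicit Types (z : C) (x y : V).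

Definition weyl_term z m n k : C := (k`!%:R)^-1 * entry (field_op z ^+ k) m n.

Definition weyl_entry z m n : C := csum (weyl_term z m n).

Lemma cabs_invfact (k : nat) : cabs ((k`!%:R)^-1 : C) = (k`!%:R)^-1.
Proof. by rewrite cabsV cabs_nat. Qed.

(** The entry vanishes unless m <= n + k. Of the factor 4^-k, one factor 2^-k is kept for the
    summation over k and the other is traded for 2^n / 2^m. *)
Lemma weyl_term_le z : exists2 H : R, 0 <= H &
  forall m n k, cabs (weyl_term z m n k) <= (H * 4 ^+ n / 2 ^+ m) / 2 ^+ k.
Proof.
have [H H0 hH] := @entry_fact_le R z 4 (ltr0n _ 4).
exists H => // m n k; rewrite cabsM cabs_invfact mulrC.
have R0 : 0 <= H * 4 ^+ n / 2 ^+ m / 2 ^+ k.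
  by rewrite !divr_ge0 ?mulr_ge0 ?exprn_ge0.
have [h|h] := ltnP (n + k) m; first by rewrite entry_high // cabs0 mul0r.
apply: le_trans (hH _ _ _) _; rewrite -!mulrA ler_wpM2l //.
rewrite ler_pdivrMr ?exprn_gt0 // -invfM -exprD mulrAC ler_pdivlMr ?exprn_gt0 //.
have -> : 4 = 2 ^+ 2 :> R by rewrite -natrX.
rewrite -!exprM -!exprD -!natrX ler_nat leq_exp2l //; lia.
Qed.

(** The decay in m makes the tails of a column small in norm and not only entry by entry. *)
Lemma weyl_entry_tail z : exists2 H : R, 0 <= H & forall m n K,
  cabs (series (weyl_term z m n) k - weyl_entry z m n) @[k --> \oo] --> (0 : R) /\
  cabs (weyl_entry z m n - series (weyl_term z m n) K) <= (H * 4 ^+ n / 2 ^+ m) / 2 ^+ K.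
Proof.
have [H H0 hH] := weyl_term_le z; exists (2 * H); first by rewrite mulr_ge0.
move=> m n K.
have H0' : 0 <= H * 4 ^+ n / 2 ^+ m by rewrite divr_ge0 ?mulr_ge0 ?exprn_ge0.
have [h1 h2] := @csum_tail _ (weyl_term z m n) _ K H0' (fun k _ => hH m n k).
by split => //; rewrite !mulrA in h2.
Qed.

Definition hdot (L : nat) x y : C := \sum_(0 <= m < L) (x m)^* * y m.

(** Summation by parts below [L] leaves boundary terms only, each containing a component at [L]. *)
Lemma field_op_skew z L x y : x L = 0 -> y L = 0 ->
  hdot L (field_op z x) y = - hdot L x (field_op z y).
Proof.
pose r n : C := (Num.sqrt n%:R)%:C.
have rc n : (r n)^* = r n by exact: conj_real.
have r0 : r 0%N = 0 by rewrite /r sqrtr0.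
move=> xL yL; apply/eqP; rewrite -addr_eq0; apply/eqP.
suff -> : hdot L (field_op z x) y + hdot L x (field_op z y) =
    - (z^* * r L * (x L.-1)^* * y L + z * r L * (x L)^* * y L.-1).
  by rewrite xL yL rmorph0 !mulr0 mul0r addr0 oppr0.
elim: L {xL yL} => [|L IH]; first by rewrite /hdot !big_nil r0 !(mulr0, mul0r) addr0 oppr0.
rewrite /hdot !big_nat_recr //= -/(hdot L _ _) -/(hdot L _ _).
have e v : (field_op z v) L = z * (r L * v L.-1) - z^* * (r L.+1 * v L.+1) by [].
have ec v : (field_op z v L)^* = z^* * (r L * (v L.-1)^*) - z * (r L.+1 * (v L.+1)^*).
  by rewrite e rmorphB !rmorphM /= !rc conjCK.
rewrite addrACA IH ec e.
by move: (x L.-1)^* (x L)^* (x L.+1)^* z^* => *; ring.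
Qed.

Lemma field_op_exp_skew z L N x y j k :
  (forall i, (N <= i)%N -> x i = 0) -> (forall i, (N <= i)%N -> y i = 0) ->
  (N + j + k <= L)%N ->
  hdot L ((field_op z ^+ j) x) ((field_op z ^+ k) y) =
  (-1) ^+ j * hdot L x ((field_op z ^+ (j + k)) y).
Proof.
move=> hx hy; elim: j k => [|j IH] k hL; first by rewrite !expr0 mul1r.
rewrite exprS seq_endME field_op_skew; last 2 first.
- by rewrite (field_op_exp_high _ hx) //; lia.
- by rewrite (field_op_exp_high _ hy) //; lia.
rewrite -seq_endME -exprS IH; last by lia.
by rewrite exprS mulN1r mulNr addnS addSn.
Qed.

Lemma triangular_sum (F : nat -> nat -> C) M :
  \sum_(0 <= j < M) \sum_(0 <= k < M - j) F j k =
  \sum_(0 <= N < M) \sum_(0 <= j < N.+1) F j (N - j)%N.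
Proof.
elim: M => [|M IH]; first by rewrite !big_nil.
rewrite [RHS]big_nat_recr //= -IH big_nat_recr //= subSn // subnn big_nat1.
rewrite [X in _ = _ + X]big_nat_recr //= subnn addrA; congr (_ + _).
rewrite -big_split /= big_nat [RHS]big_nat; apply: eq_bigr => j /andP[_ jM].
by rewrite subSn 1?ltnW // big_nat_recr.
Qed.

(** This is exp(-A) exp(A) = 1 as a Cauchy product: degree N carries the factor (1 - 1)^N. *)
Lemma exp_series_telescope (h : nat -> C) M :
  \sum_(0 <= N < M.+1) \sum_(0 <= j < N.+1)
    (j`!%:R)^-1 * ((N - j)`!%:R)^-1 * (-1) ^+ j * h (j + (N - j))%N = h 0%N.
Proof.
rewrite big_nat_recl // big_nat1 /= fact0 invr1 ?(expr0, mul1r).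
rewrite [X in _ + X]big1 ?addr0 // => N _.
have -> : \sum_(0 <= j < N.+2) (j`!%:R)^-1 * ((N.+1 - j)`!%:R)^-1 * (-1) ^+ j * h (j + (N.+1 - j))%N
   = (N.+1`!%:R)^-1 * h N.+1 * \sum_(0 <= j < N.+2) (1 ^+ (N.+1 - j) * (-1) ^+ j *+ 'C(N.+1, j)).
  rewrite mulr_sumr big_nat [RHS]big_nat; apply: eq_bigr => j /andP[_ jN].
  rewrite subnKC // expr1n mul1r -mulr_natr.
  have f0 (i : nat) : i`!%:R != 0 :> C by rewrite pnatr_eq0 -lt0n fact_gt0.
  have := bin_fact (_ : (j <= N.+1)%N) => /(_ jN) /(congr1 (fun i => i%:R : C)).
  rewrite !natrM => <-; field; rewrite !f0 /=.
  by rewrite pnatr_eq0 -lt0n bin_gt0.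
rewrite (big_mkord xpredT (fun j => 1 ^+ (N.+1 - j) * (-1) ^+ j *+ 'C(N.+1, j))) -exprDn.
by rewrite subrr expr0n mulr0.
Qed.

Lemma sqmod_conj (w : C) : (sqmod w)%:C = w^* * w.
Proof. by rewrite -cabs_sq rmorphXn /= -cabsE normCK mulrC. Qed.

Definition exp_trunc z M x : V := \sum_(0 <= k < M) (k`!%:R)^-1 *: (field_op z ^+ k) x.

Lemma seq_sumE (I : Type) (r : seq I) (F : I -> V) m : (\sum_(i <- r) F i) m = \sum_(i <- r) F i m.
Proof. by elim/big_rec2: _ => [//|i a b _ <-]. Qed.

Lemma seq_scaleE (c : C) x m : (c *: x) m = c * x m. Proof. by []. Qed.

Definition finite_seq N (x : V) : V := \sum_(0 <= n < N) x n *: delta R n.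

Lemma finite_seqE N x m : finite_seq N x m = if (m < N)%N then x m else 0.
Proof.
rewrite /finite_seq seq_sumE; elim: N => [|N IH]; first by rewrite big_nil.
rewrite big_nat_recr // IH /= seq_scaleE /delta [in RHS]ltnS [in RHS]leq_eqVlt.
by case: eqVneq => [->|mN] /=; rewrite ?ltnn ?(add0r, mulr1, mulr0, addr0).
Qed.

Lemma exp_truncE z M N x m : exp_trunc z M (finite_seq N x) m =
  \sum_(0 <= n < N) series (weyl_term z m n) M * x n.
Proof.
rewrite /exp_trunc seq_sumE.
transitivity (\sum_(0 <= k < M) \sum_(0 <= n < N) weyl_term z m n k * x n).
  apply: eq_bigr => k _; rewrite seq_scaleE /finite_seq seq_end_fun_sum seq_sumE mulr_sumr.
  by apply: eq_bigr => n _; rewrite seq_end_funZ seq_scaleE /weyl_term /entry mulrCA mulrC.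
rewrite exchange_big /=; apply: eq_bigr => n _.
by rewrite /series /= mulr_suml.
Qed.

(** Unitarity of exp(A) for skew A, up to truncation: the squared norm is a double sum over j, k <=
    M of multiples of the inner products of x with A^(j + k) x. The part j + k <= M collapses to the
    squared norm of x, and the rest is geometrically small. *)
Lemma exp_trunc_norm z N x : exists2 G : R, 0 <= G & forall M K,
  \sum_(0 <= m < K) sqmod (exp_trunc z M.+1 (finite_seq N x) m) <=
  \sum_(0 <= n < N) sqmod (x n) + G / 2 ^+ M.
Proof.
set f := finite_seq N x.
have hf i : (N <= i)%N -> f i = 0 by move=> Ni; rewrite /f finite_seqE ltnNge Ni.
(* Of the three factors of 8 = 2^3, one absorbs a binomial coefficient, one makes the double sum
   converge and one yields 2^-M. *)
have [H H0 hH] := @entry_fact_le R z 8 (ltr0n _ 8).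
pose G := \sum_(0 <= m < N) cabs (f m) * (\sum_(0 <= n < N) cabs (x n) * (H * 2 ^+ n)).
have G0 : 0 <= G.
  apply: sumr_ge0 => m _; rewrite mulr_ge0 ?cabs_ge0 //; apply: sumr_ge0 => n _.
  by rewrite !mulr_ge0 ?cabs_ge0 ?exprn_ge0.
exists (4 * G); first by rewrite mulr_ge0.
(* [L] lies above every index reached by fewer than M1 applications on each side, so no boundary
   term appears. *)
move=> M K; set M1 := M.+1; pose L := (N + M1 + M1 + K)%N.
apply: (@le_trans _ _ (\sum_(0 <= m < L) sqmod (exp_trunc z M1 f m))).
  rewrite [X in _ <= X](@big_cat_nat _ _ _ K) //=; last by rewrite /L leq_addl.
  by rewrite lerDl; apply: sumr_ge0 => i _; exact: sqmod_ge0.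
pose h k := hdot L f ((field_op z ^+ k) f).
have hle k : (k <= M1 + M1)%N -> cabs (h k) / k`!%:R <= G / 8 ^+ k.
  move=> kM; rewrite /h /hdot (@big_cat_nat _ _ _ N) //=; last by rewrite /L -!addnA leq_addr.
  rewrite [X in _ + X]big1_seq ?addr0; last first.
    by move=> i; rewrite mem_index_iota => /andP[_ /andP[Ni _]]; rewrite hf // rmorph0 mul0r.
  rewrite ler_pdivrMr ?ltr0n ?fact_gt0 //; apply: le_trans (cabs_sum _ _ _) _.
  rewrite /G !mulr_suml; apply: ler_sum => m _; rewrite cabsM cabs_conj -!mulrA.
  rewrite ler_wpM2l ?cabs_ge0 // {1}/f /finite_seq seq_end_fun_sum seq_sumE.
  apply: le_trans (cabs_sum _ _ _) _; rewrite mulr_suml; apply: ler_sum => n _.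
  rewrite seq_end_funZ seq_scaleE cabsM -!mulrA ler_wpM2l ?cabs_ge0 //.
  by have := hH k m n; rewrite ler_pdivrMr ?ltr0n ?fact_gt0 // -!mulrA.
have E : (\sum_(0 <= m < L) sqmod (exp_trunc z M1 f m))%:C =
   \sum_(0 <= j < M1) \sum_(0 <= k < M1)
     (j`!%:R)^-1 * (k`!%:R)^-1 * (-1) ^+ j * h (j + k)%N.
  rewrite rmorph_sum /=; under eq_bigr do rewrite sqmod_conj.
  transitivity (\sum_(0 <= j < M1) \sum_(0 <= k < M1)
     (j`!%:R)^-1 * (k`!%:R)^-1 * hdot L ((field_op z ^+ j) f) ((field_op z ^+ k) f)).
    transitivity (\sum_(0 <= m < L) \sum_(0 <= j < M1) \sum_(0 <= k < M1)
       (j`!%:R)^-1 * (k`!%:R)^-1 * (((field_op z ^+ j) f m)^* * (field_op z ^+ k) f m)).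
      apply: eq_bigr => m _; rewrite /exp_trunc seq_sumE rmorph_sum mulr_suml.
      apply: eq_bigr => j _; rewrite mulr_sumr; apply: eq_bigr => k _.
      by rewrite !seq_scaleE rmorphM fmorphV /= conj_nat; ring.
    rewrite exchange_big /=; apply: eq_bigr => j _.
    rewrite exchange_big /=; apply: eq_bigr => k _.
    by rewrite /hdot mulr_sumr.
  apply: eq_big_nat => j /andP[_ jM].
  apply: eq_big_nat => k /andP[_ kM].
  by rewrite (field_op_exp_skew _ hf hf) ?mulrA //; rewrite /L; lia.
have E0 : h 0%N = (\sum_(0 <= n < N) sqmod (x n))%:C.
  rewrite /h expr0 /hdot (@big_cat_nat _ _ _ N) //=; last by rewrite /L -!addnA leq_addr.
  rewrite [X in _ + X]big1_seq ?addr0; last first.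
    by move=> i; rewrite mem_index_iota => /andP[_ /andP[Ni _]]; rewrite hf // rmorph0 mul0r.
  rewrite rmorph_sum /= big_nat [RHS]big_nat; apply: eq_bigr => n /andP[_ nN].
  by rewrite sqmod_conj seq_end1E /f finite_seqE nN.
(* [r] collects the terms with j + k > M. *)
set r := \sum_(0 <= j < M1) \sum_(M1 - j <= k < M1)
     (j`!%:R)^-1 * (k`!%:R)^-1 * (-1) ^+ j * h (j + k)%N.
have Er : (\sum_(0 <= m < L) sqmod (exp_trunc z M1 f m))%:C
    = (\sum_(0 <= n < N) sqmod (x n))%:C + r.
  rewrite E -E0 -(exp_series_telescope h M) -(triangular_sum (fun j k =>
    (j`!%:R)^-1 * (k`!%:R)^-1 * (-1) ^+ j * h (j + k)%N)) /r -big_split /=.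
  apply: eq_bigr => j _; rewrite -(@big_cat_nat _ _ _ (M1 - j)) //=.
  by rewrite leq_subr.
have term j k : (M1 - j <= k)%N -> (j < M1)%N -> (k < M1)%N ->
    cabs ((j`!%:R)^-1 * (k`!%:R)^-1 * (-1) ^+ j * h (j + k)%N) <= G / 2 ^+ M1 / 2 ^+ j / 2 ^+ k.
  move=> Mjk jM kM; rewrite !cabsM !cabs_invfact cabsX cabsN.
  have -> : cabs (1 : C) = 1 by exact: (cabs_nat R 1).
  rewrite expr1n mulr1.
  have f0 (i : nat) : i`!%:R != 0 :> R by rewrite pnatr_eq0 -lt0n fact_gt0.
  have -> : j`!%:R^-1 / k`!%:R = 'C(k + j, j)%:R / (k + j)`!%:R :> R.
    have := bin_fact (leq_addl k j) => /(congr1 (fun i => i%:R : R)).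
    rewrite addnK !natrM => <-; field; rewrite !f0 /=.
    by rewrite pnatr_eq0 -lt0n bin_gt0 leq_addl.
  rewrite [(j + k)%N]addnC -[X in X <= _]mulrA [X in _ * X <= _]mulrC.
  apply: le_trans (_ : (2 ^+ k * 2 ^+ j) * (G / 8 ^+ (k + j)) <= _).
    by apply: ler_pM => //; [rewrite divr_ge0 ?cabs_ge0 | exact: bin_le_exp2 | apply: hle; lia].
  have -> : G / 2 ^+ M1 / 2 ^+ j / 2 ^+ k = G * (2 ^+ (M1 + j + k))^-1.
    by rewrite !exprD !invfM !mulrA.
  rewrite mulrCA ler_wpM2l // -exprD ler_pdivrMr ?exprn_gt0 // mulrC ler_pdivlMr ?exprn_gt0 //.
  have -> : 8 = 2 ^+ 3 :> R by rewrite -natrX.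
  rewrite -exprM -!exprD -!natrX ler_nat leq_exp2l //; lia.
have rle : cabs r <= 4 * G / 2 ^+ M.
  apply: (@le_trans _ _ (\sum_(0 <= j < M1) 2 * (G / 2 ^+ M1) / 2 ^+ j)).
    apply: le_trans (cabs_sum _ _ _) _.
    rewrite big_nat [X in _ <= X]big_nat; apply: ler_sum => j /andP[_ jM].
    apply: le_trans (cabs_sum _ _ _) _.
    apply: (@le_trans _ _ (\sum_(M1 - j <= k < M1) G / 2 ^+ M1 / 2 ^+ j / 2 ^+ k)).
      rewrite big_nat [X in _ <= X]big_nat; apply: ler_sum => k /andP[Mjk kM]; exact: term.
    have GM0 : 0 <= G / 2 ^+ M1 / 2 ^+ j by rewrite !divr_ge0 ?exprn_ge0.
    apply: le_trans (sum_geometric_le _ _ GM0) _; rewrite -!mulrA ler_wpM2l //.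
    by rewrite !mulrA ler_pdivrMr ?exprn_gt0 // ler_peMr // -natrX ler1n expn_gt0.
  have GM0 : 0 <= 2 * (G / 2 ^+ M1) by rewrite mulr_ge0 // divr_ge0 ?exprn_ge0.
  apply: le_trans (sum_geometric_le _ _ GM0) _; rewrite expr0 divr1.
  have h2 : G / 2 ^+ M1 <= G / 2 ^+ M.
    by rewrite ler_wpM2l // lef_pV2 ?posrE ?exprn_gt0 // exprS ler_peMl ?exprn_ge0 // ler1n.
  lra.
move/(congr1 (@complex.Re R)): Er => /= ->.
have -> : complex.Re ((\sum_(0 <= n < N) sqmod (x n))%:C + r) =
  \sum_(0 <= n < N) sqmod (x n) + complex.Re r by case: (r).
rewrite lerD2l; apply: le_trans rle; apply: le_trans (ler_norm _) _; exact: Re_le_cabs.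
Qed.

End WeylOperator.

(** * Existence and matrix of the Weyl operators *)

Section WeylExistence.
Variable R : realType.
Local Notation C := R[i].
Implicit Types (z : C).

Lemma cvg_half_pow (G : R) : G / 2 ^+ M @[M --> \oo] --> (0 : R).
Proof.
rewrite -[X in _ --> X](mulr0 G); apply: cvgM; first exact: cvg_cst.
under eq_fun do rewrite -exprVn.
by apply: cvg_expr; rewrite ger0_norm ?invr_ge0 // invf_lt1 // ltr1n.
Qed.

(** The norm estimate for truncations survives the limit, so the entrywise exponential is a
    contraction. *)
Lemma weyl_matrix_bounded z : matrix_bounded (weyl_entry z) 1.
Proof.
move=> K N x; rewrite mul1r.
have [G G0 hG] := exp_trunc_norm z N x.
have [H H0 hH] := weyl_entry_tail z.
have cv m : cabs (exp_trunc z M.+1 (finite_seq N x) m - \sum_(0 <= n < N) weyl_entry z m n * x n)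
    @[M --> \oo] --> (0 : R).
  have h0 : \sum_(0 <= n < N) cabs (series (weyl_term z m n) M.+1 - weyl_entry z m n) * cabs (x n)
      @[M --> \oo] --> (0 : R).
    rewrite -[X in _ --> X](_ : \sum_(0 <= n < N) (0 * cabs (x n)) = 0); last first.
      by rewrite big1 // => i _; rewrite mul0r.
    apply: cvg_sum_real => n; apply: cvgM; last exact: cvg_cst.
    have [h _] := hH m n 0%N.
    by rewrite -(cvg_shiftS (fun M => cabs (series (weyl_term z m n) M - weyl_entry z m n))) in h.
  apply: (squeeze_cvgr _ (cvg_cst 0) h0); near=> M; rewrite cabs_ge0 /=.
  rewrite exp_truncE -sumrB; apply: le_trans (cabs_sum _ _ _) _.
  by apply: ler_sum => n _; rewrite -mulrBl cabsM.
have cv2 : \sum_(0 <= m < K) sqmod (exp_trunc z M.+1 (finite_seq N x) m)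
    @[M --> \oo] --> \sum_(0 <= m < K) sqmod (\sum_(0 <= n < N) weyl_entry z m n * x n).
  apply: cvg_sum_real => m; have hc := cvg_cabs (cv m).
  have : cabs (exp_trunc z M.+1 (finite_seq N x) m) ^+ 2 @[M --> \oo] -->
      cabs (\sum_(0 <= n < N) weyl_entry z m n * x n) ^+ 2.
    by under eq_fun do rewrite expr2; rewrite expr2; exact: cvgM.
  by rewrite cabs_sq; under eq_fun do rewrite cabs_sq.
have cv3 : \sum_(0 <= n < N) sqmod (x n) + G / 2 ^+ M @[M --> \oo]
    --> \sum_(0 <= n < N) sqmod (x n).
  rewrite -[X in _ --> X]addr0; apply: cvgD; [exact: cvg_cst|exact: cvg_half_pow].
rewrite -(cvg_lim (@norm_hausdorff _ _) cv2) -(cvg_lim (@norm_hausdorff _ _) cv3).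
apply: ler_lim; [by apply/cvg_ex; eexists; exact: cv2|by apply/cvg_ex; eexists; exact: cv3|].
by near=> M; exact: hG.
Unshelve. all: by end_near.
Qed.

Lemma sqrt_cvg0 (f : nat -> R) : (forall n, 0 <= f n) -> f @ \oo --> (0 : R) ->
  Num.sqrt (f n) @[n --> \oo] --> (0 : R).
Proof.
move=> f0 /cvgrPdist_le h; apply/cvgrPdist_le => e e0.
have := h (e ^+ 2); rewrite exprn_gt0 // => /(_ isT) {}h; near=> n.
rewrite sub0r normrN ger0_norm ?sqrtr_ge0 //.
rewrite -[e]ger0_norm ?(ltW e0) // -sqrtr_sqr ler_wsqrtr //.
have : `|0 - f n| <= e ^+ 2 by near: n.
by rewrite sub0r normrN ger0_norm.
Unshelve. all: by end_near.
Qed.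

Lemma l2norm_ge_cabs (x : nat -> C) n : x \in @ell2 R -> cabs (x n) <= l2norm x.
Proof. by move=> hx; have := cabs_le_fnorm (Fock hx) n. Qed.

(** The candidate is built from its matrix; the norm convergence demanded by [is_weyl] rests on the
    factor 2^-m in [weyl_entry_tail]. *)
Lemma is_weyl_exists z : exists2 W, is_weyl z W & forall n m, W (ebasis R n) m = weyl_entry z m n.
Proof.
have [W bW hW] := matrix_op ler01 (weyl_matrix_bounded z).
exists W => //; split => // n.
have [H H0 hH] := weyl_entry_tail z.
pose y M : nat -> C := series (fun k => (k`!%:R)^-1 *:
              iter k (z *: @cre R - z^* *: @ann R) (ebasis R n)) M - (W (ebasis R n)).
have yE M m : y M m = series (weyl_term z m n) M - weyl_entry z m n.
  rewrite /y -hW; congr (_ - _); rewrite /series /= seq_sumE; apply: eq_bigr => k _.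
  by rewrite seq_scaleE /weyl_term /entry seq_endXE.
have sum_le M K : \sum_(0 <= m < K) sqmod (y M m) <= 4 * (H * 4 ^+ n / 2 ^+ M) ^+ 2.
  apply: (@le_trans _ _ (\sum_(0 <= m < K) ((H * 4 ^+ n / 2 ^+ M) ^+ 2 / 2 ^+ m))).
    apply: ler_sum => m _; rewrite yE -cabs_sq cabs_distC.
    have [_ h] := hH m n M.
    have c0 : 0 <= H * 4 ^+ n / 2 ^+ m / 2 ^+ M by rewrite !divr_ge0 ?mulr_ge0 ?exprn_ge0.
    apply: (@le_trans _ _ ((H * 4 ^+ n / 2 ^+ m / 2 ^+ M) ^+ 2)).
      by rewrite ler_sqr ?nnegrE ?cabs_ge0.
    rewrite mulrAC exprMn ler_wpM2l ?sqr_ge0 // exprVn.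
    rewrite lef_pV2 ?posrE ?exprn_gt0 // -exprM -!natrX ler_nat leq_exp2l //; lia.
  apply: le_trans (sum_geometric_le _ _ (sqr_ge0 _)) _.
  by rewrite expr0 divr1 ler_wpM2r ?sqr_ge0 // ler_nat.
have hb M : 0 <= 4 * (H * 4 ^+ n / 2 ^+ M) ^+ 2.
  by apply: mulr_ge0 => //; exact: sqr_ge0.
have cv : Num.sqrt (4 * (H * 4 ^+ n / 2 ^+ M) ^+ 2) @[M --> \oo] --> (0 : R).
  apply: (@sqrt_cvg0 (fun M => 4 * (H * 4 ^+ n / 2 ^+ M) ^+ 2)) => //.
  have h2 : 4 * (H * 4 ^+ n / 2 ^+ M * (H * 4 ^+ n / 2 ^+ M)) @[M --> \oo] --> (4 * (0 * 0) : R).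
    by apply: cvgM; [exact: cvg_cst|apply: cvgM; exact: cvg_half_pow].
  by rewrite !mulr0 in h2; under eq_fun do rewrite expr2.
apply: (squeeze_cvgr _ (cvg_cst 0) cv); near=> M; rewrite sqrtr_ge0 /=.
rewrite -/(y M) /l2norm ler_wsqrtr //.
by apply: lim_series_bounded => [k|K]; [exact: sqmod_ge0|exact: sum_le].
Unshelve. all: by end_near.
Qed.

(** Norm convergence implies convergence of entries, so all solutions of [is_weyl] have the same
    matrix and the choice made by [xget] is harmless. *)
Lemma is_weyl_entry z W n m : is_weyl z W -> W (ebasis R n) m = weyl_entry z m n.
Proof.
case=> bW /(_ n) hW; have [H H0 hH] := weyl_entry_tail z.
have [h _] := hH m n 0%N; apply: (cabs_lim_unique _ h).
apply: (squeeze_cvgr _ (cvg_cst 0) hW); near=> M; rewrite cabs_ge0 /=.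
set y : nat -> C := _ - _.
(* [l2norm] controls entries only for square-summable sequences; here the partial sums have finite
   support. *)
have hy : y \in @ell2 R.
  have -> : y = \sum_(0 <= k < M) (k`!%:R)^-1 *: (field_op z ^+ k) (ebasis R n) - W (ebasis R n).
    congr (_ - _); rewrite /series /=; apply: eq_bigr => k _; by rewrite seq_endXE.
  rewrite rpredB //; last by case: (W _).
  rewrite rpred_sum // => k _; rewrite rpredZ //.
  apply: (@ell2_bounded _ _ (\sum_(0 <= m < n + k.+1) sqmod ((field_op z ^+ k) (ebasis R n) m))).
  move=> N; have [NK|KN] := leqP N (n + k.+1).
    rewrite [X in _ <= X](big_cat_nat (leq0n N) NK) //= lerDl.
    by apply: sumr_ge0 => i _; exact: sqmod_ge0.
  rewrite (big_cat_nat (leq0n (n + k.+1)%N) (ltnW KN)) //= [X in _ + X]big1_seq ?addr0 //.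
  move=> i; rewrite mem_index_iota => /andP[_ /andP[ni _]].
  by have := @entry_high _ z k i n; rewrite /entry => ->; rewrite ?sqmod0 //; lia.
have := l2norm_ge_cabs m hy; apply: le_trans; rewrite le_eqVlt; apply/orP; left; apply/eqP.
congr (cabs (_ - _)); rewrite /series /= seq_sumE; apply: eq_bigr => k _.
by rewrite seq_scaleE /weyl_term /entry seq_endXE.
Unshelve. all: by end_near.
Qed.

Lemma weyl_bounded z : bounded_op (weyl z).
Proof.
have [W hW _] := is_weyl_exists z.
have : is_weyl z (weyl z) by exact: (xgetPex 0 (ex_intro _ W hW)).
by case.
Qed.

Lemma weylE z n m : weyl z (ebasis R n) m = weyl_entry z m n.
Proof.
have [W hW _] := is_weyl_exists z; apply: is_weyl_entry.
exact: (xgetPex 0 (ex_intro _ W hW)).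
Qed.

End WeylExistence.

(** * Embedding of polynomials *)

Section ThermalEmbedding.
Variable R : realType.
Local Notation C := R[i].
Local Notation op := (fock R -> fock R).
Local Notation E := (seq_end R).
Variables (b s : R).
Hypotheses (b0 : 0 < b) (s0 : 0 <= s) (s1 : s <= 1).
Implicit Types (z : C) (p q : E).

Lemma thermal_base_gt0 n : 0 < (1 - expR (- b)) * expR (- b * n%:R).
Proof. by rewrite mulr_gt0 ?expR_gt0 // subr_gt0 expR_lt1 oppr_lt0. Qed.

Lemma thermal_pow_gt0 x n : 0 < thermal_pow b x n.
Proof. by rewrite powR_gt0 // thermal_base_gt0. Qed.

Lemma thermal_pow_le x n : 0 <= x -> thermal_pow b x n <= expR (- (b * x * n%:R)).
Proof.
move=> x0; have -> : expR (- (b * x * n%:R)) = expR (- b * n%:R) `^ x.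
  by rewrite -expRM; congr expR; ring.
rewrite ge0_ler_powR ?nnegrE ?(ltW (thermal_base_gt0 n)) ?expR_ge0 //.
by rewrite ler_piMl ?expR_ge0 // lerBlDr lerDl expR_ge0.
Qed.

Lemma thermal_pow_le1 x n : 0 <= x -> thermal_pow b x n <= 1.
Proof.
move=> x0; apply: le_trans (thermal_pow_le _ x0) _.
by rewrite -[X in _ <= X]expR0 ler_expR oppr_le0 !mulr_ge0 // ltW.
Qed.

Lemma thermalE x (y : fock R) n : 0 <= x ->
  (thermal b x y) n = (thermal_pow b x n)%:C * y n.
Proof.
move=> x0; rewrite /thermal (@insubd_ell2 _ _ (fnorm y ^+ 2)) // => N.
apply: le_trans (sum_sqmod_le y N); apply: ler_sum => k _.
rewrite /diag_seq sqmodM ler_piMl ?sqmod_ge0 // -cabs_sq cabs_real.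
by rewrite real_normK ?num_real // expr_le1 ?thermal_pow_le1 // ltW ?thermal_pow_gt0.
Qed.

#[local] Opaque thermal thermal_pow.

Lemma mul_false (c c' : C) : c * false%:R = c' * false%:R.
Proof. by rewrite !mulr0. Qed.

Lemma thermal_ebasis x n : 0 <= x ->
  thermal b x (ebasis R n) = (thermal_pow b x n)%:C *: ebasis R n.
Proof.
move=> x0; apply: fock_ext => m; rewrite (thermalE _ _ x0) [RHS]fockZE ebasisE.
by case: eqVneq => [->|_]; [exact: erefl|exact: mul_false].
Qed.

Lemma bounded_thermal x : 0 <= x -> bounded_op (thermal b x).
Proof.
move=> x0; split.
  move=> c y y'; apply: fock_ext => m; rewrite fock_linE !thermalE // fock_linE.
  by rewrite mulrDr mulrCA.
exists 1 => y; rewrite mul1r -(@ler_pXn2r _ 2) ?nnegrE ?fnorm_ge0 //.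
apply: fnorm_sq_le => N; apply: le_trans (sum_sqmod_le y N); apply: ler_sum => k _.
rewrite thermalE // sqmodM ler_piMl ?sqmod_ge0 // -cabs_sq cabs_real.
by rewrite real_normK ?num_real // expr_le1 ?thermal_pow_le1 // ltW ?thermal_pow_gt0.
Qed.

Lemma bounded_comp (X Y : op) : bounded_op X -> bounded_op Y -> bounded_op (X \o Y).
Proof.
move=> [lX [M hM]] [lY [M' hM']]; split; first by move=> c x y; rewrite /= lY lX.
exists (`|M| * M') => x; apply: le_trans (hM _) _.
apply: (@le_trans _ _ (`|M| * fnorm (Y x))); first by rewrite ler_wpM2r ?fnorm_ge0 // ler_norm.
by rewrite -mulrA ler_wpM2l.
Qed.

Let sl0 : 0 <= s / 2. Proof. by rewrite divr_ge0. Qed.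
Let sr0 : 0 <= (1 - s) / 2. Proof. by rewrite divr_ge0 // subr_ge0. Qed.

Definition sandwich (X : op) : op := thermal b (s / 2) \o X \o thermal b ((1 - s) / 2).

(** The factor by which [sandwich] and [embed] multiply the entry (m, n). *)
Definition wt (m n : nat) : R := thermal_pow b (s / 2) m * thermal_pow b ((1 - s) / 2) n.

Lemma wt_gt0 m n : 0 < wt m n. Proof. by rewrite mulr_gt0 ?thermal_pow_gt0. Qed.

Lemma bounded_sandwich X : bounded_op X -> bounded_op (sandwich X).
Proof.
move=> hX; apply: bounded_comp; last exact: bounded_thermal sr0.
by apply: bounded_comp; [exact: bounded_thermal sl0|exact: hX].
Qed.

Lemma sandwichE X m n : bounded_op X ->
  (sandwich X (ebasis R n)) m = (wt m n)%:C * (X (ebasis R n)) m.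
Proof.
case=> lX _; rewrite /sandwich /= (thermalE _ _ sl0) (thermal_ebasis _ sr0).
have X0 : X 0 = 0.
  have := lX 1 0 0; rewrite !scale1r addr0 => /eqP.
  by rewrite -subr_eq subrr eq_sym => /eqP.
have -> : X ((thermal_pow b ((1 - s) / 2) n)%:C *: ebasis R n) =
    (thermal_pow b ((1 - s) / 2) n)%:C *: X (ebasis R n).
  by rewrite -[_ *: ebasis R n]addr0 lX X0 addr0.
by rewrite fockZE mulrA -rmorphM.
Qed.

(* Any rate below exp(-b/4) would do here: entries of a polynomial grow at most
   like a power of m + n, those of the Weyl operators subexponentially. *)
Definition rate : R := expR (- (b / 8)).

Lemma rate_ge0 : 0 <= rate. Proof. exact: expR_ge0. Qed.
Lemma rate_lt1 : rate < 1. Proof. by rewrite expR_lt1 oppr_lt0 divr_gt0. Qed.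

(** For [s] equal to 0 or 1 the weight decays in one index only; within distance k of the diagonal
    that index is half of m + n up to k / 2, and exp(b / 2)^k pays for the deviation. Here
    [rate ^+ 2] is exp(- b / 4). *)
Lemma wt_le m n k : (m <= n + k)%N -> (n <= m + k)%N ->
  wt m n <= expR (b / 2) ^+ k * (rate ^+ 2) ^+ (m + n).
Proof.
move=> mnk nmk; rewrite -!expRM_natl /rate.
apply: (@le_trans _ _ (expR (- (b * (s / 2) * m%:R)) * expR (- (b * ((1 - s) / 2) * n%:R)))).
  by rewrite ler_pM ?thermal_pow_le // ltW ?thermal_pow_gt0.
rewrite -!expRD ler_expR.
have h1 : (m%:R : R) <= n%:R + k%:R by rewrite -natrD ler_nat.
have h2 : (n%:R : R) <= m%:R + k%:R by rewrite -natrD ler_nat.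
rewrite natrD; move: (m%:R) (n%:R) (k%:R) h1 h2 => x y w h1 h2.
have e1 : s * (y - x) <= s * w by rewrite ler_wpM2l // lerBlDl.
have e2 : (1 - s) * (x - y) <= (1 - s) * w by rewrite ler_wpM2l ?subr_ge0 // lerBlDl.
suff : b * (x + y) <= b * (2 * (s * x + (1 - s) * y) + 2 * w) by lra.
rewrite ler_wpM2l ?(ltW b0) //; lra.
Qed.

(** Of the two factors [rate] supplied by [wt_le], one compensates the binomial coefficient of
    [entry_le] and the other remains as decay. What is left has the form treated by
    [geometric_fact]. *)
Lemma weighted_entry_le z : exists2 H : R, 0 <= H & forall k m n,
  wt m n * (cabs (entry (field_op z ^+ k) m n) / k`!%:R) <= H * rate ^+ (m + n) / 2 ^+ k.
Proof.
set x := rate ^+ 2.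
have x0 : 0 <= x by exact: sqr_ge0.
have x1 : x < 1 by rewrite exprn_ilt1 ?rate_ge0 ?rate_lt1.
have y0 : 0 < 1 - x by rewrite subr_gt0.
(* [y] is the price per power of the field operator: x^n C(n + k, k) <= (1 - x)^-k = y^(2 k). *)
set y := Num.sqrt (1 - x)^-1.
have y00 : 0 <= y by exact: sqrtr_ge0.
have r0 := rate_ge0.
have rp n : 0 < rate ^+ n by rewrite exprn_gt0 // expR_gt0.
have [|H H0 hH] := @geometric_fact R (2 * cabs z * expR (b / 2) * y).
  by rewrite !mulr_ge0 ?cabs_ge0 ?expR_ge0.
exists H => // k m n.
have f0 : 0 < k`!%:R :> R by rewrite ltr0n fact_gt0.
have R0 : 0 <= H * rate ^+ (m + n) / 2 ^+ k by rewrite !(mulr_ge0, invr_ge0, exprn_ge0).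
have [h|mnk] := ltnP (n + k) m; first by rewrite entry_high // cabs0 mul0r mulr0.
have [h|nmk] := ltnP (m + k) n; first by rewrite entry_low // cabs0 mul0r mulr0.
have hb : rate ^+ n * Num.sqrt 'C(n + k, k)%:R <= y ^+ k.
  rewrite -[X in X <= _]ger0_norm ?mulr_ge0 ?sqrtr_ge0 ?exprn_ge0 //.
  rewrite -[X in _ <= X]ger0_norm ?exprn_ge0 // -!sqrtr_sqr ler_wsqrtr //.
  rewrite exprMn sqr_sqrtr // -exprM mulnC exprM -/x.
  have -> : (y ^+ k) ^+ 2 = ((1 - x) ^+ k)^-1.
    by rewrite -exprM mulnC exprM sqr_sqrtr ?invr_ge0 ?(ltW y0) // exprVn.
  rewrite -[X in _ <= X]mul1r ler_pdivlMr ?exprn_gt0 // [x ^+ n * _]mulrC.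
  by apply: bin_geometric_le => //; exact: ltW.
have h1 := wt_le mnk nmk; have h2 := entry_le z k m n; rewrite -/x in h1.
rewrite sqrtrM ?ler0n // in h2.
have := hH k; set t := Num.sqrt k`!%:R in h2 *; have t0 : 0 <= t by exact: sqrtr_ge0.
set cb := Num.sqrt 'C(n + k, k)%:R in h2 hb; have cb0 : 0 <= cb by exact: sqrtr_ge0.
move=> h3.
apply: (@le_trans _ _ ((2 * cabs z * expR (b / 2) * y) ^+ k * t / k`!%:R * rate ^+ (m + n))); last first.
  by rewrite [X in _ <= X]mulrAC ler_wpM2r // ltW.
rewrite mulrA [X in _ <= X]mulrAC ler_wpM2r ?invr_ge0 ?(ltW f0) //.
apply: (@le_trans _ _ ((expR (b / 2) ^+ k * x ^+ (m + n)) * ((2 * cabs z) ^+ k * (t * cb)))).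
  by rewrite ler_pM ?cabs_ge0 // ltW ?wt_gt0.
have xr : x ^+ (m + n) * cb <= rate ^+ (m + n) * y ^+ k.
  rewrite /x -exprM mulnC exprM expr2 -mulrA ler_wpM2l ?(ltW (rp _)) //.
  apply: le_trans hb; rewrite exprD -mulrA ler_piMl ?mulr_ge0 ?(ltW (rp _)) //.
  by rewrite exprn_ile1 // ltW ?rate_lt1.
have c0 : 0 <= expR (b / 2) ^+ k * (2 * cabs z) ^+ k * t.
  by rewrite !mulr_ge0 ?exprn_ge0 ?mulr_ge0 ?cabs_ge0 ?expR_ge0.
have := ler_wpM2l c0 xr.
have -> : (2 * cabs z * expR (b / 2) * y) ^+ k = (2 * cabs z) ^+ k * expR (b / 2) ^+ k * y ^+ k.
  by rewrite (exprMn k (2 * cabs z * _)) (exprMn k (2 * cabs z)).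
move: ((2 * cabs z) ^+ k) (expR (b / 2) ^+ k) (y ^+ k) (x ^+ (m + n)) (rate ^+ (m + n)).
by move=> a1 a2 a3 a4 a5; lra.
Qed.

Definition weighted_decay p := exists2 M : R, 0 <= M &
  forall m n, wt m n * cabs (entry p m n) <= M * rate ^+ (m + n).

Lemma weighted_decay_closed : linear_closed weighted_decay.
Proof.
split; first by exists 0 => // m n; rewrite cabs0 mulr0 mul0r.
move=> k p q [M M0 hM] [M' M'0 hM']; exists (cabs k * M + M').
  by rewrite addr_ge0 // mulr_ge0 ?cabs_ge0.
move=> m n; rewrite entryD entryZ.
have h := cabsD (k * entry p m n) (entry q m n); rewrite cabsM in h.
apply: le_trans (ler_wpM2l (ltW (wt_gt0 m n)) h) _.
rewrite mulrDr mulrDl lerD // mulrCA -mulrA ler_wpM2l ?cabs_ge0 //.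
Qed.

Lemma weighted_decay_exp z k : weighted_decay (field_op z ^+ k).
Proof.
have [H H0 hH] := weighted_entry_le z; exists (H * k`!%:R); first by rewrite mulr_ge0.
have f0 : 0 < k`!%:R :> R by rewrite ltr0n fact_gt0.
move=> m n; have := hH k m n; rewrite mulrA ler_pdivrMr // => h.
apply: le_trans h _; rewrite mulrAC ler_pdivrMr ?exprn_gt0 // mulrAC.
by rewrite ler_peMr ?mulr_ge0 ?exprn_ge0 ?rate_ge0 // -natrX ler1n expn_gt0.
Qed.

(** The weighted matrix defines a Hilbert-Schmidt operator, so the set in [embed] is inhabited; from
    here on [embed] is used through its entries. *)
Lemma embedP p : weighted_decay p -> hilbert_schmidt (embed b s p) /\
  forall m n, (embed b s p (ebasis R n)) m = (wt m n)%:C * entry p m n.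
Proof.
case=> M M0 hM.
have rhsE m n : diag_seq (thermal_pow b (s / 2))
    (p (diag_seq (thermal_pow b ((1 - s) / 2)) (ebasis R n))) m = (wt m n)%:C * entry p m n.
  have -> : diag_seq (thermal_pow b ((1 - s) / 2)) (ebasis R n) =
      (thermal_pow b ((1 - s) / 2) n)%:C *: (ebasis R n : nat -> C).
    apply/funext => k; rewrite /diag_seq seq_scaleE ebasisE.
    by case: eqVneq => [->|_]; [exact: erefl|exact: mul_false].
  by rewrite /diag_seq seq_end_funZ seq_scaleE mulrA -rmorphM.
have hd m n : cabs ((wt m n)%:C * entry p m n) <= M * rate ^+ (m + n).
  by rewrite cabsM cabs_real ger0_norm // ltW ?wt_gt0.
have [B bB hB] := decay_matrix rate_ge0 rate_lt1 M0 hd.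
have hsB : hilbert_schmidt B.
  by apply: (decay_hsnorm rate_ge0 rate_lt1 M0 bB _).1 => m n; rewrite hB.
have [] : hilbert_schmidt (embed b s p) /\ forall n, (embed b s p (ebasis R n) : nat -> C) =
    diag_seq (thermal_pow b (s / 2))
      (p (diag_seq (thermal_pow b ((1 - s) / 2)) (ebasis R n))).
  apply: (xgetPex 0 (P := [set B | hilbert_schmidt B /\ forall n,
    (B (ebasis R n) : nat -> C) = diag_seq (thermal_pow b (s / 2))
      (p (diag_seq (thermal_pow b ((1 - s) / 2)) (ebasis R n)))])).
  by exists B; split => // n; apply/funext => m; rewrite rhsE; exact: hB.
by move=> h1 h2; split; [exact: h1|move=> m n; rewrite -rhsE -h2; exact: erefl].
Qed.

#[local] Opaque embed.

Lemma embed_linear k p q : weighted_decay p -> weighted_decay q ->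
  embed b s (k *: p + q : E) = k *: embed b s p + embed b s q.
Proof.
move=> hp hq; have [[B1 _] e1] := embedP hp; have [[B2 _] e2] := embedP hq.
have [[B3 _] e3] := embedP (weighted_decay_closed.2 k p q hp hq).
apply: bounded_op_ext => //; first exact: bounded_opD.
move=> n m; rewrite e3 !fctE fock_linE e1 e2 entryD entryZ mulrDr; congr (_ + _).
exact: mulrCA.
Qed.

Lemma embed0 : embed b s (0 : E) = 0.
Proof.
have [[B _] e] := embedP weighted_decay_closed.1.
by apply: bounded_op_ext => //; [exact: bounded_op0|move=> n m; rewrite e entry0 mulr0].
Qed.

Lemma weyl_term_scale (r : R) z m n k : weyl_term (r%:C * z) m n k = (r ^+ k)%:C * weyl_term z m n k.
Proof.
rewrite /weyl_term; have -> : field_op (r%:C * z) = r%:C *: field_op z.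
  by rewrite /field_op rmorphM /= conj_real scalerBr !scalerA.
by rewrite exprZn entryZ mulrCA rmorphXn.
Qed.

(** For r <= 1 every term of order k >= K gains r^K, and [weighted_entry_le] leaves 2^-k for summing
    the remainder. *)
Lemma weyl_expansion z : exists2 H : R, 0 <= H & forall (r : R) K, 0 <= r -> r <= 1 ->
  hilbert_schmidt (sandwich (weyl (r%:C * z))
    - \sum_(0 <= k < K) (r ^+ k / k`!%:R)%:C *: embed b s (field_op z ^+ k)) /\
  hsnorm (sandwich (weyl (r%:C * z))
    - \sum_(0 <= k < K) (r ^+ k / k`!%:R)%:C *: embed b s (field_op z ^+ k)) <= H * r ^+ K.
Proof.
have [H H0 hH] := weighted_entry_le z.
have th2 : 0 < 1 - rate ^+ 2 by rewrite subr_gt0 exprn_ilt1 ?rate_ge0 ?rate_lt1.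
exists (2 * H / (1 - rate ^+ 2)); first by rewrite !mulr_ge0 ?invr_ge0 ?(ltW th2).
move=> r K r0 r1; set X := _ - _.
have sumE : forall n m, (\sum_(0 <= k < K) (r ^+ k / k`!%:R)%:C *: embed b s (field_op z ^+ k))
    (ebasis R n) m = (wt m n)%:C * series (weyl_term (r%:C * z) m n) K.
  move=> n m; rewrite /series /= mulr_sumr.
  have -> : forall N, (\sum_(0 <= k < N) (r ^+ k / k`!%:R)%:C *: embed b s (field_op z ^+ k))
      (ebasis R n) m = \sum_(0 <= k < N) (r ^+ k / k`!%:R)%:C *
        ((embed b s (field_op z ^+ k)) (ebasis R n)) m.
    by elim=> [|N IH]; rewrite ?big_nil // !big_nat_recr //= -IH.
  apply: eq_bigr => k _; rewrite (embedP (weighted_decay_exp z k)).2 weyl_term_scale.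
  by rewrite /weyl_term rmorphM /= fmorphV rmorph_nat; ring.
have bS : bounded_op (\sum_(0 <= k < K) (r ^+ k / k`!%:R)%:C *: embed b s (field_op z ^+ k)).
  elim: K {X sumE} => [|K IH]; first by rewrite big_nil; exact: bounded_op0.
  rewrite big_nat_recr //= addrC; apply: bounded_opD => //.
  by case: (embedP (weighted_decay_exp z K)) => -[].
have bX : bounded_op X.
  by rewrite /X -scaleN1r addrC; apply: bounded_opD => //; exact/bounded_sandwich/weyl_bounded.
have hX m n : cabs ((X (ebasis R n)) m) <= 2 * H * r ^+ K * rate ^+ (m + n).
  have -> : (X (ebasis R n)) m = (wt m n)%:C * (weyl_entry (r%:C * z) m n
      - series (weyl_term (r%:C * z) m n) K).
    by rewrite mulrBr -sumE -weylE -sandwichE //; exact: weyl_bounded.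
  have w0 := wt_gt0 m n.
  have A0 : 0 <= r ^+ K * H * rate ^+ (m + n) / wt m n.
    by rewrite !mulr_ge0 ?exprn_ge0 ?rate_ge0 ?invr_ge0 // ltW.
  have hk k : (K <= k)%N -> cabs (weyl_term (r%:C * z) m n k) <=
      r ^+ K * H * rate ^+ (m + n) / wt m n / 2 ^+ k.
    move=> Kk; rewrite weyl_term_scale cabsM cabs_real ger0_norm ?exprn_ge0 //.
    have h1 : r ^+ k <= r ^+ K by apply: ler_wiXn2l.
    have h2 : wt m n * cabs (weyl_term z m n k) <= H * rate ^+ (m + n) / 2 ^+ k.
      by have := hH k m n; rewrite /weyl_term cabsM cabs_invfact [cabs _ / _]mulrC.
    have := ler_pM (exprn_ge0 k r0) (mulr_ge0 (ltW w0) (cabs_ge0 _)) h1 h2.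
    move: (wt m n) w0 => w w0.
    have -> : r ^+ K * H * rate ^+ (m + n) / w / 2 ^+ k = r ^+ K * (H * rate ^+ (m + n) / 2 ^+ k) / w.
      by rewrite !mulrA mulrAC.
    move=> h; rewrite (ler_pdivlMr _ _ w0); apply: le_trans h.
    by rewrite -mulrA [_ * w]mulrC.
  have [_ h] := csum_tail A0 hk.
  rewrite cabsM cabs_real ger0_norm ?(ltW w0) //.
  apply: le_trans (ler_wpM2l (ltW w0) h) _.
  have -> : wt m n * (2 * (r ^+ K * H * rate ^+ (m + n) / wt m n) / 2 ^+ K) =
      2 * H * r ^+ K * rate ^+ (m + n) / 2 ^+ K.
    have p0 : (2 : R) ^+ K != 0 by rewrite expf_neq0 // pnatr_eq0.
    by field; rewrite p0 gt_eqF.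
  rewrite ler_pdivrMr ?exprn_gt0 // ler_peMr ?mulr_ge0 ?exprn_ge0 ?rate_ge0 //.
  by rewrite -natrX ler1n expn_gt0.
have M0 : 0 <= 2 * H * r ^+ K by rewrite !mulr_ge0 ?exprn_ge0.
have [h1 h2] := decay_hsnorm rate_ge0 rate_lt1 M0 bX hX.
by split => //; apply: le_trans h2 _; rewrite mulrAC.
Qed.

End ThermalEmbedding.

(** * Flow of the drift *)

Section RealIntegrals.
Variable R : realType.
Implicit Types (f : R -> R).

(** One regularity notion for the integrands: it is stable under sums and products, gives
    integrability, and yields the quadratic error in [Rintegral_near0]. *)
Definition locally_lipschitz f := forall B : R, 1 <= B ->
  exists2 K : R, 0 <= K & forall x y, `|x| <= B -> `|y| <= B -> `|f x - f y| <= K * `|x - y|.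

Lemma locally_lipschitz_continuous f : locally_lipschitz f -> continuous f.
Proof.
move=> hf x; have B1 : 1 <= `|x| + 1 by rewrite lerDr.
have [K K0 hK] := hf _ B1.
apply/cvgrPdist_le => e e0; near=> y.
have xy1 : `|x - y| <= 1.
  by near: y; apply: (cvgrPdist_le _ _).1; [exact: cvg_id|exact: ltr01].
have yB : `|y| <= `|x| + 1.
  rewrite -[y](subrK x); apply: le_trans (ler_normD _ _) _; rewrite addrC lerD2l.
  by rewrite distrC.
apply: le_trans (hK _ _ _ yB) _; first by rewrite lerDl.
have : `|x - y| <= e / (K + 1).
  near: y; apply: (cvgrPdist_le _ _).1; first exact: cvg_id.
  by rewrite divr_gt0 // ltr_wpDl.
rewrite ler_pdivlMr ?ltr_wpDl // mulrC; apply: le_trans.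
by rewrite ler_wpM2r // lerDl.
Unshelve. all: by end_near.
Qed.

Lemma locally_lipschitz_integrable f t : locally_lipschitz f ->
  lebesgue_measure.-integrable `[0, t] (EFin \o f).
Proof.
move=> /locally_lipschitz_continuous hf.
apply: continuous_compact_integrable; first exact: segment_compact.
exact: continuous_subspaceT.
Qed.

Lemma Rintegral_segment_cst (t c : R) : 0 <= t ->
  \int[lebesgue_measure]_(r in `[0, t]) c = c * t.
Proof.
move=> t0; rewrite Rintegral_cst //= lebesgue_measure_itv /= lte_fin.
have [t1|t1] := ltP 0 t; first by rewrite -EFinB subr0.
by have -> : t = 0 by apply/eqP; rewrite eq_le t0 t1.
Qed.

Lemma Rintegral_near0 f : locally_lipschitz f -> exists2 K : R, 0 <= K &
  forall t, 0 <= t -> t <= 1 ->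
  `|\int[lebesgue_measure]_(r in `[0, t]) f r - t * f 0| <= K * t ^+ 2.
Proof.
move=> hf; have [K K0 hK] := hf 1 (lexx _); exists K => // t t0 t1.
have hc (c : R) : lebesgue_measure.-integrable `[0, t] (EFin \o (fun=> c)).
  apply: continuous_compact_integrable; first exact: segment_compact.
  by apply: continuous_subspaceT => x; exact: cvg_cst.
have hi := locally_lipschitz_integrable t hf.
have hb x : `[0, t]%classic x -> `|f x - f 0| <= K * t.
  rewrite /= in_itv /= => /andP[x0 xt].
  apply: le_trans (hK _ _ _ _) _; rewrite ?normr0 // ?ger0_norm ?subr0 ?(le_trans xt) //.
  by rewrite ?ger0_norm // ler_wpM2l.
have ub : \int[lebesgue_measure]_(r in `[0, t]) f r <= (f 0 + K * t) * t.
  rewrite -Rintegral_segment_cst //; apply: le_Rintegral => // x /hb.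
  by rewrite ler_norml => /andP[_]; rewrite lerBlDl.
have lb : (f 0 - K * t) * t <= \int[lebesgue_measure]_(r in `[0, t]) f r.
  rewrite -Rintegral_segment_cst //; apply: le_Rintegral => // x /hb.
  by rewrite ler_norml lerBrDl => /andP[].
rewrite ler_norml expr2; apply/andP; split; lra.
Qed.

Lemma locally_lipschitzM f g : locally_lipschitz f -> locally_lipschitz g ->
  locally_lipschitz (fun x => f x * g x).
Proof.
move=> hf hg B B1; have [K K0 hK] := hf _ B1; have [L L0 hL] := hg _ B1.
have B0 : 0 <= B by exact: le_trans B1.
pose F := `|f 0| + K * B; pose G := `|g 0| + L * B.
have hF x : `|x| <= B -> `|f x| <= F.
  move=> xB; rewrite -[f x](subrK (f 0)) addrC; apply: le_trans (ler_normD _ _) _.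
  rewrite lerD2l; apply: le_trans (hK _ _ xB _) _; rewrite ?normr0 // subr0 ler_wpM2l //.
have hG x : `|x| <= B -> `|g x| <= G.
  move=> xB; rewrite -[g x](subrK (g 0)) addrC; apply: le_trans (ler_normD _ _) _.
  rewrite lerD2l; apply: le_trans (hL _ _ xB _) _; rewrite ?normr0 // subr0 ler_wpM2l //.
have F0 : 0 <= F by rewrite addr_ge0 // mulr_ge0.
have G0 : 0 <= G by rewrite addr_ge0 // mulr_ge0.
exists (F * L + G * K); first by rewrite addr_ge0 // mulr_ge0.
move=> x y xB yB.
have -> : f x * g x - f y * g y = f x * (g x - g y) + (f x - f y) * g y by ring.
apply: le_trans (ler_normD _ _) _; rewrite !normrM mulrDl lerD //.
  by rewrite -mulrA ler_pM ?hF ?hL.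
by rewrite mulrC -mulrA ler_pM ?hG ?hK.
Qed.

Lemma locally_lipschitzD f g : locally_lipschitz f -> locally_lipschitz g ->
  locally_lipschitz (fun x => f x + g x).
Proof.
move=> hf hg B B1; have [K K0 hK] := hf _ B1; have [L L0 hL] := hg _ B1.
exists (K + L); first exact: addr_ge0.
move=> x y xB yB; rewrite opprD addrACA mulrDl.
by apply: le_trans (ler_normD _ _) _; rewrite lerD ?hK ?hL.
Qed.

Lemma locally_lipschitz_cst c : locally_lipschitz (fun=> c).
Proof. by move=> B B1; exists 0 => // x y _ _; rewrite subrr normr0 mul0r. Qed.

End RealIntegrals.

Section DriftFlow.
Variable R : realType.
Local Notation C := R[i].
Variables (Omega : R) (kappa : C) (u v : 'I_2 -> C).
Implicit Types (z : C).

Let Z := Zmap Omega kappa u v.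
Let flow := expZ Omega kappa u v.

Lemma Zmap_real_linear (r : R) z w : Z (r%:C * z + w) = r%:C * Z z + Z w.
Proof. by rewrite /Z /Zmap conjD conjM conj_real; ring. Qed.

Lemma iter_Zmap_scale (r : R) z k : iter k Z (r%:C * z) = r%:C * iter k Z z.
Proof.
have Z0 : Z 0 = 0 by rewrite /Z /Zmap rmorph0 !mulr0 addr0.
by elim: k => [//|k IH] /=; rewrite IH -[r%:C * _]addr0 Zmap_real_linear Z0 addr0.
Qed.

Lemma iter_Zmap_le : exists2 L : R, 0 <= L & forall k z, cabs (iter k Z z) <= L ^+ k * cabs z.
Proof.
pose L := cabs ('i * Omega%:C - (gamma u v)%:C) + cabs ('i * kappa).
have L0 : 0 <= L by rewrite addr_ge0 ?cabs_ge0.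
exists L => // k z; elim: k => [|k IH]; first by rewrite expr0 mul1r.
rewrite exprS -mulrA; apply: le_trans (_ : L * cabs (iter k Z z) <= _); last by rewrite ler_wpM2l.
rewrite /= {1}/Z /Zmap; apply: le_trans (cabsD _ _) _.
by rewrite !(cabsM _ (iter _ _ _)) cabsM cabs_conj mulrDl.
Qed.

Definition flow_term (t : R) z k : C := (exp_coeff t k)%:C * iter k Z z.

Lemma exp_coeffE (t : R) k : exp_coeff t k = t ^+ k / k`!%:R. Proof. by []. Qed.

Lemma geometric_exp_coeff (D : R) : 0 <= D ->
  exists2 H : R, 0 <= H & forall k, D ^+ k / k`!%:R <= H / 2 ^+ k.
Proof.
move=> D0; have [H H0 hH] := geometric_fact D0; exists H => // k; apply: le_trans (hH k).
rewrite ler_wpM2r ?invr_ge0 // ler_peMr ?exprn_ge0 //.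
by rewrite -[X in X <= _]sqrtr1 ler_wsqrtr // ler1n fact_gt0.
Qed.

Lemma flow_term_le (B : R) : 0 <= B -> exists2 H : R, 0 <= H &
  forall t z k, `|t| <= B -> cabs (flow_term t z k) <= H * cabs z / 2 ^+ k.
Proof.
move=> B0; have [L L0 hL] := iter_Zmap_le.
have [|H H0 hH] := @geometric_exp_coeff (B * L); first exact: mulr_ge0.
exists H => // t z k tB; rewrite cabsM cabs_real exp_coeffE normrM normrX [`|_^-1|]ger0_norm ?invr_ge0 //.
apply: (@le_trans _ _ ((B * L) ^+ k / k`!%:R * cabs z)); last first.
  by rewrite [X in _ <= X]mulrAC ler_wpM2r ?cabs_ge0.
have hm : `|t| ^+ k * cabs (iter k Z z) <= B ^+ k * (L ^+ k * cabs z).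
  by rewrite ler_pM ?cabs_ge0 ?exprn_ge0 // lerXn2r ?nnegrE.
have f0 : 0 <= k`!%:R^-1 :> R by rewrite invr_ge0.
have h := ler_wpM2r f0 hm.
rewrite exprMn [X in X <= _]mulrAC [X in _ <= X]mulrAC -[X in _ <= X * _]mulrA.
exact: h.
Qed.

(** The limit in [expZ] is taken in [R[i]]; here it is identified with [csum], for which tail
    estimates are available. *)
Lemma flow_cvg t z :
  cabs (series (flow_term t z) n - flow t z) @[n --> \oo] --> (0 : R) /\
  flow t z = csum (flow_term t z).
Proof.
have [H H0 hH] := flow_term_le (normr_ge0 t).
have A0 : 0 <= H * cabs z by rewrite mulr_ge0 ?cabs_ge0.
have [h _] := @csum_tail _ (flow_term t z) _ 0 A0 (fun k _ => hH t z k (lexx _)).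
suff e : flow t z = csum (flow_term t z) by rewrite e.
rewrite /flow /expZ; apply: (@cvg_lim C).
  exact: (@norm_hausdorff C C).
exact: (cvg_complex h).
Qed.

Lemma flow_scale (r t : R) z : flow t (r%:C * z) = r%:C * flow t z.
Proof.
have [h1 _] := flow_cvg t (r%:C * z); have [h2 _] := flow_cvg t z.
apply: (cabs_lim_unique h1).
have e n : series (flow_term t (r%:C * z)) n = r%:C * series (flow_term t z) n.
  rewrite /series /= mulr_sumr; apply: eq_bigr => k _.
  by rewrite /flow_term iter_Zmap_scale mulrCA.
have h3 : cabs r%:C * cabs (series (flow_term t z) n - flow t z) @[n --> \oo] --> (cabs r%:C * 0 : R).
  by apply: cvgM => //; exact: cvg_cst.
by rewrite mulr0 in h3; under eq_fun do rewrite e -mulrBr cabsM.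
Qed.

Lemma flow0 z : flow 0 z = z.
Proof.
have [h _] := flow_cvg 0 z; apply: (cabs_lim_unique h).
apply: cvg_near_cst; exists 1%N => // n /= n1.
rewrite /series /= big_ltn // big1_seq ?addr0.
  by rewrite /flow_term exp_coeffE expr0 fact0 invr1 mulr1 mul1r subrr cabs0.
move=> k; rewrite mem_index_iota => /andP[_ /andP[k1 _]].
by rewrite /flow_term exp_coeffE expr0n (gtn_eqF k1) /= mul0r mul0r.
Qed.

Lemma flow_near0 : exists2 K : R, 0 <= K & forall t z, 0 <= t -> t <= 1 ->
  cabs (flow t z - (z + t%:C * Z z)) <= K * cabs z * t ^+ 2.
Proof.
have [H H0 hH] := flow_term_le ler01; exists (2 * H); first by rewrite mulr_ge0.
move=> t z t0 t1; rewrite (flow_cvg t z).2.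
have A0 : 0 <= t ^+ 2 * (H * cabs z) by rewrite !mulr_ge0 ?cabs_ge0 ?exprn_ge0.
have hk k : (2 <= k)%N -> cabs (flow_term t z k) <= t ^+ 2 * (H * cabs z) / 2 ^+ k.
  move=> k2; have := hH 1 z k; rewrite normr1 => /(_ (lexx _)) h.
  have -> : flow_term t z k = (t ^+ k)%:C * flow_term 1 z k.
    by rewrite /flow_term !exp_coeffE expr1n mul1r rmorphM mulrA.
  rewrite cabsM cabs_real ger0_norm ?exprn_ge0 // -mulrA.
  by apply: ler_pM; rewrite ?exprn_ge0 ?cabs_ge0 // ler_wiXn2l.
have [_ h] := csum_tail A0 hk.
have e : series (flow_term t z) 2 = z + t%:C * Z z.
  rewrite /series /= !big_nat_recr //= big_nil add0r /flow_term !exp_coeffE.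
  by rewrite expr0 expr1 !fact0 invr1 !mulr1 /= mul1r.
rewrite e in h; apply: le_trans h _.
have -> : 2 * (t ^+ 2 * (H * cabs z)) / 2 ^+ 2 = (2 * H * cabs z * t ^+ 2) / 2 ^+ 2 by ring.
by rewrite ler_pdivrMr ?exprn_gt0 // ler_peMr ?mulr_ge0 ?cabs_ge0 ?exprn_ge0 // -natrX ler1n.
Qed.

Lemma ler_distX (B x y : R) k : 1 <= B -> `|x| <= B -> `|y| <= B ->
  `|x ^+ k - y ^+ k| <= k%:R * B ^+ k * `|x - y|.
Proof.
move=> B1 xB yB; have B0 : 0 <= B by exact: le_trans B1.
elim: k => [|k IH]; first by rewrite !expr0 subrr normr0 mul0r mul0r.
have -> : x ^+ k.+1 - y ^+ k.+1 = x * (x ^+ k - y ^+ k) + (x - y) * y ^+ k by rewrite !exprS; ring.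
apply: le_trans (ler_normD _ _) _; rewrite !normrM normrX.
have h1 : `|x| * `|x ^+ k - y ^+ k| <= B * (k%:R * B ^+ k * `|x - y|) by rewrite ler_pM.
have h2 : `|x - y| * `|y| ^+ k <= `|x - y| * B ^+ k.+1.
  rewrite ler_wpM2l //; apply: (@le_trans _ _ (B ^+ k)); first by rewrite lerXn2r ?nnegrE.
  by rewrite exprS ler_peMl ?exprn_ge0.
apply: le_trans (lerD h1 h2) _; rewrite le_eqVlt; apply/orP; left; apply/eqP.
by rewrite -natr1 exprS; ring.
Qed.

Lemma flow_lipschitz z (B : R) : 1 <= B -> exists2 K : R, 0 <= K &
  forall t t', `|t| <= B -> `|t'| <= B -> cabs (flow t z - flow t' z) <= K * `|t - t'|.
Proof.
move=> B1; have B0 : 0 <= B by exact: le_trans B1.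
(* The radius is [2 * B] because the factor k of [ler_distX] will be absorbed by 2^k. *)
have [H H0 hH] := @flow_term_le (2 * B) (mulr_ge0 (ler0n _ 2) B0).
have A0 : 0 <= H * cabs z by rewrite mulr_ge0 ?cabs_ge0.
exists (2 * (H * cabs z)); first exact: mulr_ge0.
move=> t t' tB t'B; have [h1 _] := flow_cvg t z; have [h2 _] := flow_cvg t' z.
have h3 : cabs ((series (flow_term t z) n - series (flow_term t' z) n) - (flow t z - flow t' z))
    @[n --> \oo] --> (0 : R).
  have h0 : cabs (series (flow_term t z) n - flow t z) + cabs (series (flow_term t' z) n - flow t' z)
      @[n --> \oo] --> (0 + 0 : R) by exact: cvgD.
  rewrite addr0 in h0; apply: (squeeze_cvgr _ (cvg_cst 0) h0); near=> n.
  rewrite cabs_ge0 /=; apply: le_trans (cabsB _ _).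
  by rewrite le_eqVlt; apply/orP; left; apply/eqP; congr cabs; ring.
rewrite -[X in cabs X]subr0; apply: (cabs_lim_le h3); near=> n; rewrite subr0.
rewrite /series /= -sumrB; apply: le_trans (cabs_sum _ _ _) _.
apply: (@le_trans _ _ (\sum_(0 <= k < n) (H * cabs z * `|t - t'|) / 2 ^+ k)); last first.
  apply: le_trans (sum_geometric_le _ _ _) _; first by rewrite mulr_ge0.
  by rewrite expr0 divr1 mulrA.
apply: ler_sum => k _; rewrite -mulrBl cabsM -rmorphB cabs_real !exp_coeffE -mulrBl normrM.
rewrite [`|_^-1|]ger0_norm ?invr_ge0 //.
have B20 : 0 <= 2 * B by rewrite mulr_ge0.
have n2B : `|2 * B| <= 2 * B by rewrite ger0_norm.
have h := hH _ z k n2B; rewrite cabsM cabs_real exp_coeffE in h.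
rewrite ger0_norm ?divr_ge0 ?exprn_ge0 // in h.
have h' := ler_wpM2r (normr_ge0 (t - t')) h.
apply: le_trans (le_trans _ h') _; last by rewrite [X in X <= _]mulrAC.
rewrite [X in _ <= X]mulrAC ler_wpM2r ?cabs_ge0 //.
rewrite [X in _ <= X]mulrAC ler_wpM2r ?invr_ge0 //.
apply: le_trans (ler_distX _ B1 tB t'B) _; rewrite ler_wpM2r // exprMn ler_wpM2r ?exprn_ge0 //.
by rewrite -natrX ler_nat ltnW // ltn_expl.
Unshelve. all: by end_near.
Qed.

Definition rate_fun z (t : R) : R := complex.Re ((flow t z)^* * Cmap u v (flow t z)).

Definition quad_int (t : R) z : R := 2^-1 * \int[lebesgue_measure]_(r in `[0, t]) rate_fun z r.

(** The integrand is a quadratic form in the real and imaginary parts of the flow, both of which are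
    Lipschitz. *)
Lemma rate_fun_lipschitz z : locally_lipschitz (rate_fun z).
Proof.
have lR : locally_lipschitz (fun t => complex.Re (flow t z)).
  move=> B /(flow_lipschitz z)[K K0 hK]; exists K => // x y xB yB.
  apply: le_trans (hK _ _ xB yB); apply: le_trans (Re_le_cabs _).
  by case: (flow x z) (flow y z) => [? ?] [? ?].
have lI : locally_lipschitz (fun t => complex.Im (flow t z)).
  move=> B /(flow_lipschitz z)[K K0 hK]; exists K => // x y xB yB.
  apply: le_trans (hK _ _ xB yB); apply: le_trans (Im_le_cabs _).
  by case: (flow x z) (flow y z) => [? ?] [? ?].
pose d : R := \sum_(l < 2) (sqmod (u l) + sqmod (v l)).
pose tau : C := \sum_(l < 2) 2 * v l * u l.
have CE w : Cmap u v w = d%:C * w + tau * w^*.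
  rewrite /Cmap /d /tau rmorph_sum /= !mulr_suml -big_split; apply: eq_bigr => l _.
  by [].
have E : rate_fun z = fun t => (d + complex.Re tau) * (complex.Re (flow t z) * complex.Re (flow t z))
   + ((d - complex.Re tau) * (complex.Im (flow t z) * complex.Im (flow t z))
   + (2 * complex.Im tau) * (complex.Re (flow t z) * complex.Im (flow t z))).
  apply/funext => t; rewrite /rate_fun CE.
  by case: (flow t z) (tau) => [x y] [p q] /=; ring.
rewrite E; apply: locally_lipschitzD; last apply: locally_lipschitzD;
  by apply: locally_lipschitzM; [exact: locally_lipschitz_cst|exact: locally_lipschitzM].
Qed.

Lemma quad_int_scale (r t : R) z : quad_int t (r%:C * z) = r ^+ 2 * quad_int t z.
Proof.
have li := locally_lipschitz_integrable t (rate_fun_lipschitz z).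
have e : \int[lebesgue_measure]_(x in `[0, t]) (r ^+ 2 * rate_fun z x) =
    r ^+ 2 * \int[lebesgue_measure]_(x in `[0, t]) rate_fun z x by apply: RintegralZl.
rewrite /quad_int mulrCA -e.
congr (_ * _); apply: eq_Rintegral => x _; rewrite /rate_fun flow_scale.
have -> : Cmap u v (r%:C * flow x z) = r%:C * Cmap u v (flow x z).
  rewrite /Cmap mulr_sumr; apply: eq_bigr => l _; rewrite conjM conj_real; ring.
rewrite conjM conj_real mulrACA.
by move: (_^* * _) => w; case: w => p q; rewrite expr2 /=; ring.
Qed.

Lemma quad_int_near0 z : exists2 K : R, 0 <= K & forall t, 0 <= t -> t <= 1 ->
  `|quad_int t z - t * (2^-1 * complex.Re (z^* * Cmap u v z))| <= K * t ^+ 2.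
Proof.
have [K K0 hK] := Rintegral_near0 (rate_fun_lipschitz z).
exists K => // t t0 t1; have := hK t t0 t1.
have -> : rate_fun z 0 = complex.Re (z^* * Cmap u v z) by rewrite /rate_fun flow0.
rewrite /quad_int; move: (Rintegral _ _ _) (complex.Re _) => x y.
have -> : 2^-1 * x - t * (2^-1 * y) = 2^-1 * (x - t * y) by ring.
have h2 : `|2^-1| <= 1 :> R by rewrite ger0_norm ?invr_ge0 //; lra.
by rewrite normrM; apply: le_trans; apply: ler_piMl.
Qed.

Lemma gaussian_factorE (t : R) z :
  gaussian_factor Omega kappa 0 u v t z = (expR (- quad_int t z))%:C.
Proof.
rewrite /gaussian_factor -/(quad_int t z).
have -> : \int[lebesgue_measure]_(r in `[0, t]) complex.Re (0^* * expZ Omega kappa u v r z) = 0 :> R.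
  under eq_Rintegral do rewrite rmorph0 mul0r /=.
  by rewrite Rintegral_cst // mul0r.
rewrite mulr0 addr0 /cexp /=.
by rewrite oppr0 cos0 sin0 /= mulr1.
Qed.

End DriftFlow.

#[local] Opaque weyl.

(** * The semigroup and its generator on polynomials *)

Section CoefficientComparison.
Variable R : realType.
Local Notation C := R[i].
Local Notation op := (fock R -> fock R).
Local Notation E := (seq_end R).

(** Letting r tend to 0 gives the constant coefficient; dividing by r then lowers both [N] and
    [K]. *)
Lemma small_sum_coef (d : nat -> C) N K (M : R) :
  (forall r : R, 0 < r -> r <= 1 -> cabs (\sum_(0 <= k < N) d k * r%:C ^+ k) <= M * r ^+ K) ->
  forall k, (k < K)%N -> (k < N)%N -> d k = 0.
Proof.
elim: K N d => [//|K IH] [//|N] d hd.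
pose B := \sum_(0 <= k < N) cabs (d k.+1).
have hq r : 0 < r -> r <= 1 -> cabs (\sum_(0 <= k < N) d k.+1 * r%:C ^+ k) <= B.
  move=> r0 r1; apply: le_trans (cabs_sum _ _ _) _; apply: ler_sum => k _.
  rewrite cabsM cabsX cabs_real ger0_norm ?(ltW r0) // ler_piMr ?cabs_ge0 //.
  by rewrite exprn_ile1 // ltW.
have e (r : R) : \sum_(0 <= k < N.+1) d k * r%:C ^+ k =
    d 0%N + r%:C * \sum_(0 <= k < N) d k.+1 * r%:C ^+ k.
  rewrite big_nat_recl // expr0 mulr1; congr (_ + _); rewrite mulr_sumr.
  by apply: eq_bigr => k _; rewrite exprS mulrCA.
have d0 : d 0%N = 0.
  apply: cabs_le0; apply/ler_addgt0Pr => ep ep0; rewrite add0r.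
  (* At most 1 for the hypothesis to apply, and small enough for |M| r + B r to stay below [ep]. *)
  pose r := Num.min 1 (ep / (`|M| + B + 1)).
  have B0 : 0 <= B by apply: sumr_ge0 => i _; exact: cabs_ge0.
  have S0 : 0 < `|M| + B + 1 by rewrite ltr_wpDl // addr_ge0.
  have r0 : 0 < r by rewrite lt_min ltr01 divr_gt0.
  have r1 : r <= 1 by rewrite ge_min lexx.
  have rS : r * (`|M| + B + 1) <= ep by rewrite -ler_pdivlMr // ge_min lexx orbT.
  have h := hd r r0 r1; rewrite e in h.
  have -> : d 0%N = d 0%N + r%:C * (\sum_(0 <= k < N) d k.+1 * r%:C ^+ k) -
     r%:C * (\sum_(0 <= k < N) d k.+1 * r%:C ^+ k) by rewrite addrK.
  apply: le_trans (cabsB _ _) _.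
  rewrite [X in _ + X]cabsM cabs_real ger0_norm ?(ltW r0) //.
  apply: le_trans (lerD h (ler_wpM2l (ltW r0) (hq _ r0 r1))) _.
  apply: le_trans rS.
  have h1 : M * r ^+ K.+1 <= `|M| * r.
    apply: (@le_trans _ _ (`|M| * r ^+ K.+1)); first by rewrite ler_wpM2r ?exprn_ge0 ?(ltW r0) // ler_norm.
    by rewrite ler_wpM2l // exprS ler_piMr ?(ltW r0) // exprn_ile1 // ltW.
  lra.
case=> [//|k]; rewrite !ltnS => kK kN.
apply: (IH N (fun k => d k.+1)) => // r r0 r1.
have := hd r r0 r1; rewrite e d0 add0r cabsM cabs_real ger0_norm ?(ltW r0) //.
by rewrite exprS mulrCA ler_pM2l.
Qed.

Lemma small_poly_coef (p : {poly C}) K (M : R) :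
  (forall r : R, 0 < r -> r <= 1 -> cabs p.[r%:C] <= M * r ^+ K) ->
  forall k, (k < K)%N -> p`_k = 0.
Proof.
move=> hp k kK; have [kN|Nk] := ltnP k (size p); last by rewrite nth_default.
apply: (@small_sum_coef (fun k => p`_k) (size p) K M) => // r r0 r1.
have := hp r r0 r1; rewrite horner_coef.
by rewrite (big_mkord xpredT (fun i => p`_i * r%:C ^+ i)).
Qed.

(* Taylor coefficients at 0 of r |-> exp(- q r^2). *)
Definition gauss_coef (q : R) (i : nat) : R := if odd i then 0 else (- q) ^+ i./2 / (i./2)`!%:R.

(** Written as a [csum], the exponential has its Taylor remainder bounded by [csum_tail]. *)
Lemma expR_csum (x : R) : csum (fun j => (exp_coeff x j)%:C) = (expR x)%:C.
Proof.
rewrite /csum /=; congr Complex; rewrite (_ : series _ = fun=> 0); first exact: lim_cst.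
by apply/funext => n; rewrite /series /= big1.
Qed.

Lemma gauss_coef_sum (q r : R) J :
  \sum_(0 <= i < J.*2) gauss_coef q i * r ^+ i = \sum_(0 <= j < J) exp_coeff (- (r ^+ 2 * q)) j.
Proof.
elim: J => [|J IH]; first by rewrite !big_nil.
rewrite doubleS !big_nat_recr //= IH /gauss_coef /= odd_double /= mul0r addr0; congr (_ + _).
rewrite doubleK exp_coeffE -mulrN exprMn -exprM -mul2n; ring.
Qed.

Lemma gauss_taylor (q : R) J : exists2 H : R, 0 <= H & forall r : R, 0 <= r -> r <= 1 ->
  `|expR (- (r ^+ 2 * q)) - \sum_(0 <= i < J.*2) gauss_coef q i * r ^+ i| <= H * r ^+ J.*2.
Proof.
have [H H0 hH] := geometric_exp_coeff (normr_ge0 q).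
exists (2 * H); first exact: mulr_ge0.
move=> r r0 r1.
have A0 : 0 <= r ^+ J.*2 * H by rewrite mulr_ge0 ?exprn_ge0.
have hk k : (J <= k)%N -> cabs (exp_coeff (- (r ^+ 2 * q)) k)%:C <= r ^+ J.*2 * H / 2 ^+ k.
  move=> Jk; rewrite cabs_real exp_coeffE normrM normrX normrN normrM [`|_^-1|]ger0_norm ?invr_ge0 //.
  rewrite [`|r ^+ 2|]ger0_norm ?exprn_ge0 // (exprMn k (r ^+ 2)) -exprM.
  rewrite -[X in X <= _]mulrA -[X in _ <= X]mulrA.
  have h1 : r ^+ (2 * k) <= r ^+ J.*2 by apply: ler_wiXn2l => //; rewrite mul2n leq_double.
  have h0 : 0 <= `|q| ^+ k / k`!%:R :> R by rewrite divr_ge0 ?exprn_ge0.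
  exact: ler_pM (exprn_ge0 _ r0) h0 h1 (hH k).
have [_ h] := csum_tail A0 hk.
rewrite expR_csum /series /= in h.
have e : \sum_(0 <= k < J) (exp_coeff (- (r ^+ 2 * q)) k)%:C =
    (\sum_(0 <= i < J.*2) gauss_coef q i * r ^+ i)%:C by rewrite gauss_coef_sum rmorph_sum.
rewrite e -rmorphB cabs_real in h; apply: le_trans h _.
rewrite ler_pdivrMr ?exprn_gt0 //.
have -> : 2 * (r ^+ J.*2 * H) = 2 * H * r ^+ J.*2 by ring.
by rewrite ler_peMr ?mulr_ge0 ?exprn_ge0 // -natrX ler1n expn_gt0.
Qed.

End CoefficientComparison.

(** * Action of the semigroup on powers of field operators *)

Section SemigroupOnPowers.
Variable R : realType.
Local Notation C := R[i].
Local Notation op := (fock R -> fock R).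
Local Notation E := (seq_end R).
Variables (Omega : R) (kappa : C) (u v : 'I_2 -> C) (b s : R) (T U : R -> op -> op).
Hypotheses (b0 : 0 < b) (s0 : 0 <= s) (s1 : s <= 1).
Hypothesis T_gaussian : gaussian_qms Omega kappa 0 u v T.
Hypothesis U_induced : induced_semigroup b s T U.

Let flow := expZ Omega kappa u v.
Let qint := quad_int Omega kappa u v.
Let wd := weighted_decay_exp b0 s0 s1.

Lemma semigroup_linear0 (t : R) : 0 <= t -> U t 0 = 0.
Proof.
move=> t0; have [hU _] := U_induced.
have := csg_linear hU 1 t0 (hilbert_schmidt0 R) (hilbert_schmidt0 R).
rewrite !scale1r addr0 => /eqP; rewrite -subr_eq subrr eq_sym => /eqP; exact.
Qed.

Lemma semigroup_sum (t : R) (c : nat -> C) (X : nat -> op) K : 0 <= t ->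
  (forall k, hilbert_schmidt (X k)) ->
  hilbert_schmidt (\sum_(0 <= k < K) c k *: X k) /\
  U t (\sum_(0 <= k < K) c k *: X k) = \sum_(0 <= k < K) c k *: U t (X k).
Proof.
move=> t0 hX; have [hU _] := U_induced; elim: K => [|K [hs IH]].
  by rewrite !big_nil; split; [exact: hilbert_schmidt0|exact: semigroup_linear0].
rewrite !(big_nat_recr _ _ _ (leq0n K)) /=; move: (\sum_(0 <= k < K) _) (\sum_(0 <= k < K) _) hs IH => S S' hs IH.
rewrite (addrC S) (addrC S'); split; first exact: (hilbert_schmidtD (c K) (hX K) hs).1.
have -> := csg_linear hU (c K) t0 (hX K) hs; by rewrite IH.
Qed.

Lemma op_sumE (c : nat -> C) (X : nat -> op) K x m :
  ((\sum_(0 <= k < K) c k *: X k) x) m = \sum_(0 <= k < K) c k * (X k x) m.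
Proof. by elim: K => [|K IH]; rewrite ?big_nil // !big_nat_recr //= -IH. Qed.

Lemma semigroup_weyl (t r : R) z : 0 <= t ->
  U t (sandwich b s (weyl (r%:C * z))) =
  (expR (- (r ^+ 2 * qint t z)))%:C *: sandwich b s (weyl (r%:C * flow t z)).
Proof.
move=> t0; have [hU ->] := U_induced => //; last exact: weyl_bounded.
case: T_gaussian => _ ->//; rewrite gaussian_factorE quad_int_scale flow_scale.
have bW := weyl_bounded (r%:C * flow t z).
have sl0 : 0 <= s / 2 by rewrite divr_ge0.
have [lS _] := bounded_thermal b0 sl0.
apply/funext => x; rewrite !fctE /sandwich /=.
set y := weyl _ _; have l0 : thermal b (s / 2) 0 = 0.
  have := lS 1 0 0; rewrite !scale1r addr0 => /eqP.
  by rewrite -subr_eq subrr eq_sym => /eqP.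
by rewrite -[X in thermal b (s / 2) X]addr0 lS l0 addr0.
Qed.

(* k! times the coefficient of r^k in exp(- q r^2) exp(r field_op w). *)
Definition hermite_op (q : R) (w : C) (k : nat) : E :=
  \sum_(0 <= i < k.+1) (k`!%:R / (k - i)`!%:R * gauss_coef q i)%:C *: field_op w ^+ (k - i).

Lemma weighted_decay_sum (I : Type) (r : seq I) (F : I -> E) :
  (forall i, weighted_decay b s (F i)) -> weighted_decay b s (\sum_(i <- r) F i).
Proof. by move=> hF; apply: linear_closed_sum => //; exact: weighted_decay_closed. Qed.

Lemma weighted_decay_hermite q w k : weighted_decay b s (hermite_op q w k).
Proof.
apply: weighted_decay_sum => i; apply: linear_closedZ; first exact: weighted_decay_closed.
exact: wd.
Qed.

(** The comparison is made entry by entry, so that only scalar polynomials in r occur: [pa], [pf]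
    and [pe] are Taylor polynomials of [phi], of [psi] and of the Gaussian factor. As [phi] is the
    Gaussian factor times [psi], the polynomial pa - pe pf is O(r^K), and its coefficient of order k
    is the claim. *)
Lemma semigroup_power (t : R) z k : 0 <= t ->
  U t (embed b s (field_op z ^+ k)) = embed b s (hermite_op (qint t z) (flow t z) k).
Proof.
move=> t0; have [hU _] := U_induced.
have hsA w j : hilbert_schmidt (embed b s (field_op w ^+ j)) by case: (embedP b0 (wd w j)).
have [hsH eH] := embedP b0 (weighted_decay_hermite (qint t z) (flow t z) k).
have hsU := csg_hs hU t0 (hsA z k).
apply: bounded_op_ext; [by case: hsU|by case: hsH|move=> n m].
set q := qint t z in eH *; set w := flow t z in eH *.
(* Above k, and even because [gauss_taylor] is stated at even orders. *)
pose K := k.+1.*2.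
pose a j := (U t (embed b s (field_op z ^+ j)) (ebasis R n)) m.
pose f j := (embed b s (field_op w ^+ j) (ebasis R n)) m.
pose pa : {poly C} := \poly_(j < K) (a j / j`!%:R).
pose pf : {poly C} := \poly_(j < K) (f j / j`!%:R).
pose pe : {poly C} := \poly_(i < K) (gauss_coef q i)%:C.
have hornerE' (c : nat -> C) (r : R) : (\poly_(j < K) c j).[r%:C] = \sum_(0 <= j < K) c j * r%:C ^+ j.
  by rewrite horner_poly (big_mkord xpredT (fun j => c j * r%:C ^+ j)).
have [H1 H10 hH1] := weyl_expansion b0 s0 s1 z.
have [H2 H20 hH2] := weyl_expansion b0 s0 s1 w.
have [H3 H30 hH3] := gauss_taylor q k.+1.
pose phi (r : R) := (U t (sandwich b s (weyl (r%:C * z))) (ebasis R n)) m.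
pose psi (r : R) := (sandwich b s (weyl (r%:C * w)) (ebasis R n)) m.
have B1 r : 0 <= r -> r <= 1 -> cabs (phi r - pa.[r%:C]) <= H1 * r ^+ K.
  move=> r0 r1; have [hs hle] := hH1 r K r0 r1.
  have [hsS US] := semigroup_sum (fun j => (r ^+ j / j`!%:R)%:C) K t0 (hsA z).
  have hsF : hilbert_schmidt (sandwich b s (weyl (r%:C * z))).
    have := (hilbert_schmidtD 1 hs hsS).1; rewrite scale1r subrK; exact.
  have UE : U t (sandwich b s (weyl (r%:C * z)) -
     \sum_(0 <= j < K) (r ^+ j / j`!%:R)%:C *: embed b s (field_op z ^+ j)) =
     U t (sandwich b s (weyl (r%:C * z))) -
     \sum_(0 <= j < K) (r ^+ j / j`!%:R)%:C *: U t (embed b s (field_op z ^+ j)).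
    by rewrite -scaleN1r addrC (csg_linear hU _ t0 hsS hsF) US scaleN1r addrC.
  have -> : phi r - pa.[r%:C] = (U t (sandwich b s (weyl (r%:C * z)) -
     \sum_(0 <= j < K) (r ^+ j / j`!%:R)%:C *: embed b s (field_op z ^+ j)) (ebasis R n)) m.
    rewrite UE; have -> : forall X Y : op, ((X - Y) (ebasis R n)) m = (X (ebasis R n)) m - (Y (ebasis R n)) m by [].
    congr (_ - _); rewrite hornerE' op_sumE; apply: eq_bigr => j _.
    by rewrite -/(a j) rmorphM /= fmorphV rmorph_nat rmorphXn; ring.
  apply: le_trans (cabs_le_hsnorm n m (csg_hs hU t0 hs)) _.
  exact: le_trans (csg_contraction hU t0 hs) hle.
have B2 r : 0 <= r -> r <= 1 -> cabs (psi r - pf.[r%:C]) <= H2 * r ^+ K.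
  move=> r0 r1; have [hs hle] := hH2 r K r0 r1.
  have -> : psi r - pf.[r%:C] = ((sandwich b s (weyl (r%:C * w)) -
     \sum_(0 <= j < K) (r ^+ j / j`!%:R)%:C *: embed b s (field_op w ^+ j)) (ebasis R n)) m.
    have -> : forall X Y : op, ((X - Y) (ebasis R n)) m = (X (ebasis R n)) m - (Y (ebasis R n)) m by [].
    congr (_ - _); rewrite hornerE' op_sumE; apply: eq_bigr => j _.
    by rewrite -/(f j) rmorphM /= fmorphV rmorph_nat rmorphXn; ring.
  exact: le_trans (cabs_le_hsnorm n m hs) hle.
have B3 (r : R) : 0 <= r -> r <= 1 -> cabs ((expR (- (r ^+ 2 * q)))%:C - pe.[r%:C]) <= H3 * r ^+ K.
  move=> r0 r1; rewrite hornerE'.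
  have -> : \sum_(0 <= j < K) (gauss_coef q j)%:C * r%:C ^+ j =
     (\sum_(0 <= j < K) gauss_coef q j * r ^+ j)%:C.
    by rewrite rmorph_sum; apply: eq_bigr => j _; rewrite rmorphM rmorphXn.
  by rewrite -rmorphB cabs_real; exact: hH3.
have phiE r : phi r = (expR (- (r ^+ 2 * q)))%:C * psi r.
  by rewrite /phi semigroup_weyl.
pose B := \sum_(0 <= j < K) cabs (f j / j`!%:R).
have Bf (r : R) : 0 <= r -> r <= 1 -> cabs pf.[r%:C] <= B.
  move=> r0 r1; rewrite hornerE'; apply: le_trans (cabs_sum _ _ _) _; apply: ler_sum => j _.
  rewrite cabsM cabsX cabs_real ger0_norm // ler_piMr ?cabs_ge0 // exprn_ile1 //.
have small (r : R) : 0 < r -> r <= 1 -> cabs (pa - pe * pf).[r%:C] <=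
    (H1 + expR `|q| * H2 + H3 * B) * r ^+ K.
  move=> r0 r1; have r0' := ltW r0.
  rewrite hornerD hornerN hornerM.
  set g := (expR (- (r ^+ 2 * q)))%:C.
  have -> : pa.[r%:C] - pe.[r%:C] * pf.[r%:C] = - (phi r - pa.[r%:C])
     + (g * (psi r - pf.[r%:C]) + (g - pe.[r%:C]) * pf.[r%:C]) by rewrite phiE /g; ring.
  apply: le_trans (cabsD _ _) _; rewrite cabsN [X in _ <= X]mulrDl [X in _ <= X + _]mulrDl -[X in _ <= X]addrA.
  apply: lerD; first exact: B1.
  apply: le_trans (cabsD _ _) _; rewrite !(cabsM g) (cabsM (g - _)); apply: lerD.
    rewrite -mulrA ler_pM ?cabs_ge0 //; last exact: B2.
    rewrite cabs_real ger0_norm ?expR_ge0 // ler_expR.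
    apply: le_trans (ler_norm _) _; rewrite normrN normrM ler_piMl //.
    by rewrite ger0_norm ?exprn_ge0 // exprn_ile1.
  by rewrite mulrAC ler_pM ?cabs_ge0 // ?B3 ?Bf.
have kK : (k < K)%N by rewrite /K; lia.
have := small_poly_coef small kK.
rewrite coefB coefM coef_poly kK => /eqP; rewrite subr_eq0 => /eqP h.
have k0 : k`!%:R != 0 :> C by rewrite pnatr_eq0 -lt0n fact_gt0.
rewrite -/(a k) -[a k](divfK k0) h eH mulr_suml /hermite_op.
have ent_sum (F : nat -> E) N : entry (\sum_(0 <= i < N) F i) m n = \sum_(0 <= i < N) entry (F i) m n.
  by elim: N => [|N IH]; rewrite ?big_nil // !big_nat_recr //= -IH.
rewrite ent_sum mulr_sumr (big_mkord xpredT).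
apply: eq_bigr => i _; have iK : (i < K)%N by rewrite (leq_ltn_trans _ kK) // -ltnS.
have kiK : (k - i < K)%N by rewrite (leq_ltn_trans (leq_subr _ _)).
rewrite !coef_poly iK kiK entryZ /f (embedP b0 (wd w (k - i))).2.
move: ((wt b s m n)%:C) (entry _ m n) (gauss_coef q i) => x y g.
by rewrite !rmorphM /= fmorphV !rmorph_nat; ring.
Qed.

End SemigroupOnPowers.

(** * Polynomials in a and a^+ and their limits *)

Section PolynomialFamilies.
Variable R : realType.
Local Notation C := R[i].
Local Notation op := (fock R -> fock R).
Local Notation E := (seq_end R).
Implicit Types (p q : E) (c : R -> C).

(** With the values 1 and i every P + w Q, w natural, is again a field operator, as polarization
    requires. *)
Definition quad_P : E := field_op (1 : C).
Definition quad_Q : E := field_op ('i : C).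

Lemma quad_PE : quad_P = Cre R - Ann R.
Proof. by rewrite /quad_P /field_op rmorph1 !scale1r. Qed.

Lemma conj_i : ('i : C)^* = - 'i.
Proof. by rewrite -[LHS]/(conjc _) /conjc; apply/eqP; rewrite eq_complex /= oppr0 !eqxx. Qed.

Lemma quad_QE : quad_Q = ('i : C) *: (Cre R + Ann R).
Proof. by rewrite /quad_Q /field_op conj_i scaleNr opprK scalerDr. Qed.

Lemma ad_quad : ad quad_Q quad_P = (2 * 'i : C)%:A.
Proof.
rewrite quad_PE quad_QE adZl linearB /= !adDl !adxx ad_Ann_Cre ad_Cre_Ann add0r addr0.
by rewrite scaleN1r opprK scalerDr -scalerDl; congr (_ *: _); ring.
Qed.

Definition polynomial p := poly_in quad_P quad_Q p.

Lemma quad_sum (w : nat) : quad_P + (w%:R : C) *: quad_Q = field_op (1 + w%:R * 'i).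
Proof.
rewrite /quad_P /quad_Q /field_op conjD conjM conj_nat rmorph1 conj_i !scalerDl !scalerBr !scalerA.
by rewrite opprD addrACA.
Qed.

(** The link between algebra and analysis: Weyl expansions reach powers of field operators only, and
    linearity carries the rest. *)
Lemma polynomial_ind (V : E -> Prop) : linear_closed V ->
  (forall z k, V (field_op z ^+ k)) -> forall p, polynomial p -> V p.
Proof.
move=> hV hz; apply: (poly_in_span ad_quad hV) => w k.
by rewrite quad_sum; exact: hz.
Qed.

Lemma polynomial_Cre : polynomial (Cre R).
Proof.
have -> : Cre R = (2^-1 : C) *: (quad_P + (- 'i : C) *: quad_Q).
  rewrite quad_PE quad_QE scalerA mulNr -expr2 sqr_i opprK scale1r.
  by rewrite addrACA addNr addr0 -mulr2n -[Cre R *+ 2]scaler_nat scalerA mulVf ?scale1r // pnatr_eq0.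
apply: poly_inZ; apply: poly_inD; first exact: poly_inP.
by apply: poly_inZ; exact: poly_inQ.
Qed.

Lemma polynomial_Ann : polynomial (Ann R).
Proof.
have -> : Ann R = Cre R + (- 1 : C) *: quad_P by rewrite quad_PE scaleN1r opprB addrC subrK.
by apply: poly_inD; [exact: polynomial_Cre|apply: poly_inZ; exact: poly_inP].
Qed.

Lemma polynomial_field_op z : polynomial (field_op z).
Proof.
rewrite /field_op -scaleNr; apply: poly_inD; apply: poly_inZ.
  exact: polynomial_Cre.
exact: polynomial_Ann.
Qed.

Lemma polynomial_ad l p : polynomial l -> polynomial p -> polynomial (ad l p).
Proof.
by move=> hl hp; rewrite adE -scaleN1r; apply: poly_inD; [|apply: poly_inZ]; exact: poly_inM.
Qed.

Definition ccvg c (l : C) := cabs (c t - l) @[t --> 0^'+] --> (0 : R).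

Lemma ccvg_cst l : ccvg (fun=> l) l.
Proof. by rewrite /ccvg subrr cabs0; exact: cvg_cst. Qed.

Lemma ccvg_le c l (f : R -> R) : (\forall t \near 0^'+, cabs (c t - l) <= f t) ->
  f t @[t --> 0^'+] --> (0 : R) -> ccvg c l.
Proof.
move=> h hf; apply: (squeeze_cvgr _ (cvg_cst 0) hf).
by near=> t; rewrite cabs_ge0 /=; near: t.
Unshelve. all: by end_near.
Qed.

Lemma ccvgD c c' l l' : ccvg c l -> ccvg c' l' -> ccvg (fun t => c t + c' t) (l + l').
Proof.
move=> h h'; have : cabs (c t - l) + cabs (c' t - l') @[t --> 0^'+] --> (0 + 0 : R) by exact: cvgD.
rewrite addr0; apply: ccvg_le; near=> t.
by rewrite opprD addrACA cabsD.
Unshelve. all: by end_near.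
Qed.

Lemma ccvgM c c' l l' : ccvg c l -> ccvg c' l' -> ccvg (fun t => c t * c' t) (l * l').
Proof.
move=> h h'.
have : cabs (c t - l) * cabs (c' t - l') + (cabs (c t - l) * cabs l' + cabs l * cabs (c' t - l'))
    @[t --> 0^'+] --> (0 * 0 + (0 * cabs l' + cabs l * 0) : R).
  by apply: cvgD; [exact: cvgM|apply: cvgD; apply: cvgM => //; exact: cvg_cst].
rewrite !(mul0r, mulr0, addr0); apply: ccvg_le; near=> t.
have -> : c t * c' t - l * l' = (c t - l) * (c' t - l') + ((c t - l) * l' + l * (c' t - l')) by ring.
apply: le_trans (cabsD _ _) _; rewrite cabsM lerD2l.
by apply: le_trans (cabsD _ _) _; rewrite !cabsM.
Unshelve. all: by end_near.
Qed.

Lemma ccvg_conj c l : ccvg c l -> ccvg (fun t => (c t)^*) l^*.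
Proof.
by rewrite /ccvg => h; under eq_fun do rewrite -rmorphB cabs_conj.
Qed.

(* Convergence as t -> 0+ of polynomials of bounded degree, coefficient by coefficient. *)
Inductive poly_cvg : (R -> E) -> E -> Prop :=
| poly_cvg0 : poly_cvg (fun=> 0) 0
| poly_cvgS c l q P p : ccvg c l -> polynomial q -> poly_cvg P p ->
    poly_cvg (fun t => c t *: q + P t) (l *: q + p).

Lemma poly_cvg_eq P P' p p' : (forall t, P t = P' t) -> p = p' -> poly_cvg P p -> poly_cvg P' p'.
Proof. by move=> h <-; have -> : P = P' by apply/funext. Qed.

Lemma poly_cvg_const p : polynomial p -> poly_cvg (fun=> p) p.
Proof.
move=> hp; apply: poly_cvg_eq (poly_cvgS (ccvg_cst 1) hp poly_cvg0) => [t|].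
  by rewrite scale1r addr0.
by rewrite scale1r addr0.
Qed.

Lemma poly_cvgD P P' p p' : poly_cvg P p -> poly_cvg P' p' -> poly_cvg (fun t => P t + P' t) (p + p').
Proof.
move=> hP hP'; elim: hP => [|c l q Q r hc hq _ IH].
  by apply: poly_cvg_eq hP' => [t|]; rewrite add0r.
by apply: poly_cvg_eq (poly_cvgS hc hq IH) => [t|]; rewrite addrA.
Qed.

Lemma poly_cvgZ c l P p : ccvg c l -> poly_cvg P p -> poly_cvg (fun t => c t *: P t) (l *: p).
Proof.
move=> hc; elim=> [|d m q Q r hd hq _ IH].
  by apply: poly_cvg_eq poly_cvg0 => [t|]; rewrite scaler0.
by apply: poly_cvg_eq (poly_cvgS (ccvgM hc hd) hq IH) => [t|]; rewrite scalerDr scalerA.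
Qed.

Lemma poly_cvg_mull P p q : polynomial q -> poly_cvg P p -> poly_cvg (fun t => q * P t) (q * p).
Proof.
move=> hq; elim=> [|d m r Q p' hd hr _ IH].
  by apply: poly_cvg_eq poly_cvg0 => [t|]; rewrite mulr0.
apply: poly_cvg_eq (poly_cvgS hd (poly_inM hq hr) IH) => [t|]; by rewrite mulrDr scalerAr.
Qed.

Lemma poly_cvgM P P' p p' : poly_cvg P p -> poly_cvg P' p' -> poly_cvg (fun t => P t * P' t) (p * p').
Proof.
move=> hP hP'; elim: hP => [|c l q Q r hc hq _ IH].
  by apply: poly_cvg_eq poly_cvg0 => [t|]; rewrite mul0r.
apply: poly_cvg_eq (poly_cvgD (poly_cvgZ hc (poly_cvg_mull hq hP')) IH) => [t|];
  by rewrite mulrDl scalerAl.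
Qed.

Lemma poly_cvgX P p k : poly_cvg P p -> poly_cvg (fun t => P t ^+ k) (p ^+ k).
Proof.
move=> hP; elim: k => [|k IH].
  by apply: poly_cvg_eq (poly_cvg_const (poly_in1 quad_P quad_Q)) => [t|]; rewrite expr0.
by apply: poly_cvg_eq (poly_cvgM hP IH) => [t|]; rewrite exprS.
Qed.

Lemma poly_cvg_sum (I : Type) (r : seq I) (P : I -> R -> E) (p : I -> E) :
  (forall i, poly_cvg (P i) (p i)) -> poly_cvg (fun t => \sum_(i <- r) P i t) (\sum_(i <- r) p i).
Proof.
move=> h; elim: r => [|i r IH].
  by apply: poly_cvg_eq poly_cvg0 => [t|]; rewrite big_nil.
by apply: poly_cvg_eq (poly_cvgD (h i) IH) => [t|]; rewrite big_cons.
Qed.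

Lemma poly_cvg_polynomial P p : poly_cvg P p -> (forall t, polynomial (P t)) /\ polynomial p.
Proof.
have p0 : polynomial 0 by case: (poly_in_closed quad_P quad_Q).
elim=> [//|c l q Q r _ hq _ [IH1 IH2]]; split => [t|]; (apply: poly_inD; first exact: poly_inZ); [exact: IH1|exact: IH2].
Qed.

(** The product rule in the form A^(k+1) - a^(k+1) = (A - a) A^k + a (A^k - a^k), which matches the
    recursion of [dpow]. *)
Lemma poly_cvg_dpow (A : R -> E) (a a' : E) k : polynomial a -> poly_cvg A a ->
  poly_cvg (fun t => (t^-1)%:C *: (A t - a)) a' ->
  poly_cvg (fun t => (t^-1)%:C *: (A t ^+ k - a ^+ k)) (dpow a a' k).
Proof.
move=> ha hA hD; elim: k => [|k IH].
  by apply: poly_cvg_eq poly_cvg0 => [t|] //; rewrite !expr0 subrr scaler0.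
apply: poly_cvg_eq (poly_cvgD (poly_cvgM hD (poly_cvgX k hA)) (poly_cvg_mull ha IH)) => [t|//].
rewrite -scalerAl -scalerAr -scalerDr !exprS mulrBl mulrBr; congr (_ *: _).
by rewrite addrA subrK.
Qed.

Variables (b s : R).
Hypotheses (b0 : 0 < b) (s0 : 0 <= s) (s1 : s <= 1).

Lemma polynomial_decay p : polynomial p -> weighted_decay b s p.
Proof.
by apply: polynomial_ind; [exact: weighted_decay_closed|exact: weighted_decay_exp].
Qed.

Lemma embed_hs p : polynomial p -> hilbert_schmidt (embed b s p).
Proof. by move/polynomial_decay/(embedP b0) => []. Qed.

Lemma embed_lin k p q : polynomial p -> polynomial q ->
  embed b s (k *: p + q : E) = k *: embed b s p + embed b s q.
Proof. by move=> hp hq; apply: embed_linear => //; exact: polynomial_decay. Qed.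

Lemma polynomial0 : polynomial 0.
Proof. by case: (poly_in_closed quad_P quad_Q). Qed.

Lemma embedZ k p : polynomial p -> embed b s (k *: p : E) = k *: embed b s p.
Proof.
move=> hp; rewrite -[k *: p]addr0 embed_lin //; last exact: polynomial0.
by rewrite embed0 // addr0.
Qed.

Lemma embedB p q : polynomial p -> polynomial q ->
  embed b s (p - q : E) = embed b s p - embed b s q.
Proof. by move=> hp hq; rewrite -scaleN1r addrC embed_lin // scaleN1r addrC. Qed.

(** The family stays in the span of finitely many fixed polynomials, so convergence of coefficients
    suffices. Squares appear because [hilbert_schmidtD] bounds the square of the norm. *)
Lemma poly_cvg_embed P p : poly_cvg P p ->
  hsnorm (embed b s (P t) - embed b s p) ^+ 2 @[t --> 0^'+] --> (0 : R).
Proof.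
elim=> [|c l q Q r hc hq hQ IH].
  rewrite subrr; have -> : hsnorm (0 : op) = 0.
    apply/eqP; rewrite -sqrf_eq0 eq_le sqr_ge0 andbT.
    apply: hsnorm_sq_le => [|N]; first exact: hilbert_schmidt0.
    rewrite big1 // => n _; apply/eqP; rewrite eq_le sqr_ge0 andbT.
    by apply: fnorm_sq_le => K; rewrite big1 // => i _; rewrite fock0E sqmod0.
  by rewrite expr0n; exact: cvg_cst.
have [hQt hr] := poly_cvg_polynomial hQ.
have h0 : 2 * (cabs (c t - l) * cabs (c t - l) * hsnorm (embed b s q) ^+ 2)
    + 2 * hsnorm (embed b s (Q t) - embed b s r) ^+ 2
    @[t --> 0^'+] --> (2 * (0 * 0 * hsnorm (embed b s q) ^+ 2) + 2 * 0 : R).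
  apply: cvgD; apply: cvgM => //; try exact: cvg_cst.
  by apply: cvgM; [exact: cvgM|exact: cvg_cst].
rewrite !(mul0r, mulr0, addr0) in h0.
apply: (squeeze_cvgr _ (cvg_cst 0) h0); near=> t; rewrite sqr_ge0 /=.
have -> : embed b s (c t *: q + Q t : E) - embed b s (l *: q + r : E) =
    (c t - l) *: embed b s q + (embed b s (Q t) - embed b s r).
  by rewrite !embed_lin // scalerBl opprD addrACA.
rewrite -expr2.
have hB := hilbert_schmidtB (embed_hs (hQt t)) (embed_hs hr).
exact: (hilbert_schmidtD (c t - l) (embed_hs hq) hB).2.
Unshelve. all: by end_near.
Qed.

End PolynomialFamilies.

#[local] Opaque hilbert_schmidt hsnorm bounded_op.

(** * Generators of contraction semigroups *)

Section Generators.
Variable R : realType.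
Local Notation C := R[i].
Local Notation op := (fock R -> fock R).
Local Notation E := (seq_end R).
Variable U : R -> op -> op.
Hypothesis hU : contraction_semigroup U.

Lemma hsnorm_sq_cvg (X : R -> op) : hsnorm (X t) ^+ 2 @[t --> 0^'+] --> (0 : R) ->
  hsnorm (X t) @[t --> 0^'+] --> (0 : R).
Proof.
move=> /cvgrPdist_le h; apply/cvgrPdist_le => e e0.
have := h (e ^+ 2); rewrite exprn_gt0 // => /(_ isT) {}h; near=> t.
rewrite sub0r normrN ger0_norm ?hsnorm_ge0 //.
rewrite -(@ler_pXn2r _ 2) ?nnegrE ?hsnorm_ge0 ?(ltW e0) //.
have : `|0 - hsnorm (X t) ^+ 2| <= e ^+ 2 by near: t.
by rewrite sub0r normrN ger0_norm ?sqr_ge0.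
Unshelve. all: by end_near.
Qed.

Lemma sq_cvg0 (f : R -> R) : f t @[t --> 0^'+] --> (0 : R) ->
  f t ^+ 2 @[t --> 0^'+] --> (0 : R).
Proof.
move=> h; have : f t * f t @[t --> 0^'+] --> (0 * 0 : R) by exact: cvgM.
by rewrite mulr0 => h2; under eq_fun do rewrite expr2.
Qed.

Lemma cvg_comb0 (f g : R -> R) (x : R) : f t @[t --> 0^'+] --> (0 : R) ->
  g t @[t --> 0^'+] --> (0 : R) -> 2 * (x * f t) + 2 * g t @[t --> 0^'+] --> (0 : R).
Proof.
move=> hf hg; have : 2 * (x * f t) + 2 * g t @[t --> 0^'+] --> (2 * (x * 0) + 2 * 0 : R).
  by apply: cvgD; apply: cvgM => //; try exact: cvg_cst; apply: cvgM => //; exact: cvg_cst.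
by rewrite !mulr0 addr0.
Qed.

Lemma hsnorm_comb_cvg (c : C) (X Y : R -> op) :
  (\forall t \near 0^'+, hilbert_schmidt (X t)) -> (\forall t \near 0^'+, hilbert_schmidt (Y t)) ->
  hsnorm (X t) @[t --> 0^'+] --> (0 : R) -> hsnorm (Y t) @[t --> 0^'+] --> (0 : R) ->
  hsnorm (c *: X t + Y t) @[t --> 0^'+] --> (0 : R).
Proof.
move=> hX hY cX cY; apply: (@hsnorm_sq_cvg (fun t => c *: X t + Y t)).
apply: (squeeze_cvgr _ (cvg_cst 0) (cvg_comb0 (cabs c ^+ 2) (sq_cvg0 cX) (sq_cvg0 cY))).
apply: filterS2 hX hY => t hXt hYt; rewrite sqr_ge0.
exact: (hilbert_schmidtD c hXt hYt).2.
Qed.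

Definition slope (X : op) (t : R) : op := (t^-1)%:C *: (U t X - X).

Lemma slope_hs X t : 0 <= t -> hilbert_schmidt X -> hilbert_schmidt (slope X t).
Proof.
move=> t0 hX; apply: hilbert_schmidtZ; exact: hilbert_schmidtB (csg_hs hU t0 hX) hX.
Qed.

Lemma slope_near X Y : hilbert_schmidt X -> hilbert_schmidt Y ->
  \forall t \near 0^'+, hilbert_schmidt (slope X t - Y).
Proof.
move=> hX hY; apply: filterS (nbhs_right_ge 0) => t t0.
exact: hilbert_schmidtB (slope_hs t0 hX) hY.
Qed.

Lemma generator_lin (c : C) X X' Y Y' : generator U X Y -> generator U X' Y' ->
  generator U (c *: X + X') (c *: Y + Y').
Proof.
move=> [hX hY cX] [hX' hY' cX']; split; try exact: (hilbert_schmidtD _ _ _).1.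
have h := hsnorm_comb_cvg c (slope_near hX hY) (slope_near hX' hY') cX cX'.
apply: cvg_trans h; apply: near_eq_cvg; near=> t.
have t0 : 0 <= t by near: t; exact: nbhs_right_ge.
congr hsnorm; rewrite /slope (csg_linear hU c t0 hX hX').
have e1 : (t^-1)%:C *: ((c *: U t X + U t X') - (c *: X + X')) =
    c *: ((t^-1)%:C *: (U t X - X)) + (t^-1)%:C *: (U t X' - X').
  by rewrite opprD addrACA -scalerBr scalerDr !scalerA mulrC.
by rewrite e1 opprD addrACA -scalerBr.
Unshelve. all: by end_near.
Qed.

Lemma generator_unique X Y Y' : generator U X Y -> generator U X Y' -> Y = Y'.
Proof.
move=> [hX hY cY] [_ hY' cY'].
have hYY : hilbert_schmidt (Y - Y') by exact: hilbert_schmidtB.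
have := hsnorm_comb_cvg (-1) (slope_near hX hY) (slope_near hX hY') cY cY'.
have e t : -1 *: (slope X t - Y) + (slope X t - Y') = Y - Y'.
  by rewrite scaleN1r opprB addrA subrK.
under eq_fun do rewrite e.
move=> /(cvg_unique (@norm_hausdorff _ _) (cvg_cst _)) h0.
have e0 : Y - Y' = 0.
  apply: bounded_op_ext; [exact: hs_bounded_op|exact: bounded_op0|].
  move=> n m; have := cabs_le_hsnorm n m hYY; rewrite h0 => /cabs_le0 ->.
  by [].
by apply/eqP; rewrite -subr_eq0 e0.
Qed.

End Generators.

(** * The generator on polynomials *)

Section GaussianGenerator.
Variable R : realType.
Local Notation C := R[i].
Local Notation op := (fock R -> fock R).
Local Notation E := (seq_end R).
Variables (Omega : R) (kappa : C) (u v : 'I_2 -> C) (b s : R) (T U : R -> op -> op).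
Hypotheses (b0 : 0 < b) (s0 : 0 <= s) (s1 : s <= 1).
Hypothesis T_gaussian : gaussian_qms Omega kappa 0 u v T.
Hypothesis U_induced : induced_semigroup b s T U.

Let w : C := 'i * Omega%:C - (gamma u v)%:C.
Let d : C := (\sum_(l < 2) (sqmod (u l) + sqmod (v l)))%:C.
Let tau : C := \sum_(l < 2) v l * u l.
Let ik : C := 'i * kappa.

(* The first-order coefficients reproduce [Zmap], the second-order ones are then
   fixed by the carre du champ [- Re (z^* Cmap z)] read off [gaussian_factor]. *)
Definition drift_gen : E -> E :=
  quad_gen (Ann R) (Cre R) (- ik^*) w (- w^*) ik
    ((ik^* - tau^*) / 2) ((w^* - w - d) / 2) ((- tau - ik) / 2).

Lemma drift_gen_linear : linear drift_gen.
Proof. exact: quad_gen_linear. Qed.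

Lemma polynomial_drift_gen p : polynomial p -> polynomial (drift_gen p).
Proof.
move=> hp; have hA := polynomial_Ann R; have hC := polynomial_Cre R.
rewrite /drift_gen /quad_gen.
have hlin (k k' : C) : polynomial (k *: Ann R + k' *: Cre R) by apply: poly_inD; exact: poly_inZ.
have hac := polynomial_ad hA hp; have hcc := polynomial_ad hC hp.
apply: poly_inD.
  by apply: poly_inD; [exact: poly_inM (hlin _ _) hac|exact: poly_inM (hlin _ _) hcc].
by apply: poly_inD; [apply: poly_inD|]; apply: poly_inZ; exact: polynomial_ad.
Qed.

Lemma ad_Ann_field_op z : ad (Ann R) (field_op z) = z%:A.
Proof.
by rewrite /field_op adBr !adZr ad_Ann_Cre adxx scaler0 subr0.
Qed.

Lemma ad_Cre_field_op z : ad (Cre R) (field_op z) = (z^*)%:A.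
Proof.
by rewrite /field_op adBr !adZr ad_Cre_Ann adxx scaler0 sub0r scaleN1r scalerN opprK.
Qed.

(** On field operators only the derivative of the flow is seen, as the second-order part vanishes on
    scalars. *)
Lemma drift_gen_field_op z : drift_gen (field_op z) = field_op (Zmap Omega kappa u v z).
Proof.
rewrite /drift_gen (quad_genX _ _ _ _ _ _ _ (ad_Ann_field_op z) (ad_Cre_field_op z)).
rewrite !scalerDr !scalerA addrACA -!scalerDl addrC /field_op -scaleNr.
congr (_ *: _ + _ *: _); first by rewrite /Zmap /w /ik; ring.
have -> : (Zmap Omega kappa u v z)^* = w^* * z^* + ik^* * z.
  by rewrite /Zmap conjD !conjM conjCK.
ring.
Qed.

(** The right side is - 2 times the time derivative of [quad_int] at 0: the coefficient of r^2
    enters the k-th Hermite operator with k (k - 1), whereas [quad_gen_exp] counts each pair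
    once. *)
Lemma carre_du_champ z :
  carre1 (- ik^*) w ((ik^* - tau^*) / 2) ((w^* - w - d) / 2) z z^* * z
  + carre2 (- w^*) ik ((w^* - w - d) / 2) ((- tau - ik) / 2) z z^* * z^*
  = - (complex.Re (z^* * Cmap u v z))%:C.
Proof.
have CE : Cmap u v z = d * z + 2 * tau * z^*.
  rewrite /Cmap /d /tau rmorph_sum /= mulr_suml mulr_sumr mulr_suml -big_split.
  by apply: eq_bigr => l _ /=; rewrite !mulrA.
have dc : d^* = d by exact: conj_real.
have ReE (y : C) : (complex.Re y)%:C = (y + y^*) / 2 by exact: ReJ_add.
rewrite ReE CE /carre1 /carre2.
have -> : (z^* * (d * z + 2 * tau * z^*))^* = z * (d * z^* + 2 * tau^* * z).
  by rewrite conjM conjD !conjM dc !conjCK (conj_nat R 2).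
have h2 : (2 : C) != 0 by rewrite pnatr_eq0.
move: (z^*) (w^*) (tau^*) (ik^*) => z' w' tau' ik'.
by field.
Qed.

Let wd := weighted_decay_exp b0 s0 s1.

Lemma cvg_right_id (K : R) : K * t @[t --> 0^'+] --> (0 : R).
Proof.
have : K * t @[t --> (0:R)^'+] --> (K * 0 : R).
  by apply: cvgM; [exact: cvg_cst|apply: cvg_at_right_filter; exact: cvg_id].
by rewrite mulr0.
Qed.

Lemma ccvg_right (c : R -> C) (l : C) (K : R) :
  (forall t, 0 < t -> t <= 1 -> cabs (c t - l) <= K * t) -> ccvg c l.
Proof.
move=> h; apply: ccvg_le (cvg_right_id K); near=> t; apply: h.
  by near: t; exact: nbhs_right_gt.
by near: t; exact: nbhs_right_le.
Unshelve. all: by end_near.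
Qed.

Let qint := quad_int Omega kappa u v.
Let flow := expZ Omega kappa u v.

Lemma ccvg_flow_slope z :
  ccvg (fun t => (t^-1)%:C * (flow t z - z)) (Zmap Omega kappa u v z).
Proof.
have [K K0 hK] := flow_near0 Omega kappa u v.
apply: (@ccvg_right _ _ (K * cabs z)) => t t0 t1; have := hK t z (ltW t0) t1.
set Zz := Zmap _ _ _ _ z.
have tC : (t%:C : C) != 0 by rewrite fmorph_eq0 gt_eqF.
have -> : (t^-1)%:C * (flow t z - z) - Zz = (t^-1)%:C * (flow t z - (z + t%:C * Zz)).
  by rewrite fmorphV; field.
rewrite cabsM cabs_real ger0_norm ?invr_ge0 ?(ltW t0) // => h.
have := ler_wpM2l (_ : 0 <= t^-1) h; rewrite invr_ge0 (ltW t0) => /(_ isT) h'.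
apply: le_trans h' _; rewrite expr2 mulrC -!mulrA mulfV ?gt_eqF // mulr1; exact: lexx.
Qed.

Lemma ccvg_flow z : ccvg (flow ^~ z) z.
Proof.
have := ccvgD (ccvg_cst z) (ccvgM (ccvg_right (K := 1) (c := fun t => t%:C) (l := 0) _)
  (ccvg_flow_slope z)).
rewrite mul0r addr0 => h.
have {}h : ccvg (fun t => z + t%:C * ((t^-1)%:C * (flow t z - z))) z.
  by apply: h => t t0 _; rewrite subr0 cabs_real ger0_norm ?mul1r ?(ltW t0).
apply: cvg_trans h; apply: near_eq_cvg; near=> t.
have t0 : t != 0 by rewrite gt_eqF //; near: t; exact: nbhs_right_gt.
have tC : (t%:C : C) != 0 by rewrite fmorph_eq0.
by rewrite fmorphV mulVKf // [z + (_ - _)]addrC subrK.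
Unshelve. all: by end_near.
Qed.

Let q1 z : R := 2^-1 * complex.Re (z^* * Cmap u v z).

Lemma ccvg_qint_slope z : ccvg (fun t => (t^-1 * qint t z)%:C) (q1 z)%:C.
Proof.
have [K K0 hK] := quad_int_near0 Omega kappa u v z.
apply: (@ccvg_right _ _ K) => t t0 t1; rewrite -rmorphB cabs_real.
have := hK t (ltW t0) t1; rewrite -/(q1 z) -/(qint t z) => h.
have -> : t^-1 * qint t z - q1 z = t^-1 * (qint t z - t * q1 z) by field; rewrite gt_eqF.
rewrite normrM ger0_norm ?invr_ge0 ?(ltW t0) // ler_pdivrMl //.
by apply: le_trans h _; rewrite expr2 mulrCA.
Qed.

Lemma ccvg_qint z : ccvg (fun t => (qint t z)%:C) 0.
Proof.
have := ccvgM (ccvg_right (K := 1) (c := fun t => t%:C) (l := 0) _) (ccvg_qint_slope z).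
rewrite mul0r => h.
have {}h : ccvg (fun t => t%:C * (t^-1 * qint t z)%:C) 0.
  by apply: h => t t0 _; rewrite subr0 cabs_real ger0_norm ?mul1r ?(ltW t0).
apply: cvg_trans h; apply: near_eq_cvg; near=> t.
have t0 : t != 0 by rewrite gt_eqF //; near: t; exact: nbhs_right_gt.
by rewrite -rmorphM mulrA mulfV // mul1r.
Unshelve. all: by end_near.
Qed.

Lemma ccvg_exp (c : R -> C) (l : C) k : ccvg c l -> ccvg (fun t => c t ^+ k) (l ^+ k).
Proof.
move=> h; elim: k => [|k IH].
  rewrite expr0; apply: cvg_trans (ccvg_cst 1); apply: near_eq_cvg; near=> t; by rewrite expr0.
rewrite exprS; apply: cvg_trans (ccvgM h IH); apply: near_eq_cvg; near=> t; by rewrite exprS.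
Unshelve. all: by end_near.
Qed.

(** Divided by t, the coefficient of order 2 j behaves like t^(j - 1), so only order 2 survives. The
    shift by one leaves out order 0, which is constant. *)
Lemma ccvg_gauss_coef_slope z i :
  ccvg (fun t => (t^-1 * gauss_coef (qint t z) i.+1)%:C) (if i == 1%N then - (q1 z)%:C else 0).
Proof.
rewrite /gauss_coef; case: (boolP (odd i.+1)) => [io|ie].
  have -> : (i == 1%N) = false by case: i io => [|[|i]].
  by apply: cvg_trans (ccvg_cst 0); apply: near_eq_cvg; near=> t; rewrite mulr0 rmorph0.
have [j ij] : exists j, i = j.*2.+1.
  exists i./2; rewrite /= negbK in ie.
  by rewrite -[LHS]odd_double_half ie.
have -> : i.+1./2 = j.+1 by rewrite ij -doubleS doubleK.
have h := ccvgM (ccvg_cst (((-1) ^+ j.+1 / j.+1`!%:R)%:C))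
  (ccvgM (ccvg_qint_slope z) (ccvg_exp j (ccvg_qint z))).
have -> : (if i == 1%N then - (q1 z)%:C else 0) =
    ((-1) ^+ j.+1 / j.+1`!%:R)%:C * ((q1 z)%:C * 0 ^+ j).
  case: j ij {h} => [->|j ->]; last by rewrite eqSS double_eq0 /= expr0n !mulr0.
  by rewrite /= expr0 mulr1 expr1 factS fact0 divr1 rmorphN rmorph1 mulN1r.
apply: cvg_trans h; apply: near_eq_cvg; near=> t.
congr (cabs (_ - _)); rewrite -rmorphXn -!rmorphM; congr (_%:C).
have e (x : R) : (- x) ^+ j.+1 = (-1) ^+ j.+1 * (x * x ^+ j).
  by rewrite -[- x]mulN1r (exprMn j.+1) (exprS x).
rewrite e; ring.
Unshelve. all: by end_near.
Qed.

(** Order 0 of the Gaussian factor contributes the moving power, whose derivative is [dpow]; order 2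
    contributes the carre du champ, and the other orders vanish in the limit. *)
Lemma poly_cvg_hermite z k :
  poly_cvg (fun t => (t^-1)%:C *: (hermite_op (qint t z) (flow t z) k - field_op z ^+ k))
    (drift_gen (field_op z ^+ k)).
Proof.
have hA : polynomial (field_op z) by exact: polynomial_field_op.
have fA : poly_cvg (fun t => field_op (flow t z)) (field_op z).
  have h := poly_cvgD (poly_cvgZ (ccvg_flow z) (poly_cvg_const (polynomial_Cre R)))
    (poly_cvgZ (ccvgM (ccvg_cst (-1)) (ccvg_conj (ccvg_flow z))) (poly_cvg_const (polynomial_Ann R))).
  by apply: poly_cvg_eq h => [t|]; rewrite /field_op mulN1r scaleNr.
have fD : poly_cvg (fun t => (t^-1)%:C *: (field_op (flow t z) - field_op z))
    (field_op (Zmap Omega kappa u v z)).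
  have h := poly_cvgD (poly_cvgZ (ccvg_flow_slope z) (poly_cvg_const (polynomial_Cre R)))
    (poly_cvgZ (ccvgM (ccvg_cst (-1)) (ccvg_conj (ccvg_flow_slope z))) (poly_cvg_const (polynomial_Ann R))).
  apply: poly_cvg_eq h => [t|]; rewrite /field_op mulN1r scaleNr //.
  rewrite conjM conj_real -[X in X - _]scalerA -[X in _ - X]scalerA -scalerBr; congr (_ *: _).
  have -> : (flow t z - z)^* = (flow t z)^* - z^* by exact: rmorphB.
  by rewrite !scalerBl; abel.
have h := poly_cvgD (poly_cvg_dpow k hA fA fD) (poly_cvg_sum (index_iota 0 k)
  (fun i => poly_cvgZ (ccvgM (ccvg_cst (k`!%:R / (k - i.+1)`!%:R)%:C) (ccvg_gauss_coef_slope z i))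
     (poly_cvgX (k - i.+1) fA))).
apply: poly_cvg_eq h => [t|].
  rewrite /hermite_op big_nat_recl // subn0 /gauss_coef /= expr0 fact0 invr1 mulr1 mulr1.
  rewrite divff; last by rewrite pnatr_eq0 -lt0n fact_gt0.
  rewrite rmorph1 scale1r [X in _ = _ *: X]addrAC [RHS]scalerDr; congr (_ + _).
  rewrite scaler_sumr; apply: eq_bigr => i _; rewrite scalerA -!rmorphM; congr (_%:C *: _).
  by rewrite mulrCA.
rewrite /drift_gen (quad_gen_exp _ _ _ _ _ _ _ _ (ad_Ann_field_op z) (ad_Cre_field_op z)).
rewrite -/drift_gen drift_gen_field_op; congr (_ + _); rewrite carre_du_champ.
case: k => [|[|k]].
- by rewrite big_nil bin_small // mul0r scale0r.
- by rewrite big_nat1 bin_small // mul0r scale0r /= mulr0 scale0r.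
rewrite (bigD1_seq 1%N) ?mem_index_iota ?iota_uniq //= big1 ?addr0; last first.
  by move=> i /negPf ->; rewrite mulr0 scale0r.
congr (_ *: _); rewrite /q1 /= !mulrN; congr (- _).
have -> : (complex.Re (z^* * Cmap u v z))%:C = 2 * (2^-1 * complex.Re (z^* * Cmap u v z))%:C.
  by rewrite -(rmorph_nat (real_complex R)) -rmorphM mulrA mulfV ?mul1r // pnatr_eq0.
rewrite mulrA; congr (_ * _).
have e : ('C(k.+2, 2) * 2 * k`! = k.+2`!)%N by rewrite -(bin_fact (_ : (2 <= k.+2)%N)) // subn2 /= -mulnA.
have f0 : k`!%:R != 0 :> R by rewrite pnatr_eq0 -lt0n fact_gt0.
have -> : (k.+2 - 2 = k)%N by rewrite subn2.
rewrite -e !natrM mulfK // rmorphM !rmorph_nat //.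
Qed.

Lemma generator_power z k :
  generator U (embed b s (field_op z ^+ k)) (embed b s (drift_gen (field_op z ^+ k))).
Proof.
have hp : polynomial (field_op z ^+ k) by apply: poly_inX; exact: polynomial_field_op.
have hf := poly_cvg_hermite z k; have [hft hfp] := poly_cvg_polynomial hf.
split; [exact: embed_hs|exact: embed_hs|].
apply: hsnorm_sq_cvg.
apply: cvg_trans (poly_cvg_embed b0 s0 s1 hf); apply: near_eq_cvg.
apply: filterS (nbhs_right_gt 0) => t t0.
have hH : polynomial (hermite_op (qint t z) (flow t z) k).
  apply: linear_closed_sum => [|i]; first exact: poly_in_closed.
  by apply: poly_inZ; apply: poly_inX; exact: polynomial_field_op.
have hB : polynomial (hermite_op (qint t z) (flow t z) k - field_op z ^+ k).
  by rewrite -scaleN1r addrC; exact: (poly_in_closed _ _).2.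
have e : (t^-1)%:C *: (U t (embed b s (field_op z ^+ k)) - embed b s (field_op z ^+ k)) =
    embed b s ((t^-1)%:C *: (hermite_op (qint t z) (flow t z) k - field_op z ^+ k) : E).
  rewrite (semigroup_power b0 s0 s1 T_gaussian U_induced z k (ltW t0)).
  by rewrite (embedZ b0 s0 s1 _ hB) (embedB b0 s0 s1 hH hp).
by rewrite e.
Qed.

(** The induction also carries [polynomial p], because linearity of [embed] is established on
    polynomials. *)
Lemma generator_polynomial p : polynomial p ->
  generator U (embed b s p) (embed b s (drift_gen p)).
Proof.
move=> hp; suff [] : polynomial p /\ generator U (embed b s p) (embed b s (drift_gen p)) by [].
apply: (polynomial_ind (V := fun p => polynomial p /\
  generator U (embed b s p) (embed b s (drift_gen p)))) hp.
- split.
    split; first exact: polynomial0.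
    (* The pair (0, 0) is obtained by subtracting an element of the graph from itself. *)
    have h := generator_power 0 1; have [hU _] := U_induced.
    have := generator_lin hU (-1) h h.
    rewrite !scaleN1r !addNr.
    have -> : drift_gen 0 = 0.
      by have := drift_gen_linear (-1) 0 0; rewrite !scaleN1r !addNr.
    by rewrite embed0.
  move=> k q r [hq gq] [hr gr]; split; first exact: (poly_in_closed _ _).2.
  have [hU _] := U_induced; rewrite drift_gen_linear (embed_lin b0 s0 s1 k hq hr).
  rewrite (embed_lin b0 s0 s1 k (polynomial_drift_gen hq) (polynomial_drift_gen hr)).
  exact: (generator_lin hU k gq gr).
move=> z k; split; last exact: generator_power.
by apply: poly_inX; exact: polynomial_field_op.
Qed.

End GaussianGenerator.

(** * First-order polynomials and eigenvectors *)

Section FirstOrder.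
Variable R : realType.
Local Notation C := R[i].
Local Notation op := (fock R -> fock R).
Local Notation V := (nat -> C).
Local Notation E := (seq_end R).
Implicit Types (p : E).

Lemma field_op_exp_local z k (x : V) m : (forall n, (n <= m + k)%N -> x n = 0) ->
  (field_op z ^+ k) x m = 0.
Proof.
elim: k m => [|k IH] m hx; first by rewrite expr0 seq_end1E hx // leq_addr.
rewrite field_op_exprS !IH ?mulr0 ?subr0 // => n nm; apply: hx; lia.
Qed.

(** A component of [p x] depends on finitely many components of [x]. This replaces continuity: on
    the space of all sequences, the values at the basis vectors do not determine a linear map. *)
Lemma polynomial_local p : polynomial p -> exists d, forall (x : V) m,
  (forall n, (n <= m + d)%N -> x n = 0) -> p x m = 0.
Proof.
apply: (polynomial_ind (V := fun p : E => exists d, forall (x : V) m,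
  (forall n, (n <= m + d)%N -> x n = 0) -> p x m = 0)).
  split; first by exists 0%N.
  move=> k q r [d hd] [d' hd']; exists (d + d')%N => x m hx.
  have -> : (k *: q + r) x m = k * q x m + r x m by [].
  by rewrite hd ?hd' ?mulr0 ?addr0 // => n nm; apply: hx; lia.
by move=> z k; exists k => x m; exact: field_op_exp_local.
Qed.

Lemma polynomial_entry0 p : polynomial p -> (forall m n, entry p m n = 0) -> p = 0.
Proof.
move=> /polynomial_local[d hd] hp; apply: seq_end_ext => x; apply/funext => m.
have -> : p x = p (x - finite_seq (m + d).+1 x) + p (finite_seq (m + d).+1 x).
  by rewrite -seq_end_funD subrK.
have -> : forall y y' : V, (y + y') m = y m + y' m by [].
rewrite hd; last first.
  move=> n nm; have -> : (x - finite_seq (m + d).+1 x) n = x n - finite_seq (m + d).+1 x n by [].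
  by rewrite finite_seqE ltnS nm subrr.
rewrite add0r /finite_seq seq_end_fun_sum seq_sumE big1 // => n _.
by rewrite seq_end_funZ seq_scaleE -/(entry p m n) hp mulr0.
Qed.

(** Injectivity, from positivity of the weights: it brings equations for the generator back to the
    algebra and keeps eigenvectors nonzero. *)
Lemma embed_eq0 (b s : R) p : 0 < b -> 0 <= s -> s <= 1 -> polynomial p ->
  embed b s p = 0 -> p = 0.
Proof.
move=> b0 s0 s1 hp e0; apply: polynomial_entry0 => // m n.
have [_ /(_ m n)] := embedP b0 (polynomial_decay b0 s0 s1 hp).
rewrite e0 => h; have {h} : (wt b s m n)%:C * entry p m n = 0 by rewrite -h.
move/eqP; rewrite mulf_eq0 => /orP[|/eqP//].
by rewrite fmorph_eq0 gt_eqF // wt_gt0.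
Qed.

Definition first_order_op (c0 c1 c2 : C) : E := c0%:A + c1 *: Ann R + c2 *: Cre R.

Lemma first_orderP (X : V -> V) : first_order X ->
  exists c0 c1 c2, (c1, c2) != (0, 0) /\ X = first_order_op c0 c1 c2.
Proof. by move=> [c0 [c1 [c2 [h ->]]]]; exists c0, c1, c2; split. Qed.

Lemma polynomial_first_order c0 c1 c2 : polynomial (first_order_op c0 c1 c2).
Proof.
apply: poly_inD; [apply: poly_inD; first exact: poly_in_scalar|]; apply: poly_inZ.
  exact: polynomial_Ann.
exact: polynomial_Cre.
Qed.

Lemma ad_Ann_first_order c0 c1 c2 : ad (Ann R) (first_order_op c0 c1 c2) = c2%:A.
Proof.
by rewrite /first_order_op !adDr !adZr ad1 adxx ad_Ann_Cre !scaler0 !add0r.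
Qed.

Lemma ad_Cre_first_order c0 c1 c2 : ad (Cre R) (first_order_op c0 c1 c2) = (- c1)%:A.
Proof.
by rewrite /first_order_op !adDr !adZr ad1 adxx ad_Cre_Ann !scaler0 addr0 add0r scalerA mulrN1.
Qed.

Lemma scalar_inj (x y : C) : x%:A = y%:A :> E -> x = y.
Proof.
move/eqP; rewrite -subr_eq0 -scalerBl scaler_eq0 oner_eq0 orbF subr_eq0 => /eqP; exact.
Qed.

Lemma det_mx2 (A : 'M[C]_2) : \det A = A 0 0 * A 1 1 - A 0 1 * A 1 0.
Proof.
have l00 : lift (0 : 'I_2) (0 : 'I_1) = 1 by apply/val_inj.
have l10 : lift (1 : 'I_2) (0 : 'I_1) = 0 by apply/val_inj.
rewrite (expand_det_row _ 0) !big_ord_recl big_ord0 addr0 l00 /cofactor !det_mx11 !mxE /= l00 l10.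
by rewrite expr0 expr1 mul1r mulN1r mulrN.
Qed.

Variables (Omega : R) (kappa : C) (u v : 'I_2 -> C).
Let L := drift_gen Omega kappa u v.

(** Commutators with a and a^+ extract a linear system for the vector (c2, - c1), whose matrix is
    the drift written in the coordinates z and conjugate z. Its characteristic polynomial is that of
    the drift matrix. *)
Lemma first_order_eigenvalue c0 c1 c2 lam : (c1, c2) != (0, 0) ->
  L (first_order_op c0 c1 c2) = lam *: first_order_op c0 c1 c2 ->
  eigenvalue (cdrift_mx Omega kappa u v) lam.
Proof.
move=> c12; set X := first_order_op c0 c1 c2.
have hA := ad_Ann_first_order c0 c1 c2; have hC := ad_Cre_first_order c0 c1 c2.
rewrite /L /drift_gen (quad_genX _ _ _ _ _ _ _ hA hC).
set w := 'i * _ - _; set ik := 'i * kappa => LX.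
have e1 : c2 * w + (- c1) * ik = lam * c2.
  have := congr1 (ad (Ann R)) LX; rewrite adDr !adZr hA.
  rewrite !adDr !adZr ad_Ann_Cre adxx !scaler0 !add0r !scalerA -scalerDl.
  exact: scalar_inj.
have e2 : c2 * ik^* - c1 * w^* = - (lam * c1).
  have := congr1 (ad (Cre R)) LX; rewrite adDr !adZr hC.
  rewrite !adDr !adZr ad_Cre_Ann adxx !scaler0 !addr0 !scalerA -scalerDl.
  by move/scalar_inj => h; rewrite -mulrN -h; ring.
(* The characteristic equation of that system; a nonzero coefficient among [c1], [c2] is
   cancelled. *)
have detE : (w - lam) * (w^* - lam) = ik * ik^*.
  have [c10|c10] := eqVneq c1 0.
    have c20 : c2 != 0 by apply: contraNneq c12 => ->; rewrite c10.
    apply: (mulfI c20); move: e1 e2; rewrite c10 => e1 e2.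
    have -> : c2 * ((w - lam) * (w^* - lam)) = (c2 * w + - 0 * ik - lam * c2) * (w^* - lam) by ring.
    rewrite e1 subrr mul0r.
    have -> : c2 * (ik * ik^*) = ik * (c2 * ik^* - 0 * w^*) by ring.
    by rewrite e2 mulr0 oppr0 mulr0.
  apply: (mulfI c10).
  have h1 : c2 * (w - lam) = c1 * ik.
    have -> : c2 * (w - lam) = (c2 * w + - c1 * ik) - lam * c2 + c1 * ik by ring.
    by rewrite e1 subrr add0r.
  have h2 : c1 * (w^* - lam) = c2 * ik^*.
    have -> : c1 * (w^* - lam) = c2 * ik^* - ((c2 * ik^* - c1 * w^*) + lam * c1) by ring.
    by rewrite e2 addNr subr0.
  have -> : c1 * ((w - lam) * (w^* - lam)) = (w - lam) * (c1 * (w^* - lam)) by ring.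
  rewrite h2; have -> : (w - lam) * (c2 * ik^*) = (c2 * (w - lam)) * ik^* by ring.
  by rewrite h1; ring.
have /det0P[x x0 hx] : \det (cdrift_mx Omega kappa u v - lam%:M) == 0.
  rewrite det_mx2 !mxE /= !mulr1n !mulr0n !subr0 subr_eq0; apply/eqP.
  have i2 : ('i : C) * 'i = -1 by rewrite -expr2 sqr_i.
  have wc : w^* = - ('i * Omega%:C) - (gamma u v)%:C.
    by rewrite /w rmorphB /= conjM !conj_real conj_i mulNr.
  have kE : kappa = (complex.Re kappa)%:C + 'i * (complex.Im kappa)%:C by exact: complexE.
  have kc : kappa^* = (complex.Re kappa)%:C - 'i * (complex.Im kappa)%:C.
    by rewrite {1}kE conjD conjM !conj_real conj_i mulNr.
  rewrite !(rmorphB, rmorphD, rmorphN) /=.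
  move: detE; set p := (complex.Re kappa)%:C in kE kc *; set q := (complex.Im kappa)%:C in kE kc *.
  rewrite wc /w /ik conjM conj_i kc kE.
  clear kE kc wc e1 e2 LX; clearbody p q; clear w ik.
  move: p q (gamma u v)%:C Omega%:C => p q g o h.
  (* The square of i stays symbolic for [ring] and is replaced by -1 afterwards. *)
  have h1 : (g + lam) ^+ 2 - 'i * 'i * o ^+ 2 = - ('i * 'i) * (p ^+ 2 - 'i * 'i * q ^+ 2).
    apply: etrans (etrans h _); ring.
  rewrite i2 in h1.
  have h2 : (g + lam) ^+ 2 = p ^+ 2 + q ^+ 2 - o ^+ 2.
    have -> : (g + lam) ^+ 2 = ((g + lam) ^+ 2 - -1 * o ^+ 2) - o ^+ 2 by ring.
    by rewrite h1; ring.
  have -> : (- g - q - lam) * (- g + q - lam) = (g + lam) ^+ 2 - q ^+ 2 by ring.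
  by rewrite h2; ring.
apply/eigenvalueP; exists x => //.
by move/eqP: hx; rewrite mulmxBr mul_mx_scalar subr_eq0 => /eqP.
Qed.

(* A linear functional of the symplectic plane avoiding two given lines. *)
Lemma separating_first_order c1 c2 d1 d2 : (c1, c2) != (0 : C, 0 : C) -> (d1, d2) != (0 : C, 0 : C) ->
  exists t : C, c2 - t * c1 != 0 /\ d2 - t * d1 != 0.
Proof.
move=> hc hd.
have uniq2 (a b t t' : C) : (a, b) != (0, 0) -> t != t' -> b - t * a = 0 -> b - t' * a != 0.
  move=> hab tt' e1; apply: contra hab => /eqP e2.
  have a0 : a = 0.
    have /eqP : (t' - t) * a = 0.
      have -> : (t' - t) * a = (b - t * a) - (b - t' * a) by ring.
      by rewrite e1 e2 subrr.
    by rewrite mulf_eq0 subr_eq0 eq_sym (negPf tt') /= => /eqP.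
  by move: e1; rewrite a0 mulr0 subr0 => ->.
have n01 : (0 : C) != 1 by rewrite eq_sym oner_eq0.
have n02 : (0 : C) != 2 by rewrite eq_sym pnatr_eq0.
have n12 : (1 : C) != 2 by rewrite -[1]/(1%:R) eqr_nat.
have [z0|z0] := eqVneq (c2 - 0 * c1) 0; have [y0|y0] := eqVneq (d2 - 0 * d1) 0;
  last by exists 0.
- by exists 1; split; [exact: uniq2 z0|exact: uniq2 y0].
- have [y1|y1] := eqVneq (d2 - 1 * d1) 0.
    by exists 2; split; [exact: uniq2 z0|exact: uniq2 y1].
  by exists 1; split => //; exact: uniq2 z0.
have [z1|z1] := eqVneq (c2 - 1 * c1) 0.
  by exists 2; split; [exact: uniq2 z1|exact: uniq2 y0].
by exists 1; split => //; exact: uniq2 y0.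
Qed.

Lemma monomialE (X Y : E) n m : monomial X Y n m = X ^+ n * Y ^+ m.
Proof. by apply/funext => x; rewrite seq_endME !seq_endXE. Qed.

Lemma ad_first_order c0 c1 c2 d0 d1 d2 :
  exists k : C, ad (first_order_op d0 d1 d2) (first_order_op c0 c1 c2) = k%:A.
Proof.
exists (d1 * c2 + d2 * - c1).
rewrite {1}/first_order_op !adDl !adZl ad_Ann_first_order ad_Cre_first_order.
by rewrite adC ad1 oppr0 scaler0 add0r !scalerA scalerDl.
Qed.

(** The first case of [lower_order], transcribed from functions on sequences into the algebra. *)
Definition monomial_span (X Y : E) n m (p : E) := exists c : nat -> nat -> C,
  p = \sum_(i < n + m) \sum_(j < n + m | (i + j <= n + m - 2)%N) c i j *: (X ^+ i * Y ^+ j).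

Lemma monomial_span_closed X Y n m : linear_closed (monomial_span X Y n m).
Proof.
split.
  exists (fun _ _ => 0); rewrite big1 // => i _; rewrite big1 // => j _; exact: scale0r.
move=> k p q [c ->] [c' ->]; exists (fun i j => k * c i j + c' i j).
rewrite scaler_sumr -big_split; apply: eq_bigr => i _ /=.
rewrite scaler_sumr -big_split; apply: eq_bigr => j _ /=.
by rewrite scalerA -scalerDl.
Qed.

Lemma monomial_span_mono X Y n m i j : (2 <= n + m)%N -> (i + j <= n + m - 2)%N ->
  monomial_span X Y n m (X ^+ i * Y ^+ j).
Proof.
move=> nm ij; exists (fun i' j' => ((i' == i) && (j' == j))%:R).
have iN : (i < n + m)%N by lia.
have jN : (j < n + m)%N by lia.
rewrite (bigD1 (Ordinal iN)) //= (bigD1 (Ordinal jN)) //= !eqxx scale1r.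
rewrite big1 ?addr0; last first.
  move=> j' /andP[_ /negPf h]; rewrite -val_eqE /= in h; by rewrite h scale0r.
rewrite big1 ?addr0 // => i' /negPf h; rewrite -val_eqE /= in h.
by rewrite big1 // => j' _; rewrite h scale0r.
Qed.

Lemma monomial_span_lower X Y n m p : (2 <= n + m)%N -> monomial_span X Y n m p ->
  lower_order X Y n m p.
Proof.
move=> nm [c ->]; rewrite /lower_order nm; exists c.
have sumE (I : Type) (r : seq I) (P : pred I) (F : I -> E) :
    (\sum_(i <- r | P i) F i : E) = \sum_(i <- r | P i) (F i : V -> V) :> (V -> V).
  by apply: big_morph.
rewrite sumE; apply: eq_bigr => i _; rewrite sumE; apply: eq_bigr => j _.
by rewrite monomialE.
Qed.

Variables (c0 c1 c2 d0 d1 d2 lam mu e : C).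
Let X := first_order_op c0 c1 c2.
Let Y := first_order_op d0 d1 d2.
Hypotheses (LX : L X = lam *: X) (LY : L Y = mu *: Y - e *: X).

Lemma drift_gen_monomial : exists al be ga : C, forall n m, L (X ^+ n * Y ^+ m) =
  (n%:R * lam + m%:R * mu) *: (X ^+ n * Y ^+ m)
  - (m%:R * e) *: (X ^+ n.+1 * Y ^+ m.-1)
  + (('C(n, 2)%:R * al) *: (X ^+ (n - 2) * Y ^+ m)
   + ((n * m)%:R * be) *: (X ^+ n.-1 * Y ^+ m.-1)
   + ('C(m, 2)%:R * ga) *: (X ^+ n * Y ^+ (m - 2))).
Proof.
have [k hk] := ad_first_order c0 c1 c2 d0 d1 d2.
(* The three constants are read off from [quad_gen_monomial] by unification. *)
do 3! eexists; move=> n m.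
exact: (quad_gen_monomial (ad_Ann_first_order _ _ _) (ad_Cre_first_order _ _ _)
  (ad_Ann_first_order _ _ _) (ad_Cre_first_order _ _ _) hk LX LY (erefl _)).
Qed.

(** Nonzero coefficients occur only at monomials of degree n + m - 2; when n + m < 2 both binomial
    coefficients and n m vanish. *)
Lemma drift_gen_monomial_lower n m : exists Rem : E,
  [/\ lower_order X Y n m Rem, polynomial Rem & L (X ^+ n * Y ^+ m) =
  (n%:R * lam + m%:R * mu) *: (X ^+ n * Y ^+ m)
  - (m%:R * e) *: (X ^+ n.+1 * Y ^+ m.-1) + Rem].
Proof.
have [al [be [ga h]]] := drift_gen_monomial.
have hX : polynomial X by exact: polynomial_first_order.
have hY : polynomial Y by exact: polynomial_first_order.
have hM i j : polynomial (X ^+ i * Y ^+ j) by apply: poly_inM; exact: poly_inX.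
exists (('C(n, 2)%:R * al) *: (X ^+ (n - 2) * Y ^+ m)
   + ((n * m)%:R * be) *: (X ^+ n.-1 * Y ^+ m.-1)
   + ('C(m, 2)%:R * ga) *: (X ^+ n * Y ^+ (m - 2))).
split; last exact: h.
  have [nm|nm] := leqP 2 (n + m).
    apply: monomial_span_lower => //.
    have one (c : C) i j : (c != 0 -> (i + j <= n + m - 2)%N) ->
        monomial_span X Y n m (c *: (X ^+ i * Y ^+ j)).
      have [->|c_neq0 /(_ isT) ij] := eqVneq c 0.
        by move=> _; rewrite scale0r; case: (monomial_span_closed X Y n m).
      apply: linear_closedZ; first exact: monomial_span_closed.
      exact: monomial_span_mono.
    apply: linear_closedD; [exact: monomial_span_closed|apply: linear_closedD|].
    - exact: monomial_span_closed.
    - by apply: one; case: n {h nm} => [|[|n]]; rewrite ?mul0r ?eqxx // => _; lia.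
    - apply: one; case: n {h nm} => [|n]; first by rewrite mul0r eqxx.
      by case: m => [|m]; rewrite ?muln0 ?mul0r ?eqxx // => _; lia.
    - by apply: one; case: m {h nm} => [|[|m]]; rewrite ?mul0r ?eqxx // => _; lia.
  rewrite /lower_order leqNgt nm /=.
  case: n nm {h} => [|[|n]]; case: m => [|[|m]] //= _;
    by rewrite ?(bin_small, mul0r, muln0, mul0n, scale0r, addr0).
by apply: poly_inD; [apply: poly_inD|]; apply: poly_inZ; exact: hM.
Qed.

Hypotheses (e0 : e = 0) (hc : (c1, c2) != (0, 0)) (hd : (d1, d2) != (0, 0)).
Hypotheses (lam_stable : complex.Re lam < 0) (mu_stable : complex.Re mu < 0).

(** With [e = 0] the operator is triangular on monomials, and negative real parts keep all weights
    of positive degree away from 0. *)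
Lemma drift_gen_eigenvector n m : exists p : E, [/\ polynomial p, p != 0 &
  L p = (n%:R * lam + m%:R * mu) *: p].
Proof.
have [al [be [ga h]]] := drift_gen_monomial.
have h' i j : L (X ^+ i * Y ^+ j) =
  (i%:R * lam + j%:R * mu) *: (X ^+ i * Y ^+ j)
  + (('C(i, 2)%:R * al) *: (X ^+ (i - 2) * Y ^+ j)
   + ((i * j)%:R * be) *: (X ^+ i.-1 * Y ^+ j.-1)
   + ('C(j, 2)%:R * ga) *: (X ^+ i * Y ^+ (j - 2))).
  by rewrite h e0 mulr0 scale0r subr0.
have w0 i j : (0 < i + j)%N -> i%:R * lam + j%:R * mu != 0.
  move=> ij; apply/eqP => /(congr1 (@complex.Re R)).
  have -> : complex.Re (i%:R * lam + j%:R * mu) = i%:R * complex.Re lam + j%:R * complex.Re mu.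
    rewrite -!(rmorph_nat (real_complex R)).
    by case: lam mu => [a1 a2] [b1 b2] /=; rewrite !mul0r !subr0.
  have a0 : i%:R * complex.Re lam <= 0 by rewrite mulr_ge0_le0 // ltW.
  have b0 : j%:R * complex.Re mu <= 0 by rewrite mulr_ge0_le0 // ltW.
  case: i ij a0 => [|i] ij a0.
    have : j%:R * complex.Re mu < 0 by rewrite pmulr_rlt0 // ltr0n.
    move=> b1 /=; lra.
  have : i.+1%:R * complex.Re lam < 0 by rewrite pmulr_rlt0 // ltr0n.
  move=> a1 /=; lra.
have [q hq Lq] := eigenvector_monomial (@drift_gen_linear R Omega kappa u v) h' w0 n m.
have hX : polynomial X by exact: polynomial_first_order.
have hY : polynomial Y by exact: polynomial_first_order.
have hM i j : polynomial (X ^+ i * Y ^+ j) by apply: poly_inM; exact: poly_inX.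
(* The operator a + t a^+ has commutator c2 - t c1 with [X] and d2 - t d1 with [Y]; [t] makes both
   nonzero. *)
have [t [tX tY]] := separating_first_order hc hd.
pose l := first_order_op 0 1 t.
have lX : ad l X = (c2 - t * c1)%:A.
  rewrite /l {1}/first_order_op scale0r add0r scale1r adDl adZl.
  by rewrite ad_Ann_first_order ad_Cre_first_order scalerA mulrN -scalerDl.
have lY : ad l Y = (d2 - t * d1)%:A.
  rewrite /l {1}/first_order_op scale0r add0r scale1r adDl adZl.
  by rewrite ad_Ann_first_order ad_Cre_first_order scalerA mulrN -scalerDl.
exists (X ^+ n * Y ^+ m + q); split => //.
  apply: poly_inD; first exact: hM.
  apply: (low_span_sub (poly_in_closed _ _) _ hq) => i j _; exact: hM.
exact: monomial_low_span_neq0 lX lY tX tY hq.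
Qed.

End FirstOrder.

(** * Transfer between the generator and the algebra *)

Section Spectrum.
Variable R : realType.
Local Notation C := R[i].
Local Notation op := (fock R -> fock R).
Local Notation E := (seq_end R).
Variables (Omega : R) (kappa : C) (u v : 'I_2 -> C) (b s : R).
Variables (T U : R -> op -> op).
Hypotheses (b0 : 0 < b) (s0 : 0 <= s) (s1 : s <= 1).
Hypotheses (T_gaussian : gaussian_qms Omega kappa 0 u v T).
Hypotheses (U_induced : induced_semigroup b s T U).
Let L := drift_gen Omega kappa u v.
Let Lp p := generator_polynomial b0 s0 s1 T_gaussian U_induced (p := p).

(** The generator is single-valued and [embed] is injective on polynomials, so equations for the
    generator become identities in the algebra. *)
Lemma generator_drift_gen p q : polynomial p -> polynomial q ->
  generator U (embed b s p) (embed b s q) -> L p = q.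
Proof.
move=> hp hq h; have [hU _] := U_induced.
have hLp : polynomial (L p) by exact: polynomial_drift_gen.
have e := generator_unique hU (Lp hp) h.
apply/eqP; rewrite -subr_eq0; apply/eqP.
apply: (embed_eq0 b0 s0 s1); first by rewrite -scaleN1r addrC; exact: (poly_in_closed _ _).2.
by rewrite (embedB b0 s0 s1 hLp hq) e subrr.
Qed.

Lemma drift_gen_generator_eigenvalue p l : polynomial p -> p != 0 -> L p = l *: p ->
  generator_eigenvalue U l.
Proof.
move=> hp p0 h; exists (embed b s p).
  by apply: contra p0 => /eqP e; apply/eqP; exact: (embed_eq0 b0 s0 s1 hp e).
by have := Lp hp; rewrite -/L h (embedZ b0 s0 s1).
Qed.

End Spectrum.

Unset Implicit Arguments.
Set Strict Implicit.

Theorem theorem3p3 (R : realType) (Omega : R) (kappa zeta : R[i])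
  (u v : 'I_2 -> R[i]) (s : R)
  (T U : R -> (fock R -> fock R) -> (fock R -> fock R))
  (T_gaussian : gaussian_qms Omega kappa zeta u v T)
  (Z_stable : stable Omega kappa u v)
  (rho_invariant : unique_faithful_invariant T (thermal (beta u v) 1))
  (beta_gt0 : 0 < beta u v)
  (std : standardized kappa zeta u v)
  (s_ge0 : 0 <= s) (s_le1 : s <= 1)
  (U_induced : induced_semigroup (beta u v) s T U) :
  (diagonalizable (cdrift_mx Omega kappa u v) ->
   forall (X Y : (nat -> R[i]) -> (nat -> R[i])) (lambda mu : R[i]),
   first_order X -> first_order Y ->
   generator U (embed (beta u v) s X) (lambda *: embed (beta u v) s X) ->
   generator U (embed (beta u v) s Y) (mu *: embed (beta u v) s Y) ->
   (forall n m : nat, exists2 Rem, lower_order X Y n m Rem &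
      generator U (embed (beta u v) s (monomial X Y n m))
        ((n%:R * lambda + m%:R * mu) *: embed (beta u v) s (monomial X Y n m)
         + embed (beta u v) s Rem)) /\
   (forall n m : nat, generator_eigenvalue U (n%:R * lambda + m%:R * mu))) /\
  (~ diagonalizable (cdrift_mx Omega kappa u v) ->
   forall (X Y : (nat -> R[i]) -> (nat -> R[i])) (lambda : R[i]),
   first_order X -> first_order Y ->
   generator U (embed (beta u v) s X) (lambda *: embed (beta u v) s X) ->
   generator U (embed (beta u v) s Y)
     (lambda *: embed (beta u v) s Y - embed (beta u v) s X) ->
   (forall n m : nat, exists2 Rem, lower_order X Y n m Rem &
      generator U (embed (beta u v) s (monomial X Y n m))
        ((n + m)%:R * lambda *: embed (beta u v) s (monomial X Y n m)
         - m%:R *: embed (beta u v) s (monomial X Y n.+1 m.-1)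
         + embed (beta u v) s Rem)) /\
   (forall n : nat, generator_eigenvalue U (n%:R * lambda))).
Proof.
have [zeta0 _] := std; rewrite {}zeta0 in T_gaussian.
have Lp := generator_polynomial beta_gt0 s_ge0 s_le1 T_gaussian U_induced.
have L_of := generator_drift_gen beta_gt0 s_ge0 s_le1 T_gaussian U_induced.
have eig := drift_gen_generator_eigenvalue beta_gt0 s_ge0 s_le1 T_gaussian U_induced.
have eZ := embedZ beta_gt0 s_ge0 s_le1.
have eB := embedB beta_gt0 s_ge0 s_le1.
have lin (k : R[i]) (p q : seq_end R) : polynomial p -> polynomial q -> polynomial (k *: p + q).
  exact: (poly_in_closed _ _).2.
split=> _ X Y lam.
  move=> mu /first_orderP[c0 [c1 [c2 [hc ->]]]] /first_orderP[d0 [d1 [d2 [hd ->]]]].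
  have hX := polynomial_first_order c0 c1 c2; have hY := polynomial_first_order d0 d1 d2.
  rewrite -!eZ // => /(L_of _ _ hX (poly_inZ _ hX)) LX /(L_of _ _ hY (poly_inZ _ hY)) LY.
  (* Case (i) is the general monomial formula with [e = 0], case (ii) the one with [e = 1]. *)
  have LY0 : drift_gen Omega kappa u v (first_order_op d0 d1 d2) =
      mu *: first_order_op d0 d1 d2 - 0 *: first_order_op c0 c1 c2.
    by rewrite scale0r subr0.
  have hM i j : polynomial (first_order_op c0 c1 c2 ^+ i * first_order_op d0 d1 d2 ^+ j).
    by apply: poly_inM; exact: poly_inX.
  split=> n m.
    have [Rem [low hR LM]] := drift_gen_monomial_lower LX LY0 n m.
    exists Rem => //.
    have := Lp _ (hM n m); rewrite LM mulr0 scale0r subr0.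
    by rewrite (embed_lin beta_gt0 s_ge0 s_le1 _ (hM n m) hR) monomialE.
  have lam_neg := Z_stable _ (first_order_eigenvalue hc LX).
  have mu_neg := Z_stable _ (first_order_eigenvalue hd LY).
  have [p [hp p0 Lpe]] := drift_gen_eigenvector LX LY0 erefl hc hd lam_neg mu_neg n m.
  exact: eig hp p0 Lpe.
move=> /first_orderP[c0 [c1 [c2 [hc ->]]]] /first_orderP[d0 [d1 [d2 [hd ->]]]].
have hX := polynomial_first_order c0 c1 c2; have hY := polynomial_first_order d0 d1 d2.
have hYX : polynomial (lam *: first_order_op d0 d1 d2 - first_order_op c0 c1 c2).
  by apply: lin => //; rewrite -scaleN1r; exact: poly_inZ.
rewrite -!eZ // -eB //; last exact: poly_inZ.
move=> /(L_of _ _ hX (poly_inZ _ hX)) LX /(L_of _ _ hY hYX) LY.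
have LY1 : drift_gen Omega kappa u v (first_order_op d0 d1 d2) =
    lam *: first_order_op d0 d1 d2 - 1 *: first_order_op c0 c1 c2.
  by rewrite scale1r.
(* For the eigenvalues only [X] serves as an eigenvector; it is put into both slots of
   [drift_gen_eigenvector], with second exponent 0. *)
have LX0 : drift_gen Omega kappa u v (first_order_op c0 c1 c2) =
    lam *: first_order_op c0 c1 c2 - 0 *: first_order_op c0 c1 c2.
  by rewrite scale0r subr0.
have hM i j : polynomial (first_order_op c0 c1 c2 ^+ i * first_order_op d0 d1 d2 ^+ j).
  by apply: poly_inM; exact: poly_inX.
split=> [n m|n].
  have [Rem [low hR LM]] := drift_gen_monomial_lower LX LY1 n m.
  exists Rem => //.
  have hW := poly_inZ (m%:R : R[i]) (hM n.+1 m.-1).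
  have hVW := lin ((n + m)%:R * lam) _ _ (hM n m) (poly_inZ (-1) hW).
  have := Lp _ (hM n m); rewrite LM mulr1 -mulrDl -natrD.
  (* The scalars -1 and 1 are inserted to reach the form [k *: p + q] of [embed_lin]. *)
  rewrite -[in X in X + Rem]scaleN1r -[X in X + Rem]scale1r.
  rewrite (embed_lin beta_gt0 s_ge0 s_le1 1 hVW hR) scale1r.
  rewrite (embed_lin beta_gt0 s_ge0 s_le1 _ (hM n m) (poly_inZ (-1) hW)).
  by rewrite (eZ _ _ hW) (eZ _ _ (hM _ _)) scaleN1r !monomialE.
have lam_neg := Z_stable _ (first_order_eigenvalue hc LX).
have [p [hp p0 Lpe]] := drift_gen_eigenvector LX LX0 erefl hc hc lam_neg lam_neg n 0.
by apply: eig hp p0 _; rewrite Lpe mul0r addr0.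
Qed.
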